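(* Let $q\in\mathbb N\cup\{0\}$ and $\delta>0$. Let $h,h^\delta\in L^2(\Omega)$ and $f,f^\delta\in L^\infty(0,\tau;L^2(\Omega))$ satisfy $\|h-h^\delta\|^2+\theta\|f-f^\delta\|^2_{L^\infty(0,\tau;L^2(\Omega))}\le\delta^2$. Let $g\in L^2(\Omega)$ be the unique solution of $Tg=\Upsilon_{h,f}$ and suppose $g\in S_{\varrho,p}$ for some $\varrho,p>0$. For $\beta>0$ let $u_\beta^\delta(0)$ be the regularized solution defined in the context (with this $q$). Then: (i) For $q=0$, $0<p<2$ and the choice $\beta\sim(\delta/\varrho)^{2/(p+2)}$, there is a constant $\tilde C_8>0$, depending only on $C_6,p$, such that $\|u_\beta^\delta(0)-g\|\le \tilde C_8\,\varrho^{2/(p+2)}\delta^{p/(p+2)}$. (ii) For $q=0$, $p\ge2$ and the choice $\beta\sim(\delta/\varrho)^{1/2}$, there is a constant $\tilde C_9>0$, depending only on $C_7$, such that $\|u_\beta^\delta(0)-g\|\le \tilde C_9\,\varrho^{1/2}\delta^{1/2}$. (iii) For $q\ne0$, $0<p<q+2$ and the choice $\beta\sim(\delta/\varrho)^{(q+2)/(p+2)}$, there is a constant $C_8>0$, depending only on $C_5,C_6,p,q$, such that $\|u_\beta^\delta(0)-g\|\le C_8\,\varrho^{2/(p+2)}\delta^{p/(p+2)}$. (iv) For $q\ne0$, $p\ge q+2$ and the choice $\beta\sim(\delta/\varrho)^{(q+2)/(q+4)}$, there is a constant $C_9>0$, depending only on $C_5,C_7,q$, such that $\|u_\beta^\delta(0)-g\|\le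 C_9\,\varrho^{2/(q+4)}\delta^{(q+2)/(q+4)}$. Here $\beta\sim b$ means $c'b\le\beta\le c''b$ with fixed constants $c',c''>0$ independent of $\delta,\varrho$; the constants above may also depend on $c',c''$.
   Context: Setting: $d\in\{1,\dots,7\}$, $\Omega\subset\mathbb R^d$ is a bounded domain with sufficiently smooth boundary, $\tau>0$, $\alpha\in(0,1)$, $\mathbb N=\{1,2,\dots\}$; $\|\cdot\|$ and $\langle\cdot,\cdot\rangle$ are the norm and inner product of $L^2(\Omega)$. $0<\lambda_1<\lambda_2\le\cdots\to\infty$ are the Dirichlet eigenvalues of $-\Delta$ on $\Omega$ with eigenfunctions $\varphi_n\in H_0^1(\Omega)\cap H^2(\Omega)$ forming an orthonormal basis of $L^2(\Omega)$; $w_n=\langle w,\varphi_n\rangle$ for $w\in L^2(\Omega)$, and $z_n(s)=\langle z(s),\varphi_n\rangle$ for $z\in L^\infty(0,\tau;L^2(\Omega))$. $\theta=\sum_{n=1}^\infty\lambda_n^{-4}<\infty$. Mittag-Leffler function: $E_{\gamma,b}(z)=\sum_{k=0}^\infty z^k/\Gamma(k\gamma+b)$. $C_1,C_2>0$ are fixed constants with $\frac{C_1}{\Gamma(1-\alpha)}\frac1{1-x}\le E_{\alpha,1}(x)\le\frac{C_2}{\Gamma(1-\alpha)}\frac1{1-x}$ for all $x\le0$ (known to exist). For $h\in L^2(\Omega)$, $f\in L^\infty(0,\tau;L^2(\Omega))$: $\Psi_f^{\alpha,n}(t)=\int_0^t(t-s)^{\alpha-1}E_{\alpha,\alpha}(-\lambda_n^2(t-s)^\alpha)f_n(s)\,ds$,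 $\Upsilon_{h,f}^{\alpha,n}=h_n-\Psi_f^{\alpha,n}(\tau)$, $\Upsilon_{h,f}=\sum_n\Upsilon_{h,f}^{\alpha,n}\varphi_n\in L^2(\Omega)$. The operator $T:L^2(\Omega)\to L^2(\Omega)$ is $T\phi=\sum_nE_{\alpha,1}(-\lambda_n^2\tau^\alpha)\langle\phi,\varphi_n\rangle\varphi_n$. Source set: $S_{\varrho,p}=\{\phi\in L^2(\Omega):\|\phi\|_{H_p}\le\varrho\}$, $\|\phi\|_{H_p}^2=\sum_n\lambda_n^{2p}|\langle\phi,\varphi_n\rangle|^2$. (Modified) quasi-boundary value regularized solution: $u_\beta^\delta(0)=\sum_{n=1}^\infty\frac{h_n^\delta-\Psi_{f^\delta}^{\alpha,n}(\tau)}{E_{\alpha,1}(-\lambda_n^2\tau^\alpha)+\beta\lambda_n^q}\varphi_n$. Constants: $C_4=\frac{C_1\lambda_1^2}{\Gamma(1-\alpha)(1+\lambda_1^2\tau^\alpha)}$; $C_5=\sqrt2\,(2C_4/q)^{2/(q+2)}\frac{q}{C_4(1+q)}$ (for $q\ne0$); $C_6=\left(\frac{C_4(q+2-p)}{p}\right)^{(q+2-p)/(q+2)}\frac{p}{C_4(q+2)}$ (for $0<p<q+2$); $C_7=\frac{1}{C_4\lambda_1^{p-q-2}}$ (for $p\ge q+2$). *)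

(* Defs.v *)
From HB Require Import structures.
From mathcomp Require Import all_boot all_order all_algebra.
From mathcomp Require Import all_classical all_reals all_analysis.

Set Implicit Arguments.
Unset Strict Implicit.
Unset Printing Implicit Defensive.
Import Order.TTheory GRing.Theory Num.Theory.
Import numFieldNormedType.Exports.
Local Open Scope classical_set_scope.
Local Open Scope ring_scope.

(* The Borel sigma-algebra of R^n, generated by the coordinates. *)
Section measurable_rV.
Context {R : realType} (n : nat).

Let coors : 'I_n -> 'rV[R]_n -> R := fun i x => x ord0 i.

Let rV_set0 : g_sigma_preimage coors set0.
Proof. exact: sigma_algebra0. Qed.

Let rV_setC A : g_sigma_preimage coors A -> g_sigma_preimage coors (~` A).
Proof. exact: sigma_algebraC. Qed.

Let rV_bigcup (F : _^nat) : (forall i, g_sigma_preimage coors (F i)) ->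
  g_sigma_preimage coors (\bigcup_i (F i)).
Proof. exact: sigma_algebra_bigcup. Qed.

HB.instance Definition _ := @isMeasurable.Build default_measure_display
  'rV[R]_n (g_sigma_preimage coors) rV_set0 rV_setC rV_bigcup.

End measurable_rV.

Lemma measurable_coord (R : realType) n (i : 'I_n) :
  measurable_fun setT (fun x : 'rV[R]_n => x ord0 i).
Proof.
move=> _ Y mY; rewrite setTI; apply: sub_sigma_algebra => /=.
rewrite -bigcup_seq/=; exists i => /=; first by rewrite mem_index_enum.
by exists Y => //; rewrite setTI.
Qed.

Lemma measurable_fun_rVP d (T : measurableType d) (R : realType) n
    (f : T -> 'rV[R]_n) :
  (forall i, measurable_fun setT (fun t => f t ord0 i)) ->
  measurable_fun setT f.
Proof.
move=> mf _ A mA; rewrite setTI; move: A mA.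
apply: smallest_sub.
  split => /=.
  - by rewrite preimage_set0.
  - by move=> B mB; rewrite setTD preimage_setC; exact: measurableC.
  - by move=> F mF; rewrite preimage_bigcup; exact: bigcup_measurable.
rewrite -bigcup_seq/= => B [i _ [Y mY <-]] /=.
by rewrite setTI -comp_preimage -[X in measurable X]setTI; exact: mf.
Qed.

Lemma open_measurable_rV (R : realType) n (U : set 'rV[R]_n) :
  open U -> measurable U.
Proof.
move=> oU.
pose B (q : 'rV[rat]_n * nat) : set 'rV[R]_n :=
  [set x | forall i, `|x ord0 i - ratr (q.1 ord0 i)| < q.2.+1%:R^-1].
have mB q : measurable (B q).
  have -> : B q = \bigcap_(i in [set: 'I_n]) [set x : 'rV[R]_n |
      x ord0 i \in `]ratr (q.1 ord0 i) - q.2.+1%:R^-1,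
                     ratr (q.1 ord0 i) + q.2.+1%:R^-1[].
    apply/seteqP; split => x /= Bx i => [_|].
      by have := Bx i; rewrite /= in_itv/= ltr_distl.
    by have := Bx i I; rewrite /= in_itv/= ltr_distl.
  apply: fin_bigcap_measurable => // i _.
  have := @measurable_coord R n i measurableT _
    (measurable_itv `]ratr (q.1 ord0 i) - q.2.+1%:R^-1,
                     ratr (q.1 ord0 i) + q.2.+1%:R^-1[).
  by rewrite setTI.
have -> : U = \bigcup_(q in [set q | B q `<=` U]) B q.
  apply/seteqP; split => [x Ux|x [q /= qU]]; last exact: qU.
  have /nbhs_ballP[e /= e0 xeU] : nbhs x U by exact: open_nbhs_nbhs.
  have [k ke] : exists k, k.+1%:R^-1 < e / 2.
    have e20 : 0 < e / 2 by rewrite divr_gt0.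
    exists (Num.bound (e / 2)^-1).
    rewrite -[ltRHS]invrK ltf_pV2 ?posrE ?invr_gt0//.
    apply: (lt_trans (archi_boundP _)); first by rewrite invr_ge0 ltW.
    by rewrite ltr_nat.
  have [q qx] : {q : 'rV[rat]_n |
      forall i, `|x ord0 i - ratr (q ord0 i)| < k.+1%:R^-1}.
    have H i : {r : rat | `|x ord0 i - ratr r| < k.+1%:R^-1}.
      apply: cid.
      have /rat_in_itvoo[r] : x ord0 i - k.+1%:R^-1 < x ord0 i + k.+1%:R^-1.
        by rewrite ltrD2l gtrN// invr_gt0.
      rewrite in_itv/= => /andP[r1 r2]; exists r.
      by rewrite ltr_distlC r1 r2.
    exists (\row_i sval (H i)) => i; rewrite mxE.
    by case: (H i).
  exists (q, k) => //= y By; apply: xeU; split => // i j.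
  rewrite ord1 /ball/=.
  rewrite -(subrKA (ratr (q ord0 j))) (le_lt_trans (ler_normD _ _))//.
  rewrite [ltRHS]splitr ltrD//; first exact: lt_trans (qx j) ke.
  by rewrite distrC; exact: lt_trans (By j) ke.
rewrite (_ : \bigcup_(q in _) B q =
    \bigcup_q (if `[< B q `<=` U >] then B q else set0)).
  apply: countable_bigcupT_measurable => // q.
  by case: ifP.
apply/seteqP; split => [x [q /= qU Bqx]|x [q _]].
  by exists q => //; case: asboolP.
by case: asboolP => // qU Bqx; exists q.
Qed.

(* Lebesgue measure on R^n, by induction on n as an iterated product;
   lebesgue_rV_box gives the volume of boxes, which characterizes it. *)
Section lebesgue_rV.
Context {R : realType}.
Local Open Scope ereal_scope.

Definition cons_rV n (p : R * 'rV[R]_n) : 'rV[R]_n.+1 :=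
  \row_i oapp (p.2 ord0) p.1 (unlift ord0 i).

Let tail_rV n (x : 'rV[R]_n.+1) : 'rV[R]_n := \row_j x ord0 (lift ord0 j).

Let tail_cons_rV n (p : R * 'rV[R]_n) : tail_rV (cons_rV p) = p.2.
Proof. by apply/rowP => j; rewrite !mxE liftK. Qed.

Let head_cons_rV n (p : R * 'rV[R]_n) : cons_rV p ord0 ord0 = p.1.
Proof. by rewrite mxE unlift_none. Qed.

Lemma measurable_cons_rV n : measurable_fun setT (@cons_rV n).
Proof.
apply: measurable_fun_rVP => i; rewrite /cons_rV.
case: (unliftP ord0 i) => [j ->|->].
  under eq_fun do rewrite mxE liftK/=.
  exact: (measurableT_comp (measurable_coord j)).
by under eq_fun do rewrite mxE unlift_none/=; exact: measurable_fst.
Qed.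

Let measurable_tail_rV n : measurable_fun setT (@tail_rV n).
Proof.
apply: measurable_fun_rVP => i; under eq_fun do rewrite mxE.
exact: measurable_coord.
Qed.

Section step.
Variables (n : nat) (m : {sigma_finite_measure set 'rV[R]_n -> \bar R}).

Definition lebesgue_rVS : set 'rV[R]_n.+1 -> \bar R :=
  pushforward (@lebesgue_measure R \x m) (@cons_rV n).

Let lebesgue_rVS0 : lebesgue_rVS set0 = 0.
Proof. by rewrite /lebesgue_rVS /pushforward preimage_set0 measure0. Qed.

Let lebesgue_rVS_ge0 A : 0 <= lebesgue_rVS A.
Proof. exact: integral_ge0. Qed.

Let measurable_preimage_cons_rV (A : set 'rV[R]_n.+1) :
  measurable A -> measurable (@cons_rV n @^-1` A).
Proof.
by move=> mA; rewrite -[X in measurable X]setTI; exact: measurable_cons_rV.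
Qed.

Let lebesgue_rVS_sigma_additive : semi_sigma_additive lebesgue_rVS.
Proof.
move=> F mF tF mUF; rewrite /lebesgue_rVS /pushforward preimage_bigcup.
apply: measure_semi_sigma_additive.
- by move=> k; exact: measurable_preimage_cons_rV.
- apply/trivIsetP => /= i j _ _ ij; rewrite -preimage_setI.
  by move/trivIsetP : tF => /(_ _ _ _ _ ij) ->//; rewrite preimage_set0.
- by rewrite -preimage_bigcup; exact: measurable_preimage_cons_rV.
Qed.

HB.instance Definition _ := isMeasure.Build _ _ _ lebesgue_rVS
  lebesgue_rVS0 lebesgue_rVS_ge0 lebesgue_rVS_sigma_additive.

Let lebesgue_rVS_sigma_finite : sigma_finite setT lebesgue_rVS.
Proof.
have /sigma_finiteP[F [FT ndF Foo]] := sigma_finiteT (@lebesgue_measure R).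
have /sigma_finiteP[G [GT ndG Goo]] := sigma_finiteT m.
exists (fun k => [set x : 'rV[R]_n.+1 | F k (x ord0 ord0) /\ G k (tail_rV x)]).
  apply/seteqP; split => // x _.
  have [i _ Fi] : (\bigcup_k F k) (x ord0 ord0) by rewrite -FT.
  have [j _ Gj] : (\bigcup_k G k) (tail_rV x) by rewrite -GT.
  exists (maxn i j) => //; split.
  - by move: Fi; exact/subsetPset/ndF/leq_maxl.
  - by move: Gj; exact/subsetPset/ndG/leq_maxr.
move=> k; have [mF Fk] := Foo k; have [mG Gk] := Goo k; split.
  apply: (@measurableI _ _ [set x : 'rV[R]_n.+1 | F k (x ord0 ord0)]).
    by have := @measurable_coord R n.+1 ord0 measurableT _ mF; rewrite setTI.
  by have := @measurable_tail_rV n measurableT _ mG; rewrite setTI.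
rewrite /lebesgue_rVS /pushforward (_ : _ @^-1` _ = F k `*` G k); last first.
  by apply/seteqP; split => -[x v] /=; rewrite head_cons_rV tail_cons_rV.
by rewrite product_measure1E// lte_mul_pinfty// ge0_fin_numE.
Qed.

HB.instance Definition _ :=
  Measure_isSigmaFinite.Build _ _ _ lebesgue_rVS lebesgue_rVS_sigma_finite.

End step.

Fixpoint lebesgue_rV n : {sigma_finite_measure set 'rV[R]_n -> \bar R} :=
  match n with
  | 0%N => @dirac _ 'rV[R]_0 (const_mx 0%R) R
  | n'.+1 => lebesgue_rVS (lebesgue_rV n')
  end.

Lemma lebesgue_rV_box n (a b : 'rV[R]_n) :
  (forall i, a ord0 i <= b ord0 i)%R ->
  lebesgue_rV n [set x | forall i, x ord0 i \in `[a ord0 i, b ord0 i]]%R =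
  (\prod_i (b ord0 i - a ord0 i))%:E.
Proof.
elim: n a b => [|n IH] a b ab /=.
  rewrite big_ord0 diracE mem_set//= => -[].
  by case.
transitivity ((@lebesgue_measure R \x lebesgue_rV n)
    (`[a ord0 ord0, b ord0 ord0]%classic `*` [set x : 'rV[R]_n |
      forall i, x ord0 i \in `[tail_rV a ord0 i, tail_rV b ord0 i]%R])).
  congr ((@lebesgue_measure R \x lebesgue_rV n) _).
  apply/seteqP; split => -[x v] /=.
    move=> H; split; first by have := H ord0; rewrite head_cons_rV.
    by move=> i; have := H (lift ord0 i); rewrite !mxE liftK.
  move=> [H1 H2] i; case: (unliftP ord0 i) => [j ->|->].
    by have := H2 j; rewrite !mxE liftK.
  by rewrite head_cons_rV.
rewrite product_measure1E//=; last first.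
  rewrite (_ : mkset _ = \bigcap_(i in [set: 'I_n]) [set x : 'rV[R]_n |
      x ord0 i \in `[tail_rV a ord0 i, tail_rV b ord0 i]%R]); last first.
    by apply/seteqP; split => x /= H i; [move=> _|]; exact: H.
  apply: fin_bigcap_measurable => // i _.
  have := @measurable_coord R n i measurableT _
    (measurable_itv `[tail_rV a ord0 i, tail_rV b ord0 i]%R).
  by rewrite setTI.
rewrite IH => [|i]; last by rewrite !mxE.
rewrite big_ord_recl lebesgue_measure_itv/= lte_fin.
under eq_bigr do rewrite !mxE.
case: ltP => ba; first by rewrite EFinM EFinB.
have -> : a ord0 ord0 = b ord0 ord0 by apply/le_anti; rewrite ab ba.
by rewrite subrr mul0r; exact: mul0e.
Qed.

End lebesgue_rV.

Definition lebesgue_on (R : realType) n (Omega : set 'rV[R]_n)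
    (oO : open Omega) : {measure set 'rV[R]_n -> \bar R} :=
  mrestr (lebesgue_rV n) (open_measurable_rV oO).

Definition lebesgue_itv (R : realType) (tau : R) :
    {measure set (measurableTypeR R) -> \bar R} :=
  mrestr (@lebesgue_measure R) (measurable_itv `]0, tau[).

(* Elements of L^2 are represented by functions in [Lfun mu 2%:E]. *)
Section L2.
Context {d : measure_display} {T : measurableType d} {R : realType}.
Variable mu : {measure set T -> \bar R}.
Implicit Types (u v w : T -> R) (c : nat -> R) (phi : nat -> T -> R).

Definition L2norm u : \bar R := 'N[mu]_2%:E[EFin \o u]%E.

Definition inner u v : R := \int[mu]_x (u x * v x).

Definition is_L2sum phi c w :=
  w \in Lfun mu 2%:E /\
  L2norm (fun x => w x - \sum_(n < N) c n * phi n x) @[N --> \oo] --> 0%E.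

Definition L2sum phi c : T -> R := xget (cst 0) [set w | is_L2sum phi c w].

Definition orthonormal_basis phi :=
  [/\ forall n, phi n \in Lfun mu 2%:E,
      forall m n, inner (phi m) (phi n) = (m == n)%:R &
      forall w, w \in Lfun mu 2%:E ->
        is_L2sum phi (fun n => inner w (phi n)) w].

Definition L2simple (s : R -> T -> R) :=
  exists (m : nat) (A : 'I_m -> set R) (v : 'I_m -> T -> R),
  [/\ forall j, measurable (A j), forall j, v j \in Lfun mu 2%:E &
      forall t x, s t x = \sum_(j < m) \1_(A j) t * v j x].

Definition strongly_measurable (tau : R) (f : R -> T -> R) :=
  exists s : nat -> R -> T -> R, (forall k, L2simple (s k)) /\
  \forall t \ae lebesgue_itv tau, L2norm (s k t \- f t) @[k --> \oo] --> 0%E.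

Definition Linf_L2norm (tau : R) (f : R -> T -> R) : \bar R :=
  'N[lebesgue_itv tau]_+oo [(fun t => L2norm (f t))]%E.

Definition Linf_L2 (tau : R) (f : R -> T -> R) :=
  [/\ forall t, 0 < t < tau -> f t \in Lfun mu 2%:E,
      strongly_measurable tau f & (Linf_L2norm tau f < +oo)%E].

End L2.

Section Sobolev.
Context {R : realType} {n : nat}.
Implicit Types (f psi u v w : 'rV[R]_n -> R) (i : 'I_n) (k : nat).

Definition partial i f : 'rV[R]_n -> R := fun x => 'D_(delta_mx ord0 i) f x.

Fixpoint Ck k f : Prop :=
  if k is k'.+1 then
    [/\ continuous f, forall i x, derivable f x (delta_mx ord0 i) &
        forall i, Ck k' (partial i f)]
  else continuous f.

(* Near each boundary point Omega is a sublevel set of a C^k function with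
   nonvanishing gradient. *)
Definition Ck_boundary k (Omega : set 'rV[R]_n) :=
  forall x, (closure Omega `\` interior Omega) x ->
  exists (U : set 'rV[R]_n) (rho : 'rV[R]_n -> R),
    [/\ open U /\ U x, Ck k rho, exists i, partial i rho x != 0 &
        Omega `&` U = [set y | U y /\ rho y < 0]].

Definition test_fun (Omega : set 'rV[R]_n) psi :=
  (forall k, Ck k psi) /\
  exists K, [/\ compact K, K `<=` Omega & forall x, ~ K x -> psi x = 0].

Variables (Omega : set 'rV[R]_n) (oO : open Omega).
Let mu := lebesgue_on oO.

Definition weak_partial i u v :=
  v \in Lfun mu 2%:E /\
  forall psi, test_fun Omega psi ->
    inner mu u (partial i psi) = - inner mu v psi.

Fixpoint sobolevH k u : Prop :=
  u \in Lfun mu 2%:E /\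
  if k is k'.+1 then
    forall i, exists v, weak_partial i u v /\ sobolevH k' v
  else True.

(* H^1_0(Omega): the closure of the test functions in H^1(Omega) *)
Definition sobolevH10 u :=
  u \in Lfun mu 2%:E /\
  exists (Du : 'I_n -> 'rV[R]_n -> R) (psi : nat -> 'rV[R]_n -> R),
  [/\ forall i, weak_partial i u (Du i), forall k, test_fun Omega (psi k),
      L2norm mu (psi k \- u) @[k --> \oo] --> 0%E &
      forall i, L2norm mu (partial i (psi k) \- Du i) @[k --> \oo] --> 0%E].

Definition weak_laplacian u w :=
  exists (Du DDu : 'I_n -> 'rV[R]_n -> R),
  [/\ forall i, weak_partial i u (Du i),
      forall i, weak_partial i (Du i) (DDu i) &
      w = (fun x => \sum_i DDu i x) %[ae mu]].

(* lam n and phi n (n = 0, 1, ...) are the (n+1)-th Dirichlet eigenvalue and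
   eigenfunction; completeness of phi ensures that every eigenvalue is listed,
   with multiplicity. *)
Definition dirichlet_eigensystem (lam : nat -> R)
    (phi : nat -> 'rV[R]_n -> R) :=
  [/\ [/\ 0 < lam 0%N, lam 0%N < lam 1%N,
          forall k, lam k <= lam k.+1 & lam k @[k --> \oo] --> +oo],
      orthonormal_basis mu phi,
      forall k, sobolevH10 (phi k) /\ sobolevH 2 (phi k) &
      forall k, weak_laplacian (phi k) (fun x => - (lam k * phi k x))].

End Sobolev.

Section special_functions.
Context {R : realType}.

Definition Gamma (x : R) : R :=
  \int[@lebesgue_measure R]_(t in `]0, +oo[) (t `^ (x - 1) * expR (- t)).

Definition mittag_leffler (a b z : R) : R :=
  limn (series (fun k => z ^+ k / Gamma (k%:R * a + b))).

End special_functions.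

Section regularization.
Context {d : measure_display} {T : measurableType d} {R : realType}.
Variables (mu : {measure set T -> \bar R}).
Variables (lam : nat -> R) (phi : nat -> T -> R) (tau alpha : R).

Definition theta : \bar R := (\sum_(0 <= n <oo) (lam n ^- 4)%:E)%E.

Definition Psi (f : R -> T -> R) (n : nat) (t : R) : R :=
  \int[@lebesgue_measure R]_(s in `]0, t[)
    ((t - s) `^ (alpha - 1) *
     mittag_leffler alpha alpha (- (lam n ^+ 2 * (t - s) `^ alpha)) *
     inner mu (f s) (phi n)).

Definition Upsilon_coef (h : T -> R) (f : R -> T -> R) (n : nat) : R :=
  inner mu h (phi n) - Psi f n tau.

Definition Upsilon (h : T -> R) (f : R -> T -> R) : T -> R :=
  L2sum mu phi (Upsilon_coef h f).

Definition eigT (n : nat) : R :=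
  mittag_leffler alpha 1 (- (lam n ^+ 2 * tau `^ alpha)).

Definition opT (w : T -> R) : T -> R :=
  L2sum mu phi (fun n => eigT n * inner mu w (phi n)).

Definition Hnorm (p : R) (w : T -> R) : \bar R :=
  sqrte (\sum_(0 <= n <oo)
    (lam n `^ (2 * p) * `|inner mu w (phi n)| ^+ 2)%:E)%E.

Definition source_set (rho p : R) : set (T -> R) :=
  [set w | w \in Lfun mu 2%:E /\ (Hnorm p w <= rho%:E)%E].

Definition qbv_solution (q : nat) (beta : R) (h : T -> R) (f : R -> T -> R) :
    T -> R :=
  L2sum mu phi (fun n => Upsilon_coef h f n / (eigT n + beta * lam n ^+ q)).

End regularization.

Section constants.
Context {R : realType}.

Definition const4 (C1 alpha lam1 tau : R) : R :=
  C1 * lam1 ^+ 2 / (Gamma (1 - alpha) * (1 + lam1 ^+ 2 * tau `^ alpha)).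

Definition const5 (C4 : R) (q : nat) : R :=
  Num.sqrt 2 * (2 * C4 / q%:R) `^ (2 / (q%:R + 2)) *
  (q%:R / (C4 * (1 + q%:R))).

Definition const6 (C4 : R) (q : nat) (p : R) : R :=
  (C4 * (q%:R + 2 - p) / p) `^ ((q%:R + 2 - p) / (q%:R + 2)) *
  (p / (C4 * (q%:R + 2))).

Definition const7 (C4 lam1 : R) (q : nat) (p : R) : R :=
  1 / (C4 * lam1 `^ (p - q%:R - 2)).

Definition comparable_to (c1 c2 x b : R) := c1 * b <= x /\ x <= c2 * b.

End constants.

(* Main.v *)
Require Import Defs.
From HB Require Import structures.
From mathcomp Require Import all_boot all_order all_algebra.
From mathcomp Require Import all_classical all_reals all_analysis.
From mathcomp Require Import measurable_realfun ring lra.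
Set Implicit Arguments.
Unset Strict Implicit.
Unset Printing Implicit Defensive.
Import Order.TTheory GRing.Theory Num.Theory.
Import numFieldNormedType.Exports.
Local Open Scope classical_set_scope.
Local Open Scope ring_scope.

(* The error u - g has the n-th coefficient
     (Y'_n - Y_n) / (E_n + beta lam_n^q) - beta lam_n^q g_n / (E_n + beta lam_n^q),
   where E_n = E_{alpha,1}(-lam_n^2 tau^alpha) >= C4 / lam_n^2, Y and Y' are the
   exact and noisy data coefficients and E_n g_n = Y_n.  Since the kernel
   (tau-s)^(alpha-1) E_{alpha,alpha}(-L (tau-s)^alpha) is non-negative with
   integral (1 - E_{alpha,1}(-L tau^alpha)) / L <= 1 / L, one has
   sum |Y'_n - Y_n|^2 <= 2 delta^2.  Both filters are bounded with
   s = beta lam_n^(q+2) through the maximum of s^w / (C4 + s), and the choice of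
   beta balances the two terms.  Non-negativity of E_{alpha,alpha} on the
   negative half-line comes from a limit of discrete resolvents.  As theta may be
   infinite a priori, square-summability of the Y_n is obtained from Bessel's
   inequality under the time integral instead of from theta. *)

(** * The Gamma function *)

(** Non-negativity of E_{a,a} on the negative half-line means monotonicity of E_{a,1}, which
    two-sided bounds on E_{a,1} cannot give. Hence the detour through 1 / ((1 - z)^a + m): all
    coefficients of (1 - z)^a after the first are non-positive, and an induction traps the
    coefficients of the resolvent between 0 and those of (1 - z)^(-a). The same induction yields
    E_{a,a}(-x) <= 1 / Gamma(a). This upper bound gives all kernels one integrable majorant
    independent of n, without which Bessel's inequality could not be summed under the time integral.
    Square-summability is indispensable because [L2sum] is a choice with a default value: the
    regularized solution and the exact data mean what they should only once their series are known
    to converge. The passage to the limit needs 1 / Gamma(s) as the limit of n^(1-s) times the n-th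
    coefficient of (1 - z)^(-s), together with decay of 1 / Gamma faster than any exponential; this
    is what the Gamma theory is for. The factor 2 in the noise bound is the price of (a - b)^2 <= 2
    (a^2 + b^2), and its root is the factor of C5. *)

Section FTC_exhaustion.
Context {R : realType}.
Let mu := @lebesgue_measure R.
Variables (D : set R) (u v : nat -> R) (f F : R -> R) (la lb : R).
Hypothesis uv : forall n, u n < v n.
Hypothesis du : nonincreasing_seq u.
Hypothesis dv : nondecreasing_seq v.
Hypothesis DE : D = \bigcup_n [set` `[u n, v n]].
Hypothesis cf : forall x, D x -> {for x, continuous f}.
Hypothesis dF : forall x, D x -> is_derive x 1 F (f x).
Hypothesis Fu : F (u n) @[n --> \oo] --> la.
Hypothesis Fv : F (v n) @[n --> \oo] --> lb.

Let subD n x : x \in `[u n, v n] -> D x.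
Proof. by move=> xn; rewrite DE; exists n. Qed.

Let mD : measurable (D : set (measurableTypeR R)).
Proof. by rewrite DE; apply: bigcup_measurable => n _; exact: measurable_itv. Qed.

Let nditv : nondecreasing_seq (fun n => [set` `[u n, v n]] : set R).
Proof.
move=> m n mn; apply/subsetPset => x /=; rewrite !in_itv/= => /andP[ux xv].
by rewrite (le_trans (du mn) ux) (le_trans xv (dv mn)).
Qed.

Lemma exhaustion_measurable : measurable_fun D f.
Proof.
rewrite DE; apply/measurable_fun_bigcup => [n|n]; first exact: measurable_itv.
apply: subspace_continuous_measurable_fun => //.
by apply: continuous_in_subspaceT => x; rewrite inE => /subD/cf.
Qed.

Let intn n : (\int[mu]_(x in `[u n, v n]) (f x)%:E = (F (v n) - F (u n))%:E)%E.
Proof.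
rewrite (@continuous_FTC2 _ f F)//.
- by apply: continuous_in_subspaceT => x; rewrite inE => /subD/cf.
- have cF x : x \in `[u n, v n] -> {for x, continuous F}.
    move=> /subD/dF dFx; apply: differentiable_continuous.
    exact/derivable1_diffP/ex_derive.
  split.
  + by move=> x /subset_itv_oo_cc /subD /dF[].
  + by apply: cvg_at_right_filter; apply: cF; rewrite in_itv/= lexx ltW.
  + by apply: cvg_at_left_filter; apply: cF; rewrite in_itv/= lexx ltW.
- by move=> x /subset_itv_oo_cc /subD /dF dFx; rewrite derive1E derive_val.
Qed.

Let cvg_intn :
  (\int[mu]_(x in `[u n, v n]) (f x)%:E @[n --> \oo] --> (lb - la)%:E)%E.
Proof.
under eq_fun do rewrite intn.
by apply: cvg_EFin; [exact: nearW|apply: cvgB].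
Qed.

Let mfn n : measurable_fun [set` `[u n, v n]] (EFin \o f).
Proof.
apply/measurable_EFinP.
apply: (measurable_funS mD (subD (n := n))).
exact: exhaustion_measurable.
Qed.

(** Monotone convergence along the exhausting intervals. The antiderivative enters at the ends of
    [D] only through limits, which admits half-lines and integrands singular at an end point. *)
Lemma ge0_FTC_exhaustion : (forall x, D x -> 0 <= f x) ->
  (\int[mu]_(x in D) (f x)%:E = (lb - la)%:E)%E.
Proof.
move=> f0; have : (\int[mu]_(x in [set` `[u n, v n]]) (f x)%:E @[n --> \oo] -->
    \int[mu]_(x in \bigcup_n [set` `[u n, v n]]) (f x)%:E)%E.
  apply: ge0_nondecreasing_set_cvg_integral => //.
  by move=> n x /subD Dx; rewrite lee_fin f0.
by rewrite -DE => /cvg_lim <- //; exact/cvg_lim.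
Qed.

(** For signed [f] the positive and negative parts converge separately; integrability keeps the
    difference of their limits meaningful. *)
Lemma FTC_exhaustion : mu.-integrable D (EFin \o f) ->
  \int[mu]_(x in D) f x = lb - la.
Proof.
move=> intf; have intf' n : mu.-integrable `[u n, v n] (EFin \o f).
  by apply: integrableS intf => // x; exact: subD.
have Hp : (\int[mu]_(x in [set` `[u n, v n]]) (EFin \o f)^\+ x @[n --> \oo] -->
    \int[mu]_(x in D) (EFin \o f)^\+ x)%E.
  rewrite [in X in _ --> X]DE; apply: ge0_nondecreasing_set_cvg_integral => // n.
  by apply: measurable_funepos; exact: mfn.
have Hn : (\int[mu]_(x in [set` `[u n, v n]]) (EFin \o f)^\- x @[n --> \oo] -->
    \int[mu]_(x in D) (EFin \o f)^\- x)%E.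
  rewrite [in X in _ --> X]DE; apply: ge0_nondecreasing_set_cvg_integral => // n.
  by apply: measurable_funeneg; exact: mfn.
rewrite /Rintegral.
suff -> : (\int[mu]_(x in D) (f x)%:E = (lb - la)%:E)%E by [].
rewrite integralE.
have finp := integrable_pos_fin_num mD intf.
rewrite -(cvg_lim (@ereal_hausdorff R) (cvgeB (fin_num_adde_defr _ finp) Hp Hn)).
apply/cvg_lim => //; apply: cvg_trans cvg_intn.
by apply: near_eq_cvg; apply: nearW => n; rewrite /= integralE.
Qed.

End FTC_exhaustion.

Section Gamma_theory.
Context {R : realType}.
Implicit Types (x t s : R) (n : nat).
Let mu := @lebesgue_measure R.

Lemma invSS_cvg0r : ((n.+2%:R^-1 : R) @[n --> \oo]) --> (0:R)^'+.
Proof.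
move=> A; rewrite /at_right/= => -[e /= e0 eA].
have := @cvg_harmonic R => /cvgrPdist_lt /(_ _ e0) [N _ HN].
exists N => // n Nn /=; apply: eA => //=.
rewrite sub0r normrN; have := HN n.+1 (leqW Nn).
by rewrite /= sub0r normrN.
Qed.

(** The offset 2 keeps every interval nondegenerate, as the exhaustion requires; offset 1 would
    start with [1, 1]. *)
Lemma itv0y_exhaustion :
  [set` `]0, +oo[ : interval R] = \bigcup_n [set` `[n.+2%:R^-1, n.+2%:R]].
Proof.
apply/seteqP; split => x /=.
  rewrite in_itv/= andbT => x0.
  exists (Num.bound x + Num.bound x^-1)%N => //=; rewrite in_itv/=.
  have xb : x < (Num.bound x)%:R by rewrite archi_boundP// ltW.
  have xVb : x^-1 < (Num.bound x^-1)%:R by rewrite archi_boundP// invr_ge0 ltW.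
  apply/andP; split.
    rewrite -[leRHS]invrK lef_pV2 ?posrE ?invr_gt0//.
    by rewrite (le_trans (ltW xVb))// ler_nat; do 2 apply: leqW; exact: leq_addl.
  by rewrite (le_trans (ltW xb))// ler_nat; do 2 apply: leqW; exact: leq_addr.
move=> [n _ /=]; rewrite !in_itv/= andbT => /andP[+ _].
by apply: lt_le_trans; rewrite invr_gt0.
Qed.

Lemma powR_expRN_bounded (y : R) : 0 <= y ->
  exists K, 0 <= K /\ forall t, 0 < t -> t `^ y * expR (- t) <= K.
Proof.
move=> y0; pose N := Num.bound y.
have yN : y < N.+1%:R.
  by rewrite (lt_trans (archi_boundP y0))// ltr_nat.
exists (1 + (N.+1)`!%:R); split => [|t t0]; first by rewrite addr_ge0.
rewrite expRN ler_pdivrMr ?expR_gt0//.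
have [t1|t1] := leP t 1.
  apply: (@le_trans _ _ 1).
    by rewrite -[leRHS](powRr0 t); apply: ger_powR; rewrite ?t0.
  by rewrite mulr_ege1// ?lerDl// -expR0 ler_expR ltW.
apply: (@le_trans _ _ (t ^+ N.+1)).
  by rewrite -(powR_mulrn _ (ltW t0)); apply: (ler_powR (ltW t1)); exact: ltW.
have := expR_ge1Dxn N (ltW t0); set f := (N.+1`!)%:R => H.
have f0 : 0 < f :> R by rewrite ltr0n fact_gt0.
have : t ^+ N.+1 <= f * expR t.
  by rewrite mulrC -ler_pdivrMr// (le_trans _ H)// lerDr.
by move=> /le_trans; apply; rewrite ler_wpM2r ?expR_ge0// lerDr.
Qed.

Lemma is_derive_powR_expRN x t : 0 < t ->
  is_derive t 1 (fun t => t `^ x * expR (- t))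
    (x * t `^ (x - 1) * expR (- t) - t `^ x * expR (- t)).
Proof.
move=> t0; have d1 := is_derive1_powR x t0.
have d2 : is_derive t 1 (fun t => expR (- t)) (- expR (- t)).
  have := is_derive1_comp (is_derive_expR (- t)) (is_deriveN (is_derive_id t 1)).
  by rewrite mulrN1.
have := is_deriveM d1 d2; rewrite /= => H.
apply: is_derive_eq; rewrite /GRing.scale/=; ring.
Qed.

Lemma invSS_powR_cvg0 x : 0 < x -> (n.+2%:R^-1 : R) `^ x @[n --> \oo] --> 0.
Proof. move=> x0.
exact: (@cvg_comp _ _ _ (fun n => n.+2%:R^-1) (fun a => a `^ x) _ _ _ invSS_cvg0r (powR_cvg0 x0)). Qed.

Lemma continuous_powR_gt0 (a t : R) : 0 < t ->
  {for t, continuous (fun t => t `^ a)}.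
Proof.
move=> t0; apply: differentiable_continuous; apply/derivable1_diffP.
by have [] := is_derive1_powR a t0.
Qed.

Lemma continuous_Gamma_integrand a t : 0 < t ->
  {for t, continuous (fun t : R => t `^ a * expR (- t))}.
Proof.
move=> t0; apply: continuousM; first exact: continuous_powR_gt0.
by apply: continuous_comp; [exact: opp_continuous|exact: continuous_expR].
Qed.

Let dH x t : 0 < t -> is_derive t 1 (fun t => - (1 + t `^ x)^-1)
   (x * t `^ (x - 1) / ((1 + t `^ x) * (1 + t `^ x))).
Proof.
move=> t0; have d1 := is_derive1_powR x t0.
have d2 : is_derive t 1 (fun t => 1 + t `^ x) (0 + x * t `^ (x - 1)).
  exact: (is_deriveD (@is_derive_cst _ _ R^o 1 t 1) d1).
have p : (fun t => 1 + t `^ x) t != 0 by rewrite gt_eqF// ltr_pwDl// powR_ge0.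
have := is_deriveN (@is_deriveV _ (fun t => 1 + t `^ x) t _ 1 p d2); rewrite /= => H.
by apply: is_derive_eq; rewrite /GRing.scale/= add0r mulNr opprK mulrC.
Qed.

Lemma Gamma_integrable x : 0 < x ->
  mu.-integrable `]0, +oo[ (fun t => (t `^ (x - 1) * expR (- t))%:E).
Proof.
move=> x0.
(* The comparison function has the explicit antiderivative -(1 + t^x)^-1, which rises from -1 to 0;
   it behaves like t^(x-1) near 0 and like t^(-x-1) at infinity. *)
pose h t := x * t `^ (x - 1) / ((1 + t `^ x) * (1 + t `^ x)).
have posin t : [set` `]0, +oo[ : interval R] t -> 0 < t.
  by rewrite /= in_itv/= andbT.
have ch t : [set` `]0, +oo[ : interval R] t -> {for t, continuous h}.
  move=> /posin t0; have pc a := @continuous_powR_gt0 a _ t0.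
  apply: continuousM.
    by apply: continuousM; [exact: cst_continuous|exact: pc].
  apply: continuousV; first by rewrite mulf_neq0// gt_eqF// ltr_pwDl// powR_ge0.
  by apply: continuousM; apply: continuousD; (exact: cst_continuous || exact: pc).
have inth : (\int[mu]_(t in `]0%R, +oo[) (h t)%:E = (0 - (-1))%:E)%E.
  have uv n : (n.+2%:R^-1 : R) < n.+2%:R.
    by rewrite (@lt_trans _ _ 1) ?invf_lt1 ?ltr1n.
  apply: (ge0_FTC_exhaustion uv (F := fun t => - (1 + t `^ x)^-1) _ _
    itv0y_exhaustion ch) => //.
  - by move=> m n mn; rewrite lef_pV2 ?posrE// ler_nat.
  - by move=> m n mn; rewrite ler_nat.
  - by move=> t /posin t0; exact: dH.
  - have : (1 + n.+2%:R^-1 `^ x)^-1 @[n --> \oo] --> ((1 + 0)^-1 : R).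
      apply: cvgV; first by rewrite addr0 oner_neq0.
      by apply: cvgD; [exact: cvg_cst|exact: invSS_powR_cvg0].
    by rewrite addr0 invr1; exact: cvgN.
  (* The identity (1 + w)^-1 = 1 - (1 + w^-1)^-1 turns the limit at infinity into a limit at 0. *)
  - have : (fun n => - (1 - (1 + n.+2%:R^-1 `^ x)^-1 : R)) @ \oo --> (- (1 - (1 + 0)^-1) : R).
      apply: cvgN; apply: cvgB; first exact: cvg_cst.
      apply: cvgV; first by rewrite addr0 oner_neq0.
      by apply: cvgD; [exact: cvg_cst|exact: invSS_powR_cvg0].
    rewrite addr0 invr1 subrr oppr0; apply: cvg_trans; apply: near_eq_cvg.
    apply: nearW => n /=.
    have -> : n.+2%:R^-1 `^ x = (n.+2%:R `^ x)^-1 :> R.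
      by rewrite -powR_inv1// -powRrM mulN1r powRN.
    set w := _ `^ x; have w0 : 0 < w by exact: powR_gt0.
    by field; rewrite !gt_eqF// addr_gt0.
  - move=> t /posin t0; rewrite divr_ge0 ?sqr_ge0// mulr_ge0 ?ltW ?powR_gt0//.
have [K1 [K10 HK1]] := powR_expRN_bounded (ltW x0).
have [K2 [K20 HK2]] : exists K, 0 <= K /\ forall t, 0 < t -> t `^ (x + x) * expR (- t) <= K.
  by apply: powR_expRN_bounded; rewrite addr_ge0// ltW.
(* [x * K] bounds (1 + t^x)^2 e^-t, expanded into its three terms. *)
pose K := (1 + 2 * K1 + K2) / x.
have mh : measurable_fun ([set` (`]0, +oo[ : interval R)] : set R) h.
  apply: open_continuous_measurable_fun; first exact: interval_open.
  by move=> t /set_mem; exact: ch.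
have mg : measurable_fun ([set` (`]0, +oo[ : interval R)] : set R)
    (fun t : R => t `^ (x - 1) * expR (- t)).
  apply: open_continuous_measurable_fun; first exact: interval_open.
  by move=> t /set_mem/posin; exact: continuous_Gamma_integrand.
have KxE : x * K = 1 + 2 * K1 + K2 by rewrite /K mulrC divfK// gt_eqF.
have Kge0 : 0 <= K by rewrite divr_ge0 ?addr_ge0 ?mulr_ge0// ltW.
have hge0 t : 0 < t -> 0 <= h t.
  by move=> t0; rewrite divr_ge0 ?mulr_ge0 ?addr_ge0 ?powR_ge0// ltW.
apply: (@le_integrable _ _ _ mu _ _ _ (fun t => (K * h t)%:E)) => //.
- apply/measurable_EFinP; exact: mg.
- move=> t /posin t0; rewrite !abse_EFin lee_fin.
  have p1 : 0 <= t `^ (x - 1) by exact: powR_ge0.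
  have p2 : 0 < t `^ x by exact: powR_gt0.
  have e0 := expR_gt0 (- t).
  rewrite (ger0_norm (mulr_ge0 Kge0 (hge0 _ t0))) (ger0_norm (mulr_ge0 p1 (ltW e0))).
  rewrite /h !mulrA [K * x]mulrC KxE [leRHS]mulrAC mulrC ler_wpM2r//.
  rewrite ler_pdivlMr ?mulr_gt0 ?addr_gt0//.
  have -> : expR (- t) * ((1 + t `^ x) * (1 + t `^ x)) =
    expR (- t) + 2 * (t `^ x * expR (- t)) + t `^ (x + x) * expR (- t).
    rewrite (@powRD _ t x x) ?(gt_eqF t0) ?implybT//.
    by move: (expR _) (t `^ x) => e w; ring.
  have := HK1 _ t0; have := HK2 _ t0.
  have : expR (- t) <= 1 by rewrite expR_le1 oppr_le0 ltW.
  lra.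
- apply/integrableP; split.
    by apply/measurable_EFinP; apply: measurable_funM => //; exact: mh.
  under eq_integral => t.
    rewrite inE => /posin t0; rewrite abse_EFin (ger0_norm (mulr_ge0 Kge0 (hge0 _ t0))).
    rewrite EFinM; over.
  rewrite ge0_integralZl//.
  + by rewrite inth lte_mul_pinfty// ?lee_fin// ltry.
  + apply/measurable_EFinP; exact: mh.
  + by move=> t /posin t0; rewrite lee_fin hge0.
Qed.

Lemma Gamma_ge0 x : 0 <= Gamma x.
Proof.
by apply: Rintegral_ge0 => t _; rewrite mulr_ge0 ?powR_ge0 ?expR_ge0.
Qed.

(** Integration by parts: t^x e^-t vanishes at both ends of the half-line, so its derivative has
    integral 0. *)
Lemma GammaD1 x : 0 < x -> Gamma (x + 1) = x * Gamma x.
Proof.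
move=> x0; have i1 := Gamma_integrable x0.
have i2 : mu.-integrable `]0, +oo[ (fun t => (t `^ (x + 1 - 1) * expR (- t))%:E).
  by apply: Gamma_integrable; rewrite addr_gt0.
have i3 : mu.-integrable `]0, +oo[ (fun t => (x * (t `^ (x - 1) * expR (- t)))%:E).
  apply: (@eq_integrable _ _ _ mu _ _
    (fun t => (x%:E * (t `^ (x - 1) * expR (- t))%:E)%E)) => //.
  exact: integrableZl.
apply/esym/eqP; rewrite -subr_eq0 /Gamma -RintegralZl// -RintegralB//.
have uv n : (n.+2%:R^-1 : R) < n.+2%:R.
  by rewrite (@lt_trans _ _ 1) ?invf_lt1 ?ltr1n.
have posin t : [set` `]0, +oo[ : interval R] t -> 0 < t.
  by rewrite /= in_itv/= andbT.
rewrite -[X in _ == X](subrr 0); apply/eqP.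
apply: (FTC_exhaustion uv (F := fun t => t `^ x * expR (- t)) _ _
    itv0y_exhaustion) => //.
- by move=> m n mn; rewrite lef_pV2 ?posrE// ler_nat.
- by move=> m n mn; rewrite ler_nat.
- move=> t /posin t0; apply: continuousB; repeat apply: continuousM;
    try (by exact: continuous_powR_gt0); try exact: cst_continuous;
    by apply: continuous_comp; [exact: opp_continuous|exact: continuous_expR].
- move=> t /posin t0; have := is_derive_powR_expRN x t0.
  by rewrite addrK mulrA.
- apply: (@squeeze_cvgr _ _ _ _ (fun=> 0) (fun n => n.+2%:R^-1 `^ x)).
  + apply: nearW => n; rewrite mulr_ge0 ?powR_ge0 ?expR_ge0//=.
    rewrite ler_piMr ?powR_ge0// expR_le1 oppr_le0 invr_ge0//.
  + exact: cvg_cst.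
  + exact: invSS_powR_cvg0.
- have [K [K0 HK]] : exists K, 0 <= K /\ forall t, 0 < t -> t `^ (x + 1) * expR (- t) <= K.
    by apply: powR_expRN_bounded; rewrite addr_ge0// ltW.
  apply: (@squeeze_cvgr _ _ _ _ (fun=> 0) (fun n => K * n.+2%:R^-1 `^ 1)).
  + apply: nearW => n; rewrite mulr_ge0 ?powR_ge0 ?expR_ge0//=.
    rewrite powRr1// ler_pdivlMr// (le_trans _ (HK n.+2%:R _))//.
    by rewrite powRD ?pnatr_eq0 ?implybT// powRr1// mulrAC.
  + exact: cvg_cst.
  + rewrite -[X in _ --> X](mulr0 K); apply: cvgM; first exact: cvg_cst.
    exact: invSS_powR_cvg0.
- by have := integrableB _ i3 i2; apply.
Qed.

Lemma Gamma1 : Gamma 1 = 1 :> R.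
Proof.
have i1 := @Gamma_integrable 1 ltr01.
have uv n : (n.+2%:R^-1 : R) < n.+2%:R.
  by rewrite (@lt_trans _ _ 1) ?invf_lt1 ?ltr1n.
have posin t : [set` `]0, +oo[ : interval R] t -> 0 < t.
  by rewrite /= in_itv/= andbT.
rewrite -[RHS]opprK -[RHS]add0r.
apply: (FTC_exhaustion uv (F := fun t => - expR (- t)) _ _
    itv0y_exhaustion) => //.
- by move=> m n mn; rewrite lef_pV2 ?posrE// ler_nat.
- by move=> m n mn; rewrite ler_nat.
- move=> t /posin t0; apply: continuousM; first exact: continuous_powR_gt0.
  by apply: continuous_comp; [exact: opp_continuous|exact: continuous_expR].
- move=> t /posin t0; rewrite subrr powRr0 mul1r.
  have := is_deriveN (is_derive1_comp (is_derive_expR (- t)) (is_deriveN (is_derive_id t 1))).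
  by rewrite mulrN1 opprK.
- apply: cvgN; rewrite -[X in _ --> X]expR0.
  apply: continuous_cvg; first exact: continuous_expR.
  rewrite -[X in _ --> X]oppr0; apply: cvgN.
  have := @invSS_powR_cvg0 1 ltr01; apply: cvg_trans; apply: near_eq_cvg.
  by apply: nearW => n; rewrite powRr1.
- rewrite -[X in _ --> X]oppr0; apply: cvgN.
  have := @cvgn_expR R; rewrite -(cvg_shiftn 2%N) => h; apply: cvg_trans h.
  by apply: near_eq_cvg; apply: nearW => n /=; rewrite addn2.
Qed.

(** Bernoulli's inequality for a concave power. The right side y is a convex combination of x and 1;
    the bounds ln z - ln y <= z / y - 1 at z = x and z = 1, weighted by s and 1 - s, have right
    sides that cancel. *)
Lemma powR_le_tangent x s : 0 <= x -> 0 <= s <= 1 -> x `^ s <= 1 + s * (x - 1).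
Proof.
move=> + /andP[s0 s1]; rewrite le_eqVlt => /predU1P[<-|x0].
  by rewrite sub0r mulrN1; have [->|s0'] := eqVneq s 0;
    rewrite ?powRr0 ?subr0// powR0// subr_ge0.
have [y0|y0] := ltP 0 (1 + s * (x - 1)); last first.
  have : s * x <= s - 1 by lra.
  move=> H; have sx := mulr_ge0 s0 (ltW x0).
  have s1' : s = 1 by lra.
  by move: H x0; rewrite s1'; lra.
set y := 1 + _ in y0 *; rewrite -ler_ln ?posrE ?powR_gt0// ln_powR.
have le z : 0 < z -> ln z - ln y <= z / y - 1.
  move=> z0; rewrite -ln_div// -[X in ln X](subrK 1) addrC le_ln1Dx//.
  by rewrite ltrBDl subrr divr_gt0.
have Hx := ler_wpM2l s0 (le _ x0).
have H1 : (1 - s) * (ln 1 - ln y) <= (1 - s) * (1 / y - 1).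
  by rewrite ler_wpM2l ?le// subr_ge0.
have E : s * (x / y - 1) + (1 - s) * (1 / y - 1) = 0.
  have -> : s * (x / y - 1) + (1 - s) * (1 / y - 1) = y / y - 1 by rewrite /y; ring.
  by rewrite divff ?subrr// gt_eqF.
by move: H1; rewrite ln1; lra.
Qed.

(** A substitute for log-convexity: t^s lies below its tangent at t = x, and under the weight
    t^(x-1) e^-t the mean of t is exactly x, so the linear term integrates to zero. *)
Lemma Gamma_le x s : 0 < x -> 0 <= s <= 1 -> Gamma (x + s) <= x `^ s * Gamma x.
Proof.
move=> x0 s01; have [s0 s1] := andP s01.
have x10 : 0 < x + 1 by rewrite addr_gt0.
have xs0 : 0 < x + s by rewrite ltr_pwDl.
have i0 := Gamma_integrable x0.
have i1 := Gamma_integrable x10.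
pose a := x `^ s * (1 - s); pose b := x `^ s * (s / x).
have ia : mu.-integrable `]0, +oo[ (fun t => (a * (t `^ (x - 1) * expR (- t)))%:E).
  apply: (@eq_integrable _ _ _ mu _ _
    (fun t => (a%:E * (t `^ (x - 1) * expR (- t))%:E)%E)) => //.
  exact: integrableZl.
have ib : mu.-integrable `]0, +oo[ (fun t => (b * (t `^ (x + 1 - 1) * expR (- t)))%:E).
  apply: (@eq_integrable _ _ _ mu _ _
    (fun t => (b%:E * (t `^ (x + 1 - 1) * expR (- t))%:E)%E)) => //.
  exact: integrableZl.
apply: (@le_trans _ _ (\int[mu]_(t in `]0, +oo[) (a * (t `^ (x - 1) * expR (- t)) +
   b * (t `^ (x + 1 - 1) * expR (- t))))).
  apply: le_Rintegral => //.
  - exact: Gamma_integrable.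
  - apply: (@eq_integrable _ _ _ mu _ _ (fun t =>
      ((a * (t `^ (x - 1) * expR (- t)))%:E + (b * (t `^ (x + 1 - 1) * expR (- t)))%:E)%E)) => //.
    exact: integrableD.
  move=> t; rewrite /= in_itv/= andbT => t0.
  rewrite addrK -(addrA x) (addrC s) addrA (@powRD _ t (x - 1)); last by rewrite (gt_eqF t0) implybT.
  have -> : t `^ x = t * t `^ (x - 1) by rewrite mulr_powRB1// ltW.
  have -> : t `^ s = x `^ s * (t / x) `^ s.
    by rewrite -powRM ?ltW ?divr_gt0// mulrC divfK// gt_eqF.
  have H : (t / x) `^ s <= 1 + s * (t / x - 1).
    by apply: powR_le_tangent => //; rewrite divr_ge0 ?ltW.
  have -> : a * (t `^ (x - 1) * expR (- t)) + b * (t * t `^ (x - 1) * expR (- t)) =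
     t `^ (x - 1) * (x `^ s * (1 + s * (t / x - 1))) * expR (- t).
    by rewrite /a /b; ring.
  by rewrite ler_wpM2r ?expR_ge0// ler_wpM2l ?powR_ge0// ler_wpM2l ?powR_ge0.
rewrite RintegralD// !RintegralZl//.
rewrite -/(Gamma x) -/(Gamma (x + 1)) GammaD1// /a /b.
have -> : x `^ s * (1 - s) * Gamma x + x `^ s * (s / x) * (x * Gamma x) =
  x `^ s * (1 - s + s / x * x) * Gamma x by ring.
by rewrite divfK ?gt_eqF// subrK mulr1.
Qed.

Lemma Gamma_natr n : Gamma n.+1%:R = (n`!)%:R :> R.
Proof.
elim: n => [|n IH]; first by rewrite Gamma1.
by rewrite -natr1 GammaD1 ?IH// -natrM factS.
Qed.

(** By [Gamma_le] a zero at x would spread to all of [x, x + 1], which contains a positive integer,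
    where Gamma is a factorial. *)
Lemma Gamma_gt0 x : 0 < x -> 0 < Gamma x.
Proof.
move=> x0; rewrite lt_neqAle Gamma_ge0 andbT; apply/negP => /eqP G0.
have G0' s : 0 <= s <= 1 -> Gamma (x + s) = 0.
  move=> s01; apply/le_anti; rewrite Gamma_ge0 andbT.
  by have := Gamma_le x0 s01; rewrite -G0 mulr0.
have [n nx] : exists n, 0 <= n.+1%:R - x <= 1.
  exists (Num.trunc x); have /Num.Theory.trunc_itv/andP[] := ltW x0.
  by rewrite subr_ge0 lerBlDr -natr1 => ? ?; lra.
have := G0' _ nx; rewrite addrC subrK Gamma_natr => /eqP.
by rewrite pnatr_eq0 eqn0Ngt fact_gt0.
Qed.

End Gamma_theory.

Lemma powR_ge_tangent (R : realType) (x r : R) : 0 <= x -> 1 <= r ->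
  1 + r * (x - 1) <= x `^ r.
Proof.
move=> x0 r1; have r0 : 0 < r by exact: lt_le_trans r1.
have := @powR_le_tangent R (x `^ r) r^-1 (powR_ge0 _ _).
rewrite -powRrM divff ?gt_eqF// powRr1// invr_ge0 (ltW r0) invf_le1// r1.
move=> /(_ isT); rewrite -lerBlDl ler_pdivlMl//; lra.
Qed.

(** * Binomial series coefficients *)

Section rising_coefficients.
Context {R : realType}.
Implicit Types (x y s : R) (n m : nat).

(* [nbin s n] is the coefficient of z^n in (1 - z)^(-s). *)
Fixpoint nbin s n : R :=
  if n is m.+1 then nbin s m * (s + m%:R) / m.+1%:R else 1.

Arguments nbin : simpl never.

Lemma nbin_0 s : nbin s 0 = 1.
Proof. by []. Qed.

Lemma nbinSE s n : nbin s n.+1 = nbin s n * (s + n%:R) / n.+1%:R.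
Proof. by []. Qed.

Lemma nbinS s n : n.+1%:R * nbin s n.+1 = (s + n%:R) * nbin s n.
Proof. by rewrite nbinSE mulrC divfK ?pnatr_eq0// mulrC. Qed.

Lemma nbin0 n : nbin 0 n = (n == 0%N)%:R.
Proof.
elim: n => // n IH; rewrite nbinSE IH.
by case: n {IH} => [|n]; rewrite /= ?addr0 ?mulr0 ?mul0r.
Qed.

Lemma nbin_gt0 s n : 0 < s -> 0 < nbin s n.
Proof.
move=> s0; elim: n => // n IH; rewrite nbinSE.
by rewrite divr_gt0 ?mulr_gt0// ltr_pwDl.
Qed.

Lemma nbinN_le0 s n : 0 < s < 1 -> nbin (- s) n.+1 <= 0.
Proof.
move=> /andP[s0 s1]; elim: n => [|n IH].
  by rewrite nbinSE /nbin addr0 mul1r divr1 oppr_le0 ltW.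
rewrite nbinSE -mulrA mulr_le0_ge0// divr_ge0// addrC subr_ge0.
by rewrite (le_trans (ltW s1))// ler1n.
Qed.

(** Vandermonde's convolution: the coefficients of (1 - z)^(-x) (1 - z)^(-y) = (1 - z)^(-(x+y)). *)
Lemma nbinD x y n :
  nbin (x + y) n = \sum_(m < n.+1) nbin x m * nbin y (n - m).
Proof.
elim: n => [|n IH]; first by rewrite big_ord_recl big_ord0 /= mulr1 addr0.
have n0 : n.+1%:R != 0 :> R by rewrite pnatr_eq0.
apply: (mulfI n0); rewrite nbinS IH !mulr_sumr.
(* The factor n + 1 acts as z d/dz. Splitting it as m + (n + 1 - m) is the Leibniz rule, and [nbinS]
   then lowers the index in each half. *)
transitivity (\sum_(m < n.+2) (m%:R * nbin x m * nbin y (n.+1 - m) +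
    nbin x m * ((n.+1 - m)%:R * nbin y (n.+1 - m)))); last first.
  apply: eq_bigr => m _; have mn : (m <= n.+1)%N by rewrite -ltnS.
  have <- : m%:R + (n.+1 - m)%:R = n.+1%:R :> R by rewrite -natrD subnKC.
  ring.
rewrite big_split/= [X in _ = X + _]big_ord_recl !mul0r add0r.
rewrite [X in _ = _ + X]big_ord_recr/= subnn.
rewrite mul0r mulr0 addr0 -big_split/=; apply: eq_bigr => m _.
have mn : (m <= n)%N by rewrite -ltnS.
have -> : bump 0 m = m.+1 by [].
rewrite subSS (subSn mn) nbinS [in RHS]nbinS.
have <- : m%:R + (n - m)%:R = n%:R :> R by rewrite -natrD subnKC.
ring.
Qed.

Lemma nbin_Gamma s n : 0 < s -> nbin s n = Gamma (s + n%:R) / (Gamma s * (n`!)%:R).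
Proof.
move=> s0; have Gs := Gamma_gt0 s0; elim: n => [|n IH].
  by rewrite /nbin addr0 mulr1 divff// gt_eqF.
rewrite nbinSE IH -natr1 addrA GammaD1 ?ltr_pwDl// factS natrM natr1.
by rewrite !invfM; ring.
Qed.

(** The normalization under which the coefficients tend to 1 / Gamma(s), a form of Euler's limit
    formula. *)
Definition nbin_scaled s n := n%:R `^ (1 - s) * nbin s n.

Lemma nbin_scaledD1 s n : (0 < n)%N -> 0 < s ->
  nbin_scaled (s + 1) n = nbin_scaled s n * ((s + n%:R) / (n%:R * s)).
Proof.
move=> n0 s0; have Gs := Gamma_gt0 s0.
rewrite /nbin_scaled !nbin_Gamma ?addr_gt0// addrAC GammaD1 ?ltr_pwDl// GammaD1//.
have -> : 1 - s = (1 - (s + 1)) + 1 :> R by ring.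
rewrite (@powRD _ _ _ 1); last by rewrite pnatr_eq0 -lt0n n0 implybT.
rewrite powRr1//; move: (_ `^ _) => w.
have nR : n%:R != 0 :> R by rewrite pnatr_eq0 -lt0n.
transitivity (n%:R / n%:R *
  (w * ((s + n%:R) * Gamma (s + n%:R) / (s * Gamma s * (n`!)%:R)))).
  by rewrite divff// mul1r.
by rewrite !invfM; ring.
by rewrite ltr_wpDr.
Qed.

(** Two uses of [Gamma_le] squeeze the sequence: the step from n to s + n with exponent s bounds it
    above, the step from s + n to n + 1 with exponent 1 - s bounds it below. Both exponents must lie
    in [0, 1]. *)
Let nbin_scaled_cvg01 s : 0 < s <= 1 ->
  nbin_scaled s n @[n --> \oo] --> (Gamma s)^-1.
Proof.
move=> /andP[s0 s1]; have Gs := Gamma_gt0 s0.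
apply: (@squeeze_cvgr _ _ _ _ (fun n => (n%:R / (n%:R + 1)) / Gamma s)
  (fun=> (Gamma s)^-1)); last 2 first.
- rewrite -[X in _ --> X]mul1r; apply: cvgM; last exact: cvg_cst.
  have : (1 - n.+1%:R^-1 : R) @[n --> \oo] --> (1 - 0 : R).
    by apply: cvgB; [exact: cvg_cst|exact: cvg_harmonic].
  rewrite subr0; apply: cvg_trans; apply: near_eq_cvg; apply: nearW => n /=.
  by rewrite natr1 -[n%:R](addrK 1) natr1 mulrBl divff// mul1r.
- exact: cvg_cst.
exists 1%N => // n /= n0; rewrite /nbin_scaled nbin_Gamma//.
have nR : 0 < n%:R :> R by rewrite ltr0n.
have f0 : 0 < (n`!)%:R :> R by rewrite ltr0n fact_gt0.
have nE : (n`!)%:R = n%:R * Gamma n%:R :> R.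
  by case: n n0 {nR f0} => // n _; rewrite Gamma_natr factS natrM.
have sn : 0 < s + n%:R by rewrite addr_gt0.
have Gn : 0 < Gamma n%:R :> R by exact: Gamma_gt0.
have -> : n%:R `^ (1 - s) * (Gamma (s + n%:R) / (Gamma s * (n`!)%:R)) =
    n%:R `^ (1 - s) * Gamma (s + n%:R) / (n`!)%:R / Gamma s.
  by rewrite invfM; ring.
apply/andP; split.
- rewrite ler_pM2r ?invr_gt0//.
  have /(Gamma_le sn) : 0 <= 1 - s <= 1 by lra.
  have -> : s + n%:R + (1 - s) = n.+1%:R by rewrite -natr1; ring.
  rewrite Gamma_natr => H.
  rewrite ler_pdivlMr// (le_trans (ler_wpM2l _ H)) ?divr_ge0 ?addr_ge0//.
  rewrite mulrA ler_wpM2r ?Gamma_ge0//.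
  have -> : s + n%:R = n%:R * ((s + n%:R) / n%:R) by rewrite mulrC divfK ?gt_eqF.
  rewrite powRM ?divr_ge0 ?addr_ge0 ?(ltW s0)// mulrCA ler_piMr ?powR_ge0//.
  rewrite mulrAC ler_pdivrMr ?addr_gt0// mul1r.
  have H1 : 1 <= (s + n%:R) / n%:R by rewrite ler_pdivlMr// mul1r lerDr ltW.
  have HX : ((s + n%:R) / n%:R) `^ (1 - s) <= (s + n%:R) / n%:R.
    by apply: (ler1_powR H1); rewrite gerBl ltW.
  rewrite (le_trans (ler_wpM2l (ltW nR) HX))// mulrCA divff ?gt_eqF// mulr1.
  by rewrite addrC lerD2l.
- rewrite -[leRHS]mul1r ler_pM2r ?invr_gt0//.
  have /(Gamma_le nR) : 0 <= s <= 1 by rewrite s1 ltW.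
  rewrite addrC ler_pdivrMr// mul1r => H.
  rewrite (le_trans (ler_wpM2l (powR_ge0 _ _) H))// mulrA -powRD; last first.
    by rewrite (gt_eqF nR) implybT.
  by rewrite subrK powRr1 ?nE// ltW.
Qed.

(** Induction on an integer bound for s: the ratio in [nbin_scaledD1], taken at s - 1, tends to 1 /
    (s - 1), which matches the functional equation of Gamma. *)
Lemma nbin_scaled_cvg s : 0 < s -> nbin_scaled s n @[n --> \oo] --> (Gamma s)^-1.
Proof.
move=> s0; have [m ms] : exists m : nat, s <= m.+1%:R.
  by exists (Num.bound s); rewrite (le_trans (ltW (archi_boundP (ltW s0))))// ler_nat.
elim: m s s0 ms => [|m IH] s s0 ms; first by apply: nbin_scaled_cvg01; rewrite s0.
have [s1|s1] := leP s 1; first by apply: nbin_scaled_cvg01; rewrite s0.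
have s10 : 0 < s - 1 by rewrite subr_gt0.
have := IH (s - 1) s10; rewrite lerBlDr natr1 => /(_ ms) H.
rewrite -[in X in _ --> X](subrK 1 s) GammaD1//.
have H2 : ((s - 1) * n.+1%:R^-1 + 1) / (s - 1) @[n --> \oo] --> (((s - 1) * 0 + 1) / (s - 1) : R).
  apply: cvgM; last exact: cvg_cst.
  apply: cvgD; last exact: cvg_cst.
  by apply: cvgM; [exact: cvg_cst|exact: cvg_harmonic].
have H1 : nbin_scaled (s - 1) n.+1 @[n --> \oo] --> (Gamma (s - 1))^-1.
  by rewrite (cvg_shiftS (nbin_scaled (s - 1))).
rewrite -(cvg_shiftS (nbin_scaled s)).
have H3 : nbin_scaled (s - 1) n.+1 * (((s - 1) / n.+1%:R + 1) / (s - 1)) @[n --> \oo]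
    --> (Gamma (s - 1))^-1 * (((s - 1) * 0 + 1) / (s - 1)) by exact: cvgM.
have -> : ((s - 1) * Gamma (s - 1))^-1 = (Gamma (s - 1))^-1 * (((s - 1) * 0 + 1) / (s - 1)).
  by rewrite mulr0 add0r div1r invfM mulrC.
apply: cvg_trans H3; apply: near_eq_cvg; apply: nearW => n /=.
rewrite -[in RHS](subrK 1 s) nbin_scaledD1//; congr (_ * _).
by rewrite invfM [RHS]mulrA; congr (_ * _); rewrite [in RHS]mulrDl [in RHS]divff.
Qed.

(** Bernoulli's inequality for (1 + 1/n)^(s-1), whose exponent must be at least 1. Monotonicity
    serves twice: it bounds the limit 1 / Gamma(s) by any single term, and it dominates the terms
    uniformly in n for Tannery's theorem. *)
Lemma nbin_scaled_nonincreasing s n : 2 <= s -> (0 < n)%N ->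
  nbin_scaled s n.+1 <= nbin_scaled s n.
Proof.
move=> s2 n0; rewrite /nbin_scaled nbinSE.
have nR : 0 < n%:R :> R by rewrite ltr0n.
have s0 : 0 < s by lra.
have c0 := nbin_gt0 n s0.
have c1 : n%:R `^ (1 - s) = n.+1%:R `^ (1 - s) * (n.+1%:R / n%:R) `^ (s - 1) :> R.
  rewrite powRM ?invr_ge0// mulrA -powRD ?pnatr_eq0 ?implybT//.
  have -> : 1 - s + (s - 1) = 0 by ring.
  by rewrite powRr0 mul1r -powR_inv1// -powRrM mulN1r opprB.
have b : 1 + (s - 1) * (n.+1%:R / n%:R - 1) <= (n.+1%:R / n%:R) `^ (s - 1) :> R.
  by apply: powR_ge_tangent; [rewrite divr_ge0|lra].
have b' : (s + n%:R) / n.+1%:R <= (n.+1%:R / n%:R) `^ (s - 1).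
  apply: le_trans b.
  have -> : n.+1%:R / n%:R = 1 + n%:R^-1 :> R.
    by rewrite -natr1 mulrDl divff ?gt_eqF// mul1r.
  rewrite [_ + _ - 1]addrAC subrr add0r -natr1.
  rewrite ler_pdivrMr ?addr_gt0//.
  have -> : (1 + (s - 1) / n%:R) * (n%:R + 1) = n%:R / n%:R * (s - 1) + n%:R + 1 + (s - 1) / n%:R by ring.
  rewrite divff ?gt_eqF// mul1r.
  have : 0 <= (s - 1) / n%:R by rewrite divr_ge0//; lra.
  lra.
rewrite c1 -!mulrA ler_wpM2l ?powR_ge0// [leRHS]mulrC ler_wpM2l//.
exact: ltW.
Qed.

Lemma nbin_le s n : 0 < s -> nbin s n <= (1 + s) ^+ n.
Proof.
move=> s0; elim: n => // n IH; rewrite nbinSE exprSr -mulrA ler_pM//.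
- by rewrite ltW// nbin_gt0.
- by rewrite divr_ge0// addr_ge0// ltW.
- by rewrite ler_pdivrMr// -natr1; have := ler0n R n; nra.
Qed.

Lemma expr_le_expR (e : R) x n : 0 < e -> 0 <= x ->
  x ^+ n <= (n`!)%:R / e ^+ n * expR (e * x).
Proof.
move=> e0 x0; have ex0 : 0 <= e * x by rewrite mulr_ge0// ltW.
case: n => [|n].
  by rewrite !expr0 divr1 mul1r -expR0 ler_expR.
have f0 : 0 < (n.+1`!)%:R :> R by rewrite ltr0n fact_gt0.
rewrite mulrAC ler_pdivlMr ?exprn_gt0// -exprMn [x * e]mulrC.
rewrite [leRHS]mulrC -ler_pdivrMr//.
by apply: (le_trans _ (expR_ge1Dxn n ex0)); rewrite lerDr.
Qed.

(** At fixed n the growth in s is geometric with ratio e / n, which becomes as small as desired by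
    enlarging n. *)
Lemma nbin_scaled_le s n : 0 < s -> (0 < n)%N ->
  nbin_scaled s n <= n%:R * (n`!)%:R * expR 1 * (expR 1 / n%:R) `^ s.
Proof.
move=> s0 n0; have nR : 0 < n%:R :> R by rewrite ltr0n.
rewrite /nbin_scaled powRB; last by rewrite (gt_eqF nR) implybT.
have s10 : 0 <= 1 + s by rewrite addr_ge0// ltW.
have := le_trans (nbin_le n s0) (expr_le_expR n (@ltr01 R) s10).
rewrite expr1n divr1 mul1r => H.
have w0 : 0 <= n%:R / n%:R `^ s :> R by rewrite divr_ge0 ?powR_ge0.
rewrite powRr1 ?(ltW nR)// (le_trans (ler_wpM2l w0 H))//.
rewrite powRM ?expR_ge0 ?invr_ge0 ?(ltW nR)// expRD.
have -> : expR s = expR 1 `^ s by rewrite -expRM mul1r.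
have -> : n%:R^-1 `^ s = (n%:R `^ s)^-1 :> R.
  by rewrite -powR_inv1 ?(ltW nR)// -powRrM mulN1r powRN.
by rewrite le_eqVlt; apply/orP; left; apply/eqP; ring.
Qed.

Lemma nbin_scaled_antitone s n N : 2 <= s -> (0 < N)%N -> (N <= n)%N ->
  nbin_scaled s n <= nbin_scaled s N.
Proof.
move=> s2 N0; elim: n => [|n IH]; first by rewrite leqn0 => /eqP ->.
rewrite leq_eqVlt => /predU1P[->//|Nn].
have n0 : (0 < n)%N by exact: leq_trans N0 Nn.
exact: (le_trans (nbin_scaled_nonincreasing s2 n0) (IH Nn)).
Qed.

(** Since [N] is arbitrary, 1 / Gamma decays faster than every exponential. The argument is shifted
    to s + 2 to reach the monotone range; the factor s (s + 1) produced by the shift is at most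
    e^(2s), which turns the ratio e / N into e^3 / N. *)
Lemma Gamma_inv_le s N : 0 < s -> (0 < N)%N ->
  (Gamma s)^-1 <= N%:R^-1 * (N`!)%:R * expR 1 ^+ 3 * (expR 1 ^+ 3 / N%:R) `^ s.
Proof.
move=> s0 N0; have NR : 0 < N%:R :> R by rewrite ltr0n.
have s10 : 0 < s + 1 by rewrite addr_gt0.
have s20 : 0 < s + 1 + 1 by rewrite addr_gt0.
have s2 : 2 <= s + 1 + 1 by lra.
have G2 : (Gamma (s + 1 + 1))^-1 <= nbin_scaled (s + 1 + 1) N.
  apply: (cvgr_to_le (nbin_scaled_cvg s20)); exists N => // n /= Nn.
  exact: nbin_scaled_antitone.
have := le_trans G2 (nbin_scaled_le s20 N0).
set e := expR 1; have e0 : 0 < e by exact: expR_gt0.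
have eN : 0 < e / N%:R by rewrite divr_gt0.
rewrite -addrA powRD ?(gt_eqF eN) ?implybT// addrA.
have -> : (e / N%:R) `^ (1 + 1) = (e / N%:R) ^+ 2.
  by rewrite -[1 + 1]/(2%:R) powR_mulrn// ltW.
rewrite !GammaD1// => H.
have -> : (Gamma s)^-1 = (s * (s + 1)) * ((s + 1) * (s * Gamma s))^-1.
  rewrite [(s + 1) * (s * _)]mulrA invfM mulrA [s * (s + 1)]mulrC divff ?mul1r//.
  by rewrite mulf_neq0// gt_eqF.
have ss : s * (s + 1) <= expR s * expR s.
  have := expR_ge1Dx s; have := expR_gt0 s; nra.
have es : expR s = e `^ s by rewrite -expRM mul1r.
have Gi0 : 0 <= ((s + 1) * (s * Gamma s))^-1.
  by rewrite invr_ge0 !mulr_ge0 ?Gamma_ge0// ltW.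
rewrite (le_trans (ler_pM _ Gi0 ss H)) ?mulr_ge0 ?(ltW s0) ?(ltW s10)//.
have -> : e ^+ 3 / N%:R = e * (e * (e / N%:R)) by ring.
rewrite (powRM _ (ltW e0)) ?(powRM _ (ltW e0)) ?mulr_ge0 ?(ltW eN) ?(ltW e0)//.
rewrite es le_eqVlt; apply/orP; left; apply/eqP.
by rewrite -[RHS]mul1r -[X in _ = X * _](divff (lt0r_neq0 NR)); ring.
Qed.

End rising_coefficients.

(** * Dominated series *)

Section series_estimates.
Context {R : realType}.
Implicit Types u v g : nat -> R.

Lemma dominated_series_cvg u g : (forall k, `|u k| <= g k) ->
  cvgn (series g) -> cvgn (series u).
Proof.
move=> ug cg; apply: normed_cvg.
apply: series_le_cvg cg => k /=; [by []|by apply: le_trans (ug k)|exact: ug].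
Qed.

Lemma series_tail_le u g K : (forall k, (K <= k)%N -> `|u k| <= g k) ->
  cvgn (series g) -> cvgn (series u) ->
  `|limn (series u) - series u K| <= limn (series g) - series g K.
Proof.
move=> ug cg cu.
have H1 : (fun n => `|series u n - series u K|) @ \oo -->
    `|limn (series u) - series u K|.
  by apply: cvg_norm; apply: cvgB => //; exact: cvg_cst.
have H2 : (fun n => series g n - series g K) @ \oo --> limn (series g) - series g K.
  by apply: cvgB => //; exact: cvg_cst.
rewrite -(cvg_lim (@Rhausdorff R) H1) -(cvg_lim (@Rhausdorff R) H2).
apply: ler_lim; [exact: cvgP H1|exact: cvgP H2|].
exists K => // n /= Kn; rewrite !sub_series_geq//.
rewrite (le_trans (ler_norm_sum _ _ _))// ler_sum_nat// => k /andP[Kk _].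
exact: ug.
Qed.

(* Tannery's theorem *)
Lemma series_cvg_dominated (U : nat -> nat -> R) u g (k0 n0 : nat) :
  (forall k, (fun n => U n k) @ \oo --> u k) ->
  (forall n k, (n0 <= n)%N -> (k0 <= k)%N -> `|U n k| <= g k) ->
  cvgn (series g) -> (forall n, (n0 <= n)%N -> cvgn (series (U n))) ->
  cvgn (series u) ->
  (fun n => limn (series (U n))) @ \oo --> limn (series u).
Proof.
move=> Uu Ug cg cU cu.
have ug k : (k0 <= k)%N -> `|u k| <= g k.
  move=> kk; apply: (cvgr_to_le (cvg_norm (Uu k))).
  by exists n0 => // n /= nn; exact: Ug.
apply/cvgrPdist_le => e e0.
have e3 : 0 < e / 3 by rewrite divr_gt0.
have /cvgrPdist_le /(_ _ e3) [K0 _ HK0] := cg.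
pose K := maxn k0 K0.
have tail : limn (series g) - series g K <= e / 3.
  by rewrite (le_trans (ler_norm _))//; apply: HK0; rewrite /= leq_maxr.
have partial : (fun n => series (U n) K) @ \oo --> series u K.
  rewrite /series/=; apply: cvg_big => //=; first exact: add_continuous.
have /cvgrPdist_le /(_ _ e3) [n1 _ Hn1] := partial.
exists (maxn n0 n1) => // n /=; rewrite geq_max => /andP[nn0 nn1].
have t1 : `|limn (series u) - series u K| <= e / 3.
  apply: le_trans tail; apply: series_tail_le => // k kK.
  by apply: ug; rewrite (leq_trans _ kK)// leq_maxl.
have t2 : `|limn (series (U n)) - series (U n) K| <= e / 3.
  apply: le_trans tail; apply: series_tail_le => //; last exact: cU.
  by move=> k kK; apply: Ug => //; rewrite (leq_trans _ kK)// leq_maxl.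
have t3 := Hn1 _ nn1; rewrite /= in t3.
have -> : limn (series u) - limn (series (U n)) =
  (limn (series u) - series u K) + (series u K - series (U n) K) -
  (limn (series (U n)) - series (U n) K) by ring.
rewrite (le_trans (ler_normB _ _))//.
have := ler_normD (limn (series u) - series u K) (series u K - series (U n) K).
lra.
Qed.

Lemma powR_base_small (x K a : R) : 0 < K -> 0 < a ->
  exists N, (0 < N)%N /\ forall n, (N <= n)%N -> `|x| * (K / n%:R) `^ a < 1.
Proof.
move=> K0 a0; pose c := ((`|x| + 1)^-1) `^ a^-1.
have x1 : 0 < `|x| + 1 by rewrite ltr_pwDr.
have c0 : 0 < c by rewrite powR_gt0// invr_gt0.
exists (Num.bound (K / c)).+1; split=> // n Nn.
have n0 : 0 < n%:R :> R by rewrite ltr0n (leq_trans _ Nn).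
have Kn : K / n%:R <= c.
  rewrite ler_pdivrMr// mulrC -ler_pdivrMr// (le_trans (ltW (archi_boundP _)))//.
    by rewrite divr_ge0// ltW.
  by rewrite ler_nat (leq_trans _ Nn).
have : (K / n%:R) `^ a <= c `^ a.
  by apply: ge0_ler_powR => //; rewrite ?nnegrE ?divr_ge0// ltW.
rewrite -powRrM mulVf ?gt_eqF// powRr1 ?invr_ge0 ?(ltW x1)// => H.
rewrite (le_lt_trans (ler_wpM2l (normr_ge0 x) H))//.
by rewrite ltr_pdivrMr// mul1r ltrDl.
Qed.

End series_estimates.

(** * The Mittag-Leffler function *)

Section pseries_entire.
Context {R : realType}.
Variable c : nat -> R.
Hypothesis cvgc : forall z, cvgn (pseries c z).

Lemma pseries_diffs_cvg z : cvgn (pseries (pseries_diffs c) z).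
Proof.
(* Doubling the radius absorbs the factor k + 1 <= 2^(k+1) created by differentiation. *)
pose w : R := 2 * (`|z| + 1); have w0 : 0 <= w by rewrite mulr_ge0// addr_ge0.
have : cvgn (pseries (fun i => `|c i|) w).
  have ww : `|w| < `|w + 1| by rewrite !ger0_norm ?addr_ge0// ltrDl.
  exact: (is_cvg_pseries_inside_norm (@cvgc (w + 1)) ww).
move=> /cvg_ex[l]; rewrite -cvg_shiftS => cw.
apply: (@dominated_series_cvg _ _ (fun k => `|c k.+1| * w ^+ k.+1)); last first.
  apply/cvg_ex; exists (l - `|c 0%N| * w ^+ 0).
  have cw2 : (fun n => pseries (fun i => `|c i|) w n.+1 - `|c 0%N| * w ^+ 0) @ \oo
      --> l - `|c 0%N| * w ^+ 0 by apply: cvgB => //; exact: cvg_cst.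
  apply: cvg_trans cw2; apply: near_eq_cvg; apply: nearW => n /=.
  by rewrite /pseries /series/= big_nat_recl// addrC addKr.
move=> k; rewrite /pseries_diffs !normrM normrX mulrAC mulrC ler_wpM2l//.
rewrite exprMn ger0_norm// ler_pM// ?exprn_ge0//.
  by rewrite -natrX ler_nat ltnW// ltn_expl.
rewrite exprS (@le_trans _ _ ((`|z| + 1) ^+ k))//.
  by rewrite lerXn2r ?nnegrE ?addr_ge0// lerDl.
by rewrite ler_peMl ?exprn_ge0 ?addr_ge0// lerDr.
Qed.

End pseries_entire.

Lemma pseries_derivable (R : realType) (c : nat -> R) (z : R) :
  (forall z, cvgn (pseries c z)) ->
  is_derive z (1 : R) (fun z => limn (pseries c z)) (limn (pseries (pseries_diffs c) z)).
Proof.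
move=> cvgc; have c1 := pseries_diffs_cvg cvgc; have c2 := pseries_diffs_cvg c1.
apply: (@pseries_snd_diffs _ c (`|z| + 1)) => //.
by rewrite [ltRHS]ger0_norm ?addr_ge0// ltrDl.
Qed.

Section mittag_leffler_series.
Context {R : realType}.
Variables (a b : R).
Hypotheses (a0 : 0 < a) (b0 : 0 < b).

Definition ml_coef (k : nat) : R := (Gamma (k%:R * a + b))^-1.

Let arg_gt0 k : 0 < k%:R * a + b.
Proof. by rewrite ltr_wpDl// mulr_ge0// ltW. Qed.

Lemma ml_coef_cvg (z : R) : cvgn (pseries ml_coef z).
Proof.
have e0 : 0 < expR 1 ^+ 3 :> R by rewrite exprn_gt0// expR_gt0.
have [N [N0 HN]] := powR_base_small z e0 a0.
pose r := `|z| * (expR 1 ^+ 3 / N%:R) `^ a.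
pose C := N%:R^-1 * (N`!)%:R * expR 1 ^+ 3 * (expR 1 ^+ 3 / N%:R) `^ b.
apply: (@dominated_series_cvg _ _ (geometric C r)); last first.
  by apply: is_cvg_geometric_series; rewrite ger0_norm ?HN// mulr_ge0// powR_ge0.
move=> k; rewrite normrM normrX ger0_norm ?invr_ge0 ?Gamma_ge0//.
have := Gamma_inv_le (arg_gt0 k) N0.
rewrite /geometric/= /C /r exprMn => H.
rewrite (le_trans (ler_wpM2r _ H)) ?exprn_ge0//.
rewrite powRD; last by rewrite gt_eqF ?implybT// divr_gt0// ltr0n.
rewrite mulrC powRrM (powRAC _ k%:R) powR_mulrn ?powR_ge0//.
by rewrite le_eqVlt; apply/orP; left; apply/eqP; ring.
Qed.

Lemma mittag_lefflerE z : mittag_leffler a b z = limn (pseries ml_coef z).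
Proof.
rewrite /mittag_leffler /pseries; congr (limn (series _)).
by apply/funext => k; rewrite mulrC.
Qed.

Lemma continuous_mittag_leffler : continuous (mittag_leffler a b).
Proof.
move=> z; apply: differentiable_continuous; apply/derivable1_diffP.
have -> : mittag_leffler a b = (fun z => limn (pseries ml_coef z)).
  by apply/funext => y; exact: mittag_lefflerE.
by have [] := pseries_derivable z ml_coef_cvg.
Qed.

End mittag_leffler_series.

(** The functional equation cancels k + 1 in (k + 1) / Gamma((k + 1) a + 1); this is E_{a,1}' =
    E_{a,a} / a at the level of coefficients. *)
Lemma ml_coef_diffs (R : realType) (a : R) k : 0 < a ->
  pseries_diffs (ml_coef a 1) k = a^-1 * ml_coef a a k.
Proof.
move=> a0; have ka : 0 < k.+1%:R * a by rewrite mulr_gt0.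
rewrite /pseries_diffs /ml_coef (GammaD1 ka) (_ : k%:R * a + a = k.+1%:R * a); last first.
  by rewrite -natr1 mulrDl mul1r.
rewrite 2!invfM !mulrA mulfV ?mul1r//.
Qed.

Lemma mittag_leffler_derivative (R : realType) (a z : R) : 0 < a ->
  is_derive z (1 : R) (mittag_leffler a 1) (a^-1 * mittag_leffler a a z).
Proof.
move=> a0; have -> : mittag_leffler a 1 = (fun z => limn (pseries (ml_coef a 1) z)).
  by apply/funext => y; exact: mittag_lefflerE.
have := pseries_derivable z (ml_coef_cvg a0 ltr01).
have -> : limn (pseries (pseries_diffs (ml_coef a 1)) z) = a^-1 * mittag_leffler a a z; last by [].
rewrite mittag_lefflerE; apply: cvg_lim => //.
have : (fun n => a^-1 * pseries (ml_coef a a) z n) @ \oo -->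
    a^-1 * limn (pseries (ml_coef a a) z).
  by apply: cvgM; [exact: cvg_cst|exact: ml_coef_cvg].
apply: cvg_trans; apply: near_eq_cvg; apply: nearW => n.
rewrite /pseries /series/= mulr_sumr; apply: eq_bigr => k _.
by rewrite mulrA ml_coef_diffs.
Qed.

(** * Bounds for E_{a,a} on the negative half-line *)

Section mittag_leffler_bounds.
Context {R : realType}.
Variable a : R.
Hypotheses (a0 : 0 < a) (a1 : a < 1).

Let arg k : R := k%:R * a + a.

Let arg_gt0 k : 0 < arg k.
Proof. by rewrite ltr_wpDl// mulr_ge0// ltW. Qed.

Section discrete_resolvent.
Variable m : R.
Hypotheses (m0 : 0 <= m) (m1 : m < 1).

(* The sum over k of T n k is the coefficient of z^n in 1 / ((1 - z)^a + m); multiplying by (1 - z)^a gives a Volterra recurrence whose sign pattern yields the bounds. *)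
Let T n k := (- m) ^+ k * nbin (arg k) n.

Lemma discrete_resolvent_cvg n :
  cvgn (series (fun k => (- m) ^+ k * nbin (k%:R * a + a) n)).
Proof.
(* The coefficients grow in k like e^(e a k), with [e] small enough to keep the ratio below 1: e^(-e
   a) >= 1 - e a > 1 - e = (1 + m) / 2 > m. *)
pose e := (1 - m) / 2; have e0 : 0 < e by rewrite divr_gt0// subr_gt0.
pose r := m * expR (e * a).
have r1 : r < 1.
  rewrite /r -ltr_pdivlMr ?expR_gt0// div1r -expRN.
  rewrite (lt_le_trans _ (expR_ge1Dx _))//.
  have ea : e * a < e by rewrite gtr_pMr.
  have eE : 2 * e = 1 - m by rewrite /e mulrC divfK.
  lra.
apply: (@dominated_series_cvg _ _ (geometric ((n`!)%:R / e ^+ n * expR (e * (1 + a))) r)).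
  move=> k; rewrite /geometric/= normrM normrX normrN (ger0_norm m0).
  have p := nbin_gt0 n (arg_gt0 k).
  rewrite (ger0_norm (ltW p)) /r [(m * _) ^+ k]exprMn -expRM_natr mulrCA ler_wpM2l ?exprn_ge0//.
  have H := nbin_le n (arg_gt0 k).
  have sk : 0 <= 1 + arg k by rewrite addr_ge0// ltW.
  rewrite (le_trans H)// (le_trans (expr_le_expR n e0 sk))//.
  have -> : expR (e * (1 + arg k)) = expR (e * (1 + a)) * expR (e * a * k%:R).
    by rewrite -expRD; congr expR; rewrite /arg; ring.
  by rewrite mulrA.
by apply: is_cvg_geometric_series; rewrite ger0_norm// mulr_ge0// expR_ge0.
Qed.

Let T_cvg n : cvgn (series (T n)).
Proof. exact: discrete_resolvent_cvg. Qed.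

Let Y n := limn (series (T n)).

Let Y_convolution n :
  \sum_(j < n.+1) nbin (- a) j * Y (n - j) = nbin 0 n - m * Y n.
Proof.
have H1 : (fun K => \sum_(j < n.+1) nbin (- a) j * series (T (n - j)) K) @ \oo -->
    \sum_(j < n.+1) nbin (- a) j * Y (n - j).
  apply: cvg_big => //=; first exact: add_continuous.
  by move=> j _; apply: cvgM; [exact: cvg_cst|exact: T_cvg].
have H2 : (fun K => nbin 0 n + - m * series (T n) K) @ \oo --> nbin 0 n - m * Y n.
  rewrite -mulNr; apply: cvgD; first exact: cvg_cst.
  by apply: cvgM; [exact: cvg_cst|exact: T_cvg].
suff H3 : (fun K => nbin 0 n + - m * series (T n) K) @ \oo -->
    \sum_(j < n.+1) nbin (- a) j * Y (n - j).
  by rewrite -(cvg_lim (@Rhausdorff R) H3) (cvg_lim (@Rhausdorff R) H2).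
(* The truncation is shifted by one: multiplication by (1 - z)^a removes one factor (1 - z)^(-a)
   from each term, so K + 1 terms become 1 followed by -m times the first K terms. *)
rewrite -cvg_shiftS in H1; apply: cvg_trans H1; apply: near_eq_cvg; apply: nearW => K.
rewrite /= /series/=.
under eq_bigr do rewrite mulr_sumr.
rewrite exchange_big/=.
under eq_bigr => k _.
  under eq_bigr do rewrite /T mulrCA.
  rewrite -mulr_sumr -nbinD; over.
rewrite big_nat_recl//= mulr_sumr expr0 mul1r.
rewrite (_ : - a + arg 0 = 0); last by rewrite /arg mul0r add0r addNr.
congr (_ + _).
apply: eq_bigr => k _; rewrite exprS -mulrA; congr (_ * (_ * nbin _ _)).
by rewrite /arg -natr1 mulrDl mul1r addrC addrK.
Qed.

Let nbin_convolution n :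
  \sum_(j < n.+1) nbin (- a) j * nbin a (n - j) = nbin 0 n.
Proof. by rewrite -nbinD addNr. Qed.

(** The induction step in isolation: [y] is the resolvent coefficient, [z] the coefficient of (1 -
    z)^(-a), and [s1], [s2] are the history terms of the two recurrences. Then (1 + m) y = b - s2
    and z - y = (s2 - s1) + m y. *)
Let convolution_step (y z b s1 s2 : R) : z + s1 = b -> y + s2 = b - m * y ->
  0 <= b -> s1 <= s2 -> s2 <= 0 -> 0 <= y <= z.
Proof.
move=> E1 E2 b0 s12 s20.
have y0 : 0 <= y by rewrite -(pmulr_rge0 _ (ltr_pwDl ltr01 m0)) mulrDl; lra.
by rewrite y0; have := mulr_ge0 m0 y0; lra.
Qed.

(** [nbin a] solves the same recurrence with m = 0. As the weights [nbin (- a) j] with j >= 1 are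
    non-positive, the induction hypothesis orders the history terms of the two recurrences and gives
    both bounds at once. *)
Lemma discrete_resolvent_bounds n :
  0 <= limn (series (fun k => (- m) ^+ k * nbin (k%:R * a + a) n)) <= nbin a n.
Proof.
rewrite -/(Y n); elim/ltn_ind: n => n IH.
have := Y_convolution n; have := nbin_convolution n.
rewrite !big_ord_recl subn0 nbin_0 !mul1r.
have a01 : 0 < a < 1 by rewrite a0.
set S1 := \sum_(_ < _) _; set S2 := \sum_(_ < _) _ => E1 E2.
have : S1 <= S2 /\ S2 <= 0.
  split.
    apply: ler_sum => j _.
    have /IH/andP[_ H] : (n - lift ord0 j < n)%N.
      by rewrite ltn_subrL/=; case: n j {IH E1 E2 S1 S2} => [[]|].
    by apply: ler_wnM2l => //; exact: nbinN_le0.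
  apply: sumr_le0 => j _.
  have /IH/andP[H _] : (n - lift ord0 j < n)%N.
    by rewrite ltn_subrL/=; case: n j {IH E1 E2 S1 S2} => [[]|].
  by apply: mulr_le0_ge0 => //; exact: nbinN_le0.
have : 0 <= nbin 0 n :> R by rewrite nbin0.
by move=> b0 [s1 s2]; exact: convolution_step E1 E2 b0 s1 s2.
Qed.

End discrete_resolvent.

(* For m = x / n^a the discrete resolvents, multiplied by n^(1-a), converge to E_{a,a}(-x) by Tannery's theorem. *)
Lemma mittag_leffler_bounds x : 0 <= x ->
  0 <= mittag_leffler a a (- x) <= (Gamma a)^-1.
Proof.
move=> x0.
(* The k-th term of the rescaled resolvent: with m = x / n^a the power n^(-k a) in m^k completes
   n^(1-a) to the normalization belonging to [arg k], so the limit in n is (-x)^k / Gamma(k a +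
   a). *)
pose U n k := nbin_scaled (arg k) n * (- x) ^+ k.
have [N [N0 HN]] := powR_base_small x (expR_gt0 1) a0.
have xn n : (N <= n)%N -> x / n%:R `^ a < 1.
  move=> Nn; apply: le_lt_trans (HN _ Nn).
  have nR : 0 < n%:R :> R by rewrite ltr0n (leq_trans N0).
  rewrite ger0_norm// ler_wpM2l// powRM ?expR_ge0 ?invr_ge0//.
  have -> : n%:R^-1 `^ a = (n%:R `^ a)^-1 :> R by rewrite -powR_inv1// -powRrM mulN1r powRN.
  rewrite ler_peMl ?invr_ge0 ?powR_ge0// -expRM mul1r -expR0 ler_expR ltW//.
have UE n : (N <= n)%N -> series (U n) =
    (fun K => n%:R `^ (1 - a) *
      series (fun k => (- (x / n%:R `^ a)) ^+ k * nbin (k%:R * a + a) n) K).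
  move=> Nn; apply/funext => K; rewrite /series/= mulr_sumr; apply: eq_bigr => k _.
  have nR : 0 < n%:R :> R by rewrite ltr0n (leq_trans N0).
  rewrite /U /nbin_scaled -mulNr exprMn exprVn.
  have -> : 1 - arg k = (1 - a) - k%:R * a by rewrite /arg; ring.
  rewrite powRB ?(gt_eqF nR) ?implybT//.
  have -> : n%:R `^ (k%:R * a) = (n%:R `^ a) ^+ k :> R.
    by rewrite mulrC powRrM powR_mulrn// powR_ge0.
  by rewrite /arg; ring.
have m0 n : 0 <= x / n%:R `^ a by rewrite divr_ge0// powR_ge0.
have Ucvg n : (N <= n)%N -> series (U n) @ \oo -->
   n%:R `^ (1 - a) * limn (series (fun k => (- (x / n%:R `^ a)) ^+ k * nbin (k%:R * a + a) n)).
  move=> Nn; rewrite UE//; apply: cvgM; first exact: cvg_cst.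
  by apply: discrete_resolvent_cvg; [exact: m0|exact: xn].
have Ub n : (N <= n)%N -> 0 <= limn (series (U n)) <= nbin_scaled a n.
  move=> Nn; rewrite (cvg_lim (@Rhausdorff R) (Ucvg _ Nn)).
  have /andP[H1 H2] := @discrete_resolvent_bounds _ (m0 n) (xn _ Nn) n.
  by rewrite mulr_ge0 ?powR_ge0//= ler_wpM2l ?powR_ge0.
have Tan : (fun n => limn (series (U n))) @ \oo --> mittag_leffler a a (- x).
  rewrite mittag_lefflerE.
  pose C := N%:R * (N`!)%:R * expR 1 * (expR 1 / N%:R) `^ a.
  pose r := `|x| * (expR 1 / N%:R) `^ a.
  (* From k = [Num.bound (2 / a)] on, [arg k] is at least 2, so [nbin_scaled] at n >= [N] is at most
     its value at [N], which is geometric in k. The choice of [N] makes the ratio [r] smaller than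
     1. *)
  apply: (@series_cvg_dominated _ _ _ (geometric C r) (Num.bound (2 / a)) N).
  - by move=> k; apply: cvgM; [exact: nbin_scaled_cvg|exact: cvg_cst].
  - move=> n k Nn kk; rewrite /U normrM normrX normrN.
    have s2 : 2 <= arg k.
      rewrite /arg ler_wpDr ?(ltW a0)// -ler_pdivrMr//.
      rewrite (le_trans (ltW (archi_boundP _)))// ?ler_nat//.
      by rewrite divr_ge0// ltW.
    have p : 0 <= nbin_scaled (arg k) n.
      by rewrite mulr_ge0 ?powR_ge0// ltW// nbin_gt0.
    rewrite (ger0_norm p) /geometric/= /r exprMn mulrCA mulrC.
    rewrite ler_wpM2l ?exprn_ge0//.
    rewrite (le_trans (nbin_scaled_antitone s2 N0 Nn))//.
    rewrite (le_trans (nbin_scaled_le (arg_gt0 k) N0))//.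
    have eN : 0 < expR 1 / N%:R :> R by rewrite divr_gt0 ?expR_gt0// ltr0n.
    rewrite /arg powRD ?(gt_eqF eN) ?implybT//.
    have -> : (expR 1 / N%:R) `^ (k%:R * a) = ((expR 1 / N%:R) `^ a) ^+ k :> R.
      by rewrite [k%:R * a]mulrC powRrM powR_mulrn ?powR_ge0.
    rewrite /C.
    by rewrite le_eqVlt; apply/orP; left; apply/eqP; ring.
  - by apply: is_cvg_geometric_series; rewrite ger0_norm ?HN// mulr_ge0// powR_ge0.
  - by move=> n /Ucvg; exact: cvgP.
  - exact: ml_coef_cvg.
apply/andP; split.
  by apply: (cvgr_to_ge Tan); exists N => // n /= /Ub/andP[].
have H : (fun n => nbin_scaled a n - limn (series (U n))) @ \oo -->
    (Gamma a)^-1 - mittag_leffler a a (- x).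
  by apply: cvgB => //; exact: nbin_scaled_cvg.
rewrite -subr_ge0; apply: (cvgr_to_ge H); exists N => // n /= /Ub/andP[_].
by rewrite subr_ge0.
Qed.

End mittag_leffler_bounds.

(** * The convolution kernel and its integral *)

Section mittag_leffler_kernel.
Context {R : realType}.
Let mu := @lebesgue_measure R.

Lemma ge0_FTC_oo (t : R) (f F : R -> R) (la lb : R) : 0 < t ->
  (forall s, 0 < s < t -> {for s, continuous f}) ->
  (forall s, 0 < s < t -> is_derive s 1 F (f s)) ->
  (forall s, 0 < s < t -> 0 <= f s) ->
  F (t * n.+3%:R^-1) @[n --> \oo] --> la ->
  F (t - t * n.+3%:R^-1) @[n --> \oo] --> lb ->
  (\int[mu]_(s in `]0%R, t[) (f s)%:E = (lb - la)%:E)%E.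
Proof.
move=> t0 cf dF f0 Fa Fb.
(* Offset 3 is the least that keeps the intervals nondegenerate: offset 2 would start with
   [t/2, t/2]. *)
have n3 n : (3%:R : R) <= n.+3%:R by rewrite ler_nat.
have DE : [set` (`]0, t[ : interval R)] =
    \bigcup_n [set` `[t * n.+3%:R^-1, t - t * n.+3%:R^-1]].
  apply/seteqP; split => x /=; last first.
    move=> [n _ /=]; rewrite !in_itv/= => /andP[x1 x2].
    have p : 0 < t * n.+3%:R^-1 by rewrite mulr_gt0 ?invr_gt0.
    by rewrite (lt_le_trans p x1) (le_lt_trans x2)// gtrBl.
  rewrite in_itv/= => /andP[x0 xt].
  have tx0 : 0 < t - x by rewrite subr_gt0.
  exists (Num.bound (t / x) + Num.bound (t / (t - x)))%N => //=; rewrite in_itv/=.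
  have xb y : 0 < y -> t / y < (Num.bound (t / y))%:R.
    by move=> y0; rewrite archi_boundP// divr_ge0// ltW.
  apply/andP; split.
    rewrite ler_pdivrMr// mulrC -ler_pdivrMr// (le_trans (ltW (xb _ x0)))//.
    by rewrite ler_nat; do 3 apply: leqW; exact: leq_addr.
  rewrite lerBrDl -lerBrDr ler_pdivrMr// mulrC -ler_pdivrMr//.
  rewrite (le_trans (ltW (xb _ tx0)))//.
  by rewrite ler_nat; do 3 apply: leqW; exact: leq_addl.
have inD s : [set` (`]0, t[ : interval R)] s -> 0 < s < t by rewrite /= in_itv.
apply: (ge0_FTC_exhaustion (u := fun n => t * n.+3%:R^-1)
  (v := fun n => t - t * n.+3%:R^-1) (F := F) _ _ _ DE) => //.
- move=> n; rewrite ltrBrDl -mulrDr gtr_pMr// -mulr2n -[_ *+ 2]mulr_natr.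
  by rewrite mulrC ltr_pdivrMr// mul1r (lt_le_trans _ (n3 n))// ltr_nat.
- by move=> m n mn; rewrite ler_pM2l// lef_pV2 ?posrE// ler_nat.
- by move=> m n mn; rewrite lerD2l lerN2 ler_pM2l// lef_pV2 ?posrE// ler_nat.
Qed.

Lemma invSSS_powR_cvg0 (t a : R) : 0 < t -> 0 < a ->
  (t * n.+3%:R^-1) `^ a @[n --> \oo] --> 0.
Proof.
move=> t0 a0; have H : (fun n => t `^ a * n.+3%:R^-1 `^ a) @ \oo --> t `^ a * 0.
  apply: cvgM; first exact: cvg_cst.
  by have := invSS_powR_cvg0 a0; rewrite -cvg_shiftS.
rewrite mulr0 in H; apply: cvg_trans H; apply: near_eq_cvg; apply: nearW => n /=.
by rewrite powRM// ltW.
Qed.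

Lemma subSSS_powR_cvg (t a : R) : 0 < t ->
  (t - t * n.+3%:R^-1) `^ a @[n --> \oo] --> t `^ a.
Proof.
move=> t0; have H : (fun n => t - t * n.+3%:R^-1) @ \oo --> t.
  rewrite -[X in _ --> X]subr0 -[X in _ - X](mulr0 t).
  apply: cvgB; first exact: cvg_cst.
  apply: cvgM; first exact: cvg_cst.
  have := @cvg_harmonic R; rewrite -(cvg_shiftn 2); apply: cvg_trans.
  by apply: near_eq_cvg; apply: nearW => n /=; rewrite addn2.
exact: (@cvg_comp _ _ _ (fun n => t - t * n.+3%:R^-1) (fun x => x `^ a) _ _ _ H
  (continuous_powR_gt0 t0)).
Qed.

Variables (a t : R).
Hypotheses (a0 : 0 < a) (a1 : a < 1) (t0 : 0 < t).

Let is_derive_powR_sub s : 0 < s < t ->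
  is_derive s 1 (fun s => (t - s) `^ a) (- (a * (t - s) `^ (a - 1))).
Proof.
move=> /andP[_ st]; have ts : 0 < t - s by rewrite subr_gt0.
have d1 := is_derive1_powR a ts.
have d2 : is_derive s 1 (fun s => t - s) (-1).
  have := is_deriveB (@is_derive_cst _ _ R^o t s 1) (is_derive_id s 1).
  by rewrite sub0r.
by have := @is_derive1_comp _ (fun x => x `^ a) (fun s => t - s) s _ _ d1 d2; rewrite mulrN1.
Qed.

Let continuous_powR_sub b s : 0 < s < t ->
  {for s, continuous (fun s => (t - s) `^ b)}.
Proof.
move=> /andP[_ st].
apply: (@continuous_comp _ _ _ (fun s => t - s) (fun x => x `^ b)).
  by apply: continuousB; [exact: cst_continuous|exact: cvg_id].
by apply: continuous_powR_gt0; rewrite subr_gt0.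
Qed.

Lemma integral_powR_sub :
  (\int[mu]_(s in `]0%R, t[) ((t - s) `^ (a - 1))%:E = (t `^ a / a)%:E)%E.
Proof.
have dF s : 0 < s < t ->
    is_derive s 1 (fun s => - (a^-1 * (t - s) `^ a)) ((t - s) `^ (a - 1)).
  move=> st; have := is_deriveN (is_deriveZ a^-1 (is_derive_powR_sub st)).
  by rewrite scalerN opprK /GRing.scale/= mulKf ?gt_eqF.
have -> : t `^ a / a = - (a^-1 * 0) - (- (a^-1 * t `^ a)).
  by rewrite mulr0 oppr0 sub0r opprK mulrC.
apply: (ge0_FTC_oo t0 _ dF).
- by move=> s st; exact: continuous_powR_sub.
- by move=> s _; exact: powR_ge0.
- apply: cvgN; apply: cvgM; first exact: cvg_cst.
  exact: subSSS_powR_cvg.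
- apply: cvgN; apply: cvgM; first exact: cvg_cst.
  have := invSSS_powR_cvg0 t0 a0; apply: cvg_trans; apply: near_eq_cvg.
  by apply: nearW => n /=; rewrite opprB addrC subrK.
Qed.

Variable L : R.
Hypothesis L0 : 0 < L.

Definition ml_kernel (s : R) : R :=
  (t - s) `^ (a - 1) * mittag_leffler a a (- (L * (t - s) `^ a)).

Lemma ml_kernel_bounds s : 0 <= ml_kernel s <= (Gamma a)^-1 * (t - s) `^ (a - 1).
Proof.
have /andP[H1 H2] := @mittag_leffler_bounds R a a0 a1 (L * (t - s) `^ a)
  (mulr_ge0 (ltW L0) (powR_ge0 _ _)).
rewrite /ml_kernel; apply/andP; split; first by rewrite mulr_ge0 ?powR_ge0.
by rewrite mulrC ler_wpM2r ?powR_ge0.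
Qed.

Lemma continuous_ml_kernel s : 0 < s < t -> {for s, continuous ml_kernel}.
Proof.
move=> st; apply: continuousM; first exact: continuous_powR_sub.
apply: (@continuous_comp _ _ _ (fun s => - (L * (t - s) `^ a)) (mittag_leffler a a)).
  apply: continuousN; apply: continuousM; first exact: cst_continuous.
  exact: continuous_powR_sub.
exact: continuous_mittag_leffler.
Qed.

Lemma mittag_leffler0 : mittag_leffler a 1 0 = 1 :> R.
Proof.
rewrite /mittag_leffler; apply: cvg_lim => //.
have : (fun=> 1 : R) @ \oo --> (1 : R) by exact: cvg_cst.
rewrite -(cvg_shiftS (series _)); apply: cvg_trans; apply: near_eq_cvg.
apply: nearW => n; rewrite /series/= big_nat_recl// big1 => [|k _].
  by rewrite addr0 expr0 mul0r add0r Gamma1 divr1.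
by rewrite expr0n mul0r.
Qed.

Lemma integral_ml_kernel :
  (\int[mu]_(s in `]0%R, t[) (ml_kernel s)%:E =
   (L^-1 * (1 - mittag_leffler a 1 (- (L * t `^ a))))%:E)%E.
Proof.
(* An antiderivative of the kernel, because E_{a,1}' = E_{a,a} / a; its limit at s = t is E_{a,1}(0)
   / L = 1 / L. *)
pose F s := L^-1 * mittag_leffler a 1 (- (L * (t - s) `^ a)).
have Fcvg (w : nat -> R) l : (t - w n) `^ a @[n --> \oo] --> l ->
    F (w n) @[n --> \oo] --> L^-1 * mittag_leffler a 1 (- (L * l)).
  move=> wl; apply: cvgM; first exact: cvg_cst.
  apply: continuous_cvg; first exact: continuous_mittag_leffler.
  by apply: cvgN; apply: cvgM => //; exact: cvg_cst.
have dF s : 0 < s < t -> is_derive s 1 F (ml_kernel s).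
  move=> st; have d1 := is_deriveN (is_deriveZ L (is_derive_powR_sub st)).
  have d2 := is_deriveZ L^-1 (@is_derive1_comp _ _
    (fun s => - (L * (t - s) `^ a)) s _ _
    (mittag_leffler_derivative (- (L * (t - s) `^ a)) a0) d1).
  rewrite /F; apply: is_derive_eq.
  rewrite scalerN opprK /GRing.scale/= /ml_kernel.
  have -> : a^-1 * mittag_leffler a a (- (L * (t - s) `^ a)) *
      (L * (a * (t - s) `^ (a - 1))) = L * ((a^-1 * a) *
      ((t - s) `^ (a - 1) * mittag_leffler a a (- (L * (t - s) `^ a)))).
    by move: ((t - s) `^ (a - 1)) (mittag_leffler a a _) => x y; ring.
  by rewrite mulVf ?gt_eqF// mul1r mulKf ?gt_eqF.
have -> : L^-1 * (1 - mittag_leffler a 1 (- (L * t `^ a))) =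
    L^-1 * mittag_leffler a 1 (- (L * 0)) - L^-1 * mittag_leffler a 1 (- (L * t `^ a)).
  by rewrite mulr0 oppr0 mittag_leffler0 mulrBr.
apply: (ge0_FTC_oo t0 _ dF).
- exact: continuous_ml_kernel.
- by move=> s _; have /andP[] := ml_kernel_bounds s.
- by apply: Fcvg; exact: subSSS_powR_cvg.
- apply: Fcvg; have := invSSS_powR_cvg0 t0 a0; apply: cvg_trans; apply: near_eq_cvg.
  by apply: nearW => n /=; rewrite opprB addrC subrK.
Qed.

End mittag_leffler_kernel.

(** * Orthonormal expansions *)

Section L2_space.
Context {d : measure_display} {T : measurableType d} {R : realType}.
Variable mu : {measure set T -> \bar R}.
Implicit Types (u v w : T -> R) (a : R).
Local Notation L2 := (Lfun mu 2%:E).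

Lemma L2_measurable u : u \in L2 -> measurable_fun setT u.
Proof. by rewrite inE => /andP[/[!inE]]. Qed.

Let le12 : (1 <= 2%:E :> \bar R)%E.
Proof. by rewrite lee_fin ler1n. Qed.

Lemma L2D u v : u \in L2 -> v \in L2 -> (fun x => u x + v x) \in L2.
Proof. by have [_] := @Lfun_addr_closed _ _ _ mu _ le12; apply. Qed.

Lemma L2Z a u : u \in L2 -> (fun x => a * u x) \in L2.
Proof.
have -> : (fun x => a * u x) = a \o* u by apply/funext => x /=; rewrite mulrC.
by apply: Lfun_scale; rewrite ler1n.
Qed.

Lemma L2B u v : u \in L2 -> v \in L2 -> (fun x => u x - v x) \in L2.
Proof.
move=> Lu Lv; have -> : (fun x => u x - v x) = (fun x => u x + -1 * v x).
  by apply/funext => x /=; rewrite mulN1r.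
by apply: L2D => //; exact: L2Z.
Qed.

Lemma L2_0 : (fun=> 0 : R) \in L2.
Proof. by have [] := @Lfun_addr_closed _ _ _ mu _ le12. Qed.

Lemma L2_sum (c : nat -> R) (phi : nat -> T -> R) (N : nat) :
  (forall n, phi n \in L2) -> (fun x => \sum_(n < N) c n * phi n x) \in L2.
Proof.
move=> Lphi; elim: N => [|N IH].
  by under eq_fun do rewrite big_ord0; exact: L2_0.
under eq_fun do rewrite big_ord_recr/=.
by apply: L2D => //; exact: L2Z.
Qed.

Lemma L2_mul_integrable u v : u \in L2 -> v \in L2 ->
  mu.-integrable setT (EFin \o (fun x => u x * v x)).
Proof. by move=> Lu Lv; apply/Lfun1_integrable/Lfun2_mul_Lfun1. Qed.

Lemma innerC u v : inner mu u v = inner mu v u.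
Proof. by apply: eq_Rintegral => x _; rewrite mulrC. Qed.

Lemma innerDl u v w : u \in L2 -> v \in L2 -> w \in L2 ->
  inner mu (fun x => u x + v x) w = inner mu u w + inner mu v w.
Proof.
move=> Lu Lv Lw; rewrite /inner -RintegralD//; last 2 first.
  exact: L2_mul_integrable.
  exact: L2_mul_integrable.
by apply: eq_Rintegral => x _; rewrite mulrDl.
Qed.

Lemma innerZl a u w : u \in L2 -> w \in L2 ->
  inner mu (fun x => a * u x) w = a * inner mu u w.
Proof.
move=> Lu Lw; rewrite /inner -RintegralZl//; last exact: L2_mul_integrable.
by apply: eq_Rintegral => x _; rewrite mulrA.
Qed.

Lemma innerBl u v w : u \in L2 -> v \in L2 -> w \in L2 ->
  inner mu (fun x => u x - v x) w = inner mu u w - inner mu v w.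
Proof.
move=> Lu Lv Lw; rewrite -[inner mu v w]mul1r -mulNr -innerZl// -innerDl//; last exact: L2Z.
by congr inner; apply/funext => x; rewrite mulN1r.
Qed.

Lemma inner0l w : inner mu (fun=> 0) w = 0.
Proof.
rewrite /inner; under eq_Rintegral do rewrite mul0r.
by rewrite /Rintegral integral0.
Qed.

Lemma inner_suml (c : nat -> R) (phi : nat -> T -> R) (N : nat) w :
  (forall n, phi n \in L2) -> w \in L2 ->
  inner mu (fun x => \sum_(n < N) c n * phi n x) w =
  \sum_(n < N) c n * inner mu (phi n) w.
Proof.
move=> Lphi Lw; elim: N => [|N IH].
  rewrite big_ord0 -[RHS](inner0l w); congr inner.
  by apply/funext => x; rewrite big_ord0.
rewrite big_ord_recr/= -IH -innerZl// -innerDl//; last 2 first.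
  exact: L2_sum.
  exact: L2Z.
by congr inner; apply/funext => x; rewrite big_ord_recr.
Qed.

Lemma inner_ge0 u : 0 <= inner mu u u.
Proof. by apply: Rintegral_ge0 => x _; rewrite -expr2 sqr_ge0. Qed.

Lemma integral_sqr u : u \in L2 ->
  (\int[mu]_x (u x ^+ 2)%:E = (inner mu u u)%:E)%E.
Proof.
move=> Lu; rewrite /inner /Rintegral fineK//.
exact/integrable_fin_num/L2_mul_integrable.
Qed.

Lemma L2norm_sqrt u : L2norm mu u = sqrte (\int[mu]_x (u x ^+ 2)%:E)%E.
Proof.
rewrite /L2norm unlock /Lnorm poweR12_sqrt ?integral_ge0//; last first.
  by move=> x _; exact: poweR_ge0.
congr sqrte; apply: eq_integral => x _ /=.
by rewrite powR_mulrn// -normrX ger0_norm ?sqr_ge0.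
Qed.

Lemma L2normE u : u \in L2 -> L2norm mu u = (Num.sqrt (inner mu u u))%:E.
Proof. by move=> Lu; rewrite L2norm_sqrt integral_sqr. Qed.

Lemma L2P u : measurable_fun setT u ->
  (\int[mu]_x (u x ^+ 2)%:E < +oo)%E -> u \in L2.
Proof.
move=> mu' i; rewrite inE; apply/andP; split; rewrite inE//=.
rewrite /finite_norm -/(L2norm mu u) L2norm_sqrt.
by move: (integral _ _ _) i => [r||]//= _; rewrite ltry.
Qed.

Lemma inner_sqrD u v : u \in L2 -> v \in L2 ->
  inner mu (fun x => u x + v x) (fun x => u x + v x) =
  inner mu u u + 2 * inner mu u v + inner mu v v.
Proof.
move=> Lu Lv; have Luv := L2D Lu Lv.
rewrite innerDl// !(innerC _ (fun x => u x + v x)) !innerDl//.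
by rewrite (innerC v u); ring.
Qed.

Lemma Cauchy_Schwarz_L2 u v : u \in L2 -> v \in L2 ->
  `|inner mu u v| <= Num.sqrt (inner mu u u) * Num.sqrt (inner mu v v).
Proof.
move=> Lu Lv; rewrite -sqrtrM ?inner_ge0// -sqrtr_sqr ler_wsqrtr//.
have key t : 0 <= inner mu u u + 2 * (t * inner mu u v) + t ^+ 2 * inner mu v v.
  have := inner_ge0 (fun x => u x + t * v x).
  rewrite inner_sqrD//; last exact: L2Z.
  rewrite (innerC u) !innerZl//; last exact: L2Z.
  by rewrite (innerC v (fun x => t * v x)) innerZl// (innerC v u) !mulrA expr2.
have [v0|v0] := eqVneq (inner mu v v) 0.
  rewrite v0 mulr0; set b := inner mu u v in key *.
  have [->|b0] := eqVneq b 0; first by rewrite expr0n.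
  (* When [inner mu v v] vanishes the quadratic is affine in t; this t gives it the value -1. *)
  have := key (- (inner mu u u + 1) / (2 * b)).
  rewrite v0 mulr0 addr0 mulrCA.
  have -> : - (inner mu u u + 1) / (2 * b) * (2 * b) = - (inner mu u u + 1).
    by rewrite divfK// mulf_neq0.
  by have := inner_ge0 u; lra.
have vp : 0 < inner mu v v by rewrite lt_neqAle eq_sym v0 inner_ge0.
have := key (- inner mu u v / inner mu v v).
move: (inner mu u u) (inner mu u v) (inner mu v v) v0 vp => A B C C0 Cp.
have -> : A + 2 * (- B / C * B) + (- B / C) ^+ 2 * C = A - B ^+ 2 / C.
  have -> : (- B / C) ^+ 2 * C = B ^+ 2 / C * (C / C) by ring.
  by rewrite divff// mulr1; ring.
by rewrite subr_ge0 ler_pdivrMr.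
Qed.

Lemma L2_triangle u v : u \in L2 -> v \in L2 ->
  Num.sqrt (inner mu (fun x => u x + v x) (fun x => u x + v x)) <=
  Num.sqrt (inner mu u u) + Num.sqrt (inner mu v v).
Proof.
move=> Lu Lv; rewrite -[leRHS]ger0_norm ?addr_ge0 ?sqrtr_ge0// -sqrtr_sqr ler_wsqrtr//.
rewrite inner_sqrD// sqrrD !sqr_sqrtr ?inner_ge0// lerD2r lerD2l.
rewrite mulr_natl ler_wMn2r// (le_trans (ler_norm _))//.
exact: Cauchy_Schwarz_L2.
Qed.

Lemma cvg_EFinP (f : nat -> R) (l : R) :
  (f n)%:E @[n --> \oo] --> l%:E -> f n @[n --> \oo] --> l.
Proof. by move=> /fine_cvg. Qed.

Lemma inner_ae u v w : u \in L2 -> v \in L2 -> w \in L2 ->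
  u = v %[ae mu] -> inner mu u w = inner mu v w.
Proof.
move=> Lu Lv Lw uv; congr fine; apply: ae_eq_integral => //.
- by have /integrableP[] := L2_mul_integrable Lu Lw.
- by have /integrableP[] := L2_mul_integrable Lv Lw.
by apply: filterS uv => x /= uvx xT; rewrite uvx.
Qed.

Lemma L2norm_cvg0P (u : nat -> T -> R) : (forall n, u n \in L2) ->
  L2norm mu (u n) @[n --> \oo] --> 0%E <-> inner mu (u n) (u n) @[n --> \oo] --> 0.
Proof.
move=> Lu; under eq_fun do rewrite L2normE//; split => [H|H].
  have H1 : Num.sqrt (inner mu (u n) (u n)) @[n --> \oo] --> 0.
    by apply: cvg_EFinP; exact: H.
  have H2 : Num.sqrt (inner mu (u n) (u n)) * Num.sqrt (inner mu (u n) (u n))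
    @[n --> \oo] --> (0 * 0 : R) by exact: cvgM.
  rewrite mulr0 in H2; apply: cvg_trans H2; apply: near_eq_cvg.
  by apply: nearW => n /=; rewrite -expr2 sqr_sqrtr ?inner_ge0.
apply: cvg_EFin; first exact: nearW.
rewrite -[X in _ --> X]sqrtr0; apply: continuous_cvg => //.
exact: sqrt_continuous.
Qed.

Lemma inner_cvg (u : nat -> T -> R) v w : (forall n, u n \in L2) -> v \in L2 -> w \in L2 ->
  L2norm mu (fun x => u n x - v x) @[n --> \oo] --> 0%E ->
  inner mu (u n) w @[n --> \oo] --> inner mu v w.
Proof.
move=> Lu Lv Lw H.
have H1 : Num.sqrt (inner mu (fun x => u n x - v x) (fun x => u n x - v x)) @[n --> \oo] --> 0.
  suff H' : (Num.sqrt (inner mu (fun x => u n x - v x) (fun x => u n x - v x)))%:E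
    @[n --> \oo] --> 0%E by apply: cvg_EFinP; exact: H'.
  apply: cvg_trans H; apply: near_eq_cvg; apply: nearW => n /=.
  by rewrite L2normE//; exact: L2B.
apply/subr_cvg0; apply/norm_cvg0P.
have H2 : Num.sqrt (inner mu (fun x => u n x - v x) (fun x => u n x - v x)) *
    Num.sqrt (inner mu w w) @[n --> \oo] --> 0 * Num.sqrt (inner mu w w).
  by apply: cvgM => //; exact: cvg_cst.
rewrite mul0r in H2; apply: (squeeze_cvgr _ (cvg_cst 0) H2).
apply: nearW => n; rewrite normr_ge0/= -innerBl//.
by apply: Cauchy_Schwarz_L2 => //; exact: L2B.
Qed.

Section orthonormal.
Variable phi : nat -> T -> R.
Hypothesis Lphi : forall n, phi n \in L2.
Hypothesis phi_orth : forall m n, inner mu (phi m) (phi n) = (m == n)%:R.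
Implicit Types (c : nat -> R) (N : nat).

Let S c N := fun x => \sum_(n < N) c n * phi n x.

Let LS c N : S c N \in L2. Proof. exact: L2_sum. Qed.

Lemma inner_partial_sum c N m :
  inner mu (S c N) (phi m) = if (m < N)%N then c m else 0.
Proof.
rewrite inner_suml//; under eq_bigr do rewrite phi_orth.
case: ifPn => mN.
  rewrite (bigD1 (Ordinal mN))//= eqxx mulr1 big1 ?addr0// => j jm.
  by rewrite (_ : (j == m :> nat) = false) ?mulr0//; apply/negbTE; apply: contra jm.
rewrite big1// => j _; rewrite (_ : (j == m :> nat) = false) ?mulr0//.
by apply/negbTE; apply: contraNN mN => /eqP <-.
Qed.

Lemma inner_partial_sums c c' N :
  inner mu (S c N) (S c' N) = \sum_(n < N) c n * c' n.
Proof.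
rewrite inner_suml//; apply: eq_bigr => n _.
by rewrite innerC inner_partial_sum ltn_ord.
Qed.

Lemma Bessel_L2 w N : w \in L2 ->
  \sum_(n < N) inner mu w (phi n) ^+ 2 <= inner mu w w.
Proof.
move=> Lw; pose c n := inner mu w (phi n).
have := inner_ge0 (fun x => w x - S c N x).
rewrite innerBl ?(L2B Lw (LS _ _))// !(innerC _ (fun x => w x - S c N x)) !innerBl//.
rewrite inner_partial_sums (innerC w) inner_suml//.
have -> : \sum_(n < N) c n * inner mu (phi n) w = \sum_(n < N) c n * c n.
  by apply: eq_bigr => n _; rewrite innerC.
rewrite subrr subr0 subr_ge0.
by under eq_bigr do rewrite -expr2.
Qed.

Lemma L2sum_coef c w m : is_L2sum mu phi c w -> inner mu w (phi m) = c m.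
Proof.
move=> [Lw H].
have H1 : L2norm mu (fun x => S c n x - w x) @[n --> \oo] --> 0%E.
  apply: cvg_trans H; apply: near_eq_cvg; apply: nearW => n /=.
  rewrite !L2norm_sqrt; congr sqrte; apply: eq_integral => x _.
  by rewrite -sqrrN opprB.
have /cvg_lim <-// := inner_cvg (LS c) Lw (Lphi m) H1.
apply: cvg_lim => //; apply: cvg_near_cst.
by exists m.+1 => // n /= mn; rewrite inner_partial_sum mn.
Qed.

Lemma L2sum_norm_le c w K : 0 <= K -> is_L2sum mu phi c w ->
  (forall N, \sum_(n < N) c n ^+ 2 <= K ^+ 2) -> (L2norm mu w <= K%:E)%E.
Proof.
move=> K0 [Lw H] cK; rewrite L2normE// lee_fin.
have H1 : inner mu (fun x => w x - S c n x) (fun x => w x - S c n x) @[n --> \oo] --> 0.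
  by apply/L2norm_cvg0P => // n; exact: L2B.
have H2 : Num.sqrt (inner mu (fun x => w x - S c n x) (fun x => w x - S c n x)) + K @[n --> \oo] --> Num.sqrt 0 + K.
  apply: cvgD; last exact: cvg_cst.
  by apply: continuous_cvg => //; exact: sqrt_continuous.
rewrite sqrtr0 add0r in H2; apply: (cvgr_to_ge H2); apply: nearW => n.
have := L2_triangle (L2B Lw (LS c n)) (LS c n).
rewrite (_ : (fun x => w x - S c n x + S c n x) = w); last first.
  by apply/funext => x; rewrite subrK.
move=> /le_trans; apply; rewrite lerD2l inner_partial_sums.
under eq_bigr do rewrite -expr2.
by rewrite -[leRHS](ger0_norm K0) -sqrtr_sqr ler_wsqrtr.
Qed.

Lemma L2norm_partial_diff c N M : (N <= M)%N ->
  inner mu (fun x => S c M x - S c N x) (fun x => S c M x - S c N x) =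
  \sum_(N <= n < M) c n ^+ 2.
Proof.
move=> NM; pose c' n := if (n < N)%N then 0 else c n.
have -> : (fun x => S c M x - S c N x) = S c' M.
  apply/funext => x; rewrite /S -!(big_mkord xpredT (fun n => _ n * phi n x)).
  rewrite (big_cat_nat (leq0n N) NM)//= [in RHS](big_cat_nat (leq0n N) NM)//= addrAC subrr add0r.
  have z : \sum_(0 <= i < N) c' i * phi i x = 0.
    by rewrite big_nat big1// => n /andP[_ nN]; rewrite /c' nN mul0r.
  rewrite z add0r.
  by apply: eq_big_nat => n /andP[Nn _]; rewrite /c' ltnNge Nn.
rewrite inner_partial_sums -(big_mkord xpredT (fun n => c' n * c' n)) (big_cat_nat (leq0n N) NM)//=.
have z : \sum_(0 <= i < N) c' i * c' i = 0.
  by rewrite big_nat big1// => n /andP[_ nN]; rewrite /c' nN mul0r.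
rewrite z add0r.
by apply: eq_big_nat => n /andP[Nn _]; rewrite /c' ltnNge Nn.
Qed.

Lemma nneseries_le_partial (u : nat -> R) K : (forall k, 0 <= u k) ->
  (forall N, \sum_(k < N) u k <= K) -> (\sum_(0 <= k <oo) (u k)%:E <= K%:E)%E.
Proof.
move=> u0 uK; apply: lime_le.
  by apply: is_cvg_nneseries => n _ _; rewrite lee_fin.
by apply: nearW => n; rewrite sumEFin lee_fin big_mkord.
Qed.

(* Along a subsequence with tails at most 8^-k, the series of 4^k |increment|^2 is integrable, so the partial sums converge a.e. along it. *)
Lemma Riesz_Fischer c K : (forall N, \sum_(n < N) c n ^+ 2 <= K) ->
  exists w, is_L2sum mu phi c w.
Proof.
move=> cK; pose s N := \sum_(n < N) c n ^+ 2.
have nds : nondecreasing_seq s.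
  apply/nondecreasing_seqP => n; rewrite /s big_ord_recr/= lerDl sqr_ge0//.
have cvgs : cvgn s.
  by apply: nondecreasing_is_cvgn => //; exists K => _ [n _ <-]; exact: cK.
pose tail N := limn s - s N.
have tail_ge0 N : 0 <= tail N.
  by rewrite subr_ge0; exact: nondecreasing_cvgn_le.
have tail_anti N M : (N <= M)%N -> tail M <= tail N.
  by move=> NM; rewrite lerD2l lerN2; exact: nds.
have tail0 : tail N @[N --> \oo] --> 0.
  rewrite -[X in _ --> X](subrr (limn s)); apply: cvgB => //; exact: cvg_cst.
have tail_diff N M : (N <= M)%N ->
    inner mu (fun x => S c M x - S c N x) (fun x => S c M x - S c N x) <= tail N.
  move=> NM; rewrite L2norm_partial_diff//.
  have -> : \sum_(N <= n < M) c n ^+ 2 = s M - s N.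
    rewrite /s -!(big_mkord xpredT (fun n => c n ^+ 2)).
    by rewrite (big_cat_nat (leq0n N) NM)//= addrAC subrr add0r.
  by rewrite lerD2r; exact: nondecreasing_cvgn_le.
have ex k : {N : nat | (k <= N)%N /\ tail N <= 8^-1 ^+ k}.
  apply: cid; have e0 : 0 < 8^-1 ^+ k :> R by rewrite exprn_gt0.
  have /cvgrPdist_le /(_ _ e0) [N _ HN] := tail0.
  exists (maxn k N); split; first exact: leq_maxl.
  by have := HN (maxn k N) (leq_maxr _ _); rewrite /= sub0r normrN ger0_norm.
(* The running maximum makes the subsequence monotone; tails decrease, so the bound 8^-k
   survives. *)
pose M k := \max_(j < k.+1) sval (ex j).
have ndM k : (M k <= M k.+1)%N.
  by rewrite /M [X in (_ <= X)%N]big_ord_recr/= leq_maxl.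
have tailM k : tail (M k) <= 8^-1 ^+ k.
  apply: (le_trans _ (svalP (ex k)).2); apply: tail_anti.
  exact: (leq_bigmax (Ordinal (ltnSn k))).
have kM k : (k <= M k)%N.
  apply: (leq_trans (svalP (ex k)).1).
  exact: (leq_bigmax (Ordinal (ltnSn k))).
pose D k x := S c (M k.+1) x - S c (M k) x.
have LD k : D k \in L2 by apply: L2B; exact: LS.
have mD k : measurable_fun setT (D k) by exact: L2_measurable.
pose G x : \bar R := (\sum_(0 <= k <oo) (4 ^+ k * D k x ^+ 2)%:E)%E.
have G0 k x : (0 <= (4 ^+ k * D k x ^+ 2)%:E)%E.
  by rewrite lee_fin mulr_ge0 ?sqr_ge0// exprn_ge0.
have mDk k : measurable_fun setT (fun x => (4 ^+ k * D k x ^+ 2)%:E).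
  by apply/measurable_EFinP; apply: measurable_funM => //; exact: measurable_funX.
have mG : measurable_fun setT G.
  by apply: ge0_emeasurable_sum => // k x _ _; exact: G0.
have intG : (\int[mu]_x G x < +oo)%E.
  rewrite integral_nneseries//.
  apply: (@le_lt_trans _ _ (\sum_(0 <= k <oo) ((2^-1 : R) ^+ k)%:E)%E).
    apply: lee_nneseries => [k _ _|k _]; first exact: integral_ge0.
    under eq_integral do rewrite EFinM.
    rewrite ge0_integralZl//; last 2 first.
    - by apply/measurable_EFinP; exact: measurable_funX.
    - by move=> x _; rewrite lee_fin sqr_ge0.
    rewrite integral_sqr// -EFinM lee_fin.
    have -> : 2^-1 = 4 * 8^-1 :> R by lra.
    rewrite exprMn ler_pM2l ?exprn_gt0//.
    exact: le_trans (tail_diff _ _ (ndM k)) (tailM k).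
  apply: (@le_lt_trans _ _ 2%:E); last by rewrite ltry.
  apply: nneseries_le_partial => // N.
  suff : \sum_(k < N) 2^-1 ^+ k + 2 * 2^-1 ^+ N = 2 :> R.
    by move=> eq2; rewrite -[leRHS]eq2 lerDl mulr_ge0 ?exprn_ge0.
  elim: N => [|N IH]; first by rewrite big_ord0 expr0 add0r mulr1.
  by rewrite big_ord_recr/= -[RHS]IH exprS; lra.
pose E := [set x | (G x < +oo)%E].
have mE : measurable E.
  by rewrite -[X in measurable X]setTI; exact: emeasurable_fun_infty_o.
have Gge0 x : (0 <= G x)%E by apply: nneseries_ge0 => k _ _; exact: G0.
have muE : mu (~` E) = 0%E.
  have iG : mu.-integrable setT G.
    apply/integrableP; split => //.
    by under eq_integral do rewrite gee0_abs//.
  have := integrable_ae measurableT iG.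
  move=> /negligibleP H; apply: measure_negligible; first exact: measurableC.
  move: (integrable_ae measurableT iG) => [A [mA A0 AE]].
  exists A; split => // x Ex; apply: AE => /= /(_ I) Gfin; apply: Ex.
  by rewrite /E /= ltey_eq Gfin.
have cvgE x : E x -> cvgn (fun k => S c (M k) x).
  move=> Ex; have Gfin : G x \is a fin_num by rewrite ge0_fin_numE.
  have Dle k : `|D k x| <= geometric (Num.sqrt (fine (G x))) 2^-1 k.
    rewrite /geometric/= -[leRHS]ger0_norm ?mulr_ge0 ?sqrtr_ge0 ?exprn_ge0//.
    rewrite -ler_sqr ?nnegrE// !real_normK ?num_real// exprMn sqr_sqrtr; last first.
      by rewrite fine_ge0.
    rewrite -exprM mulnC exprM.
    have -> : 2^-1 ^+ 2 = 4^-1 :> R by lra.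
    rewrite exprVn ler_pdivlMr ?exprn_gt0// mulrC -lee_fin fineK//.
    have := @nneseries_lim_ge R (fun k => (4 ^+ k * D k x ^+ 2)%:E) xpredT 0 k.+1.
    move=> /(_ (fun n _ _ => G0 n x)); rewrite big_nat_recr//=.
    by apply: le_trans; rewrite leeDr// sume_ge0.
  have H : cvgn (series (D ^~ x)).
    apply: (dominated_series_cvg Dle); apply: is_cvg_geometric_series.
    by rewrite ger0_norm// invf_lt1// ltr1n.
  have -> : (fun k => S c (M k) x) = (fun k => S c (M 0) x + series (D ^~ x) k).
    apply/funext => k; rewrite /series/= telescope_sumr// addrC subrK//.
  by apply: is_cvgD => //; exact: is_cvg_cst.
(* Cutting off outside the conull set [E] makes the sequence converge everywhere, so the pointwise
   limit is measurable. *)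
pose f k x := S c (M k) x * \1_E x.
have fE k x : E x -> f k x = S c (M k) x by move=> Ex; rewrite /f indicE mem_set// mulr1.
have cvgf x : cvgn (f ^~ x).
  have [Ex|Ex] := pselect (E x).
    have -> : f ^~ x = (fun k => S c (M k) x) by apply/funext => k; rewrite fE.
    exact: cvgE.
  have -> : f ^~ x = (fun=> 0) by apply/funext => k; rewrite /f indicE memNset// mulr0.
  exact: is_cvg_cst.
have mf k : measurable_fun setT (f k).
  by apply: measurable_funM; [exact/L2_measurable/LS|exact: measurable_indic].
pose w x := limn (f ^~ x).
have mw : measurable_fun setT w.
  by apply: (measurable_fun_cvg mf) => x _; exact: cvgf.
(* Fatou's lemma along the subsequence carries the tail bound over to [w]. As [N] is arbitrary, the
   full sequence of partial sums converges in L^2, not only the subsequence. *)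
have key N : (\int[mu]_x ((w x - S c N x) ^+ 2)%:E <= (tail N)%:E)%E.
  pose h k x := ((f (k + N)%N x - S c N x) ^+ 2)%:E.
  have mh k : measurable_fun setT (h k).
    apply/measurable_EFinP; apply: measurable_funX; apply: measurable_funB => //.
    exact/L2_measurable/LS.
  have -> : (\int[mu]_x ((w x - S c N x) ^+ 2)%:E = \int[mu]_x limn_einf (h^~ x))%E.
    apply: eq_integral => x _.
    have H : h^~ x @ \oo --> ((w x - S c N x) ^+ 2)%:E.
      apply: cvg_EFin; first exact: nearW.
      have H1 : f (k + N)%N x - S c N x @[k --> \oo] --> w x - S c N x.
        apply: cvgB; last exact: cvg_cst.
        by rewrite (cvg_shiftn N (f ^~ x)); exact: cvgf.
      have H2 : (f (k + N)%N x - S c N x) * (f (k + N)%N x - S c N x) @[k --> \oo] -->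
         (w x - S c N x) * (w x - S c N x) by exact: cvgM.
      by rewrite expr2; apply: cvg_trans H2; apply: near_eq_cvg; apply: nearW => k /=; rewrite expr2.
    by rewrite (cvg_limn_einf_sup H).1.
  apply: (le_trans (fatou mu measurableT mh _)).
    by move=> k x _; rewrite lee_fin sqr_ge0.
  have hk k : (\int[mu]_x h k x <= (tail N)%:E)%E.
    rewrite (@ae_eq_integral _ _ _ mu setT (fun x => ((S c (M (k + N)) x - S c N x) ^+ 2)%:E))//.
    - rewrite integral_sqr; last exact: L2B.
      rewrite lee_fin; apply: tail_diff.
      by rewrite (leq_trans _ (kM _))// leq_addl.
    - apply/measurable_EFinP; apply: measurable_funX.
      by apply: measurable_funB; exact/L2_measurable/LS.
    - exists (~` E); split => //; first exact: measurableC.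
      move=> x /= H Ex; apply: H => _; by rewrite /h fE.
  rewrite limn_einf_lim; apply: lime_le; first exact: is_cvg_einfs.
  apply: nearW => k; apply: le_trans (hk k); rewrite /einfs/=.
  by apply: ereal_inf_lbound; exists k => //=.
have Lw : w \in L2.
  have H : (fun x => w x - S c 0 x) \in L2.
    apply: L2P.
      by apply: measurable_funB => //; exact/L2_measurable/LS.
    by apply: le_lt_trans (key 0%N) _; rewrite ltry.
  have := L2D H (LS c 0%N).
  by under eq_fun do rewrite subrK.
exists w; split => //; apply/L2norm_cvg0P => [n|]; first exact/L2B/LS.
apply: (squeeze_cvgr _ (cvg_cst 0) tail0); apply: nearW => N.
rewrite inner_ge0/=; have := key N.
by rewrite integral_sqr ?lee_fin//; exact/L2B/LS.
Qed.

End orthonormal.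

End L2_space.

(** * Bochner-measurable sources *)

Section integral_nonmeasurable.
Context {d : measure_display} {T : measurableType d} {R : realType}.
Variable mu : {measure set T -> \bar R}.
Local Open Scope ereal_scope.
Import HBNNSimple.

(** Multiplying a simple function below [P] by the indicator of the complement of [N] keeps its
    integral and puts it below [Q]: off [N] the two agree, and on [N] it becomes 0. *)
Let le_nnintegral_off_null (P Q : T -> \bar R) (N : set T) :
  measurable N -> mu N = 0 -> (forall x, 0 <= Q x) ->
  (forall x, ~ N x -> P x = Q x) ->
  ereal_sup [set sintegral mu h | h in [set h : {nnsfun T >-> R} | forall x, (h x)%:E <= P x]] <=
  ereal_sup [set sintegral mu h | h in [set h : {nnsfun T >-> R} | forall x, (h x)%:E <= Q x]].
Proof.
move=> mN N0 Q0 PQ; apply: ge_ereal_sup => _ [h hP <-].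
have mNC := measurableC mN.
apply: ereal_sup_ubound; exists (proj_nnsfun h mNC) => /=.
  move=> x; rewrite mindicE; have [|] := boolP (x \in ~` N).
    by rewrite inE mulr1 => Nx; rewrite -PQ.
  by rewrite mulr0.
rewrite -!integralT_nnsfun; apply: ae_eq_integral => //.
- by apply/measurable_EFinP.
- by apply/measurable_EFinP.
exists N; split => // x /= H; apply: contrapT => Nx; apply: H => _.
by rewrite mindicE mem_set// mulr1.
Qed.

(* The integral of a non-negative function is a supremum of integrals of simple functions, so null sets can be dropped without assuming F measurable. *)
Lemma integral_conull (D B : set T) (F : T -> \bar R) :
  measurable D -> measurable B -> B `<=` D -> mu (D `\` B) = 0 ->
  \int[mu]_(x in D) F x = \int[mu]_(x in B) F x.
Proof.
move=> mD mB BD DB; have mN := measurableD mD mB.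
have E x : ~ (D `\` B) x -> (F \_ D) x = (F \_ B) x.
  rewrite /= /patch => H; case: ifPn => [/set_mem Dx|Dx].
    by rewrite mem_set//; apply: contrapT => nB; exact: H.
  by rewrite memNset// => /BD /mem_set; rewrite (negbTE Dx).
rewrite /integral/=; congr (_ - _); apply/eqP; rewrite eq_le; apply/andP; split.
- by apply: (le_nnintegral_off_null mN DB) => // x Nx; rewrite !funeposE E.
- by apply: (le_nnintegral_off_null mN DB) => // x Nx; rewrite !funeposE E.
- by apply: (le_nnintegral_off_null mN DB) => // x Nx; rewrite !funenegE E.
- by apply: (le_nnintegral_off_null mN DB) => // x Nx; rewrite !funenegE E.
Qed.

Lemma Rintegral_conull (D B : set T) (F : T -> R) :
  measurable D -> measurable B -> B `<=` D -> mu (D `\` B) = 0 ->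
  (\int[mu]_(x in D) F x = \int[mu]_(x in B) F x)%R.
Proof. by move=> mD mB BD DB; rewrite /Rintegral (integral_conull _ mD mB). Qed.

End integral_nonmeasurable.

Section conull_sets.
Context {R : realType}.
Implicit Types (tau : R) (B : set R).

(** A concrete measurable set, unlike an almost-everywhere statement, can serve as domain of
    integration on which the coefficients of the source are measurable and bounded at every
    point. *)
Definition conull tau B :=
  [/\ measurable (B : set (measurableTypeR R)), B `<=` `]0, tau[ &
      @lebesgue_measure R (`]0, tau[ `\` B) = 0%E].

Lemma conullI tau B B' : conull tau B -> conull tau B' -> conull tau (B `&` B').
Proof.
move=> [mB BI B0] [mB' BI' B0']; split; first exact: measurableI.
  by move=> x [/BI].
by rewrite setDIr; apply: null_set_setU => //; exact: measurableD.
Qed.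

Lemma ae_conull tau (P : R -> Prop) :
  (\forall t \ae lebesgue_itv tau, P t) -> exists B, conull tau B /\ forall t, B t -> P t.
Proof.
move=> [A [mA A0 PA]]; exists (`]0, tau[ `\` A); split; last first.
  by move=> t [_ nA]; apply: contrapT => Pt; exact/nA/PA.
split; [exact: measurableD|by move=> x []|].
rewrite setDD -[RHS]A0 /lebesgue_itv /mrestr setIC//.
Qed.

End conull_sets.

Section Bochner_coefficients.
Context {d : measure_display} {T : measurableType d} {R : realType}.
Variable mu : {measure set T -> \bar R}.
Variable tau : R.
Hypothesis tau0 : 0 < tau.
Local Notation L2 := (Lfun mu 2%:E).

Lemma L2simple_inner_measurable (s : R -> T -> R) v : L2simple mu s -> v \in L2 ->
  (forall t, s t \in L2) /\
  measurable_fun setT (fun t : measurableTypeR R => inner mu (s t) v).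
Proof.
move=> [m [A [w [mA Lw sE]]]] Lv.
(* Both finite families are extended by zero to all naturals, to fit the finite-sum lemmas stated
   for sequences. *)
pose w' j := if insub j is Some i then w i else fun=> 0.
pose c t j := if insub j is Some i then \1_(A i) t : R else 0.
have Lw' n : w' n \in L2.
  by rewrite /w'; case: insubP => // *; exact: L2_0.
have sE' t : s t = (fun x => \sum_(j < m) c t j * w' j x).
  apply/funext => x; rewrite sE; apply: eq_bigr => j _.
  by rewrite /c /w' valK.
split=> [t|]; first by rewrite sE'; exact: L2_sum.
rewrite (_ : (fun t => _) = (fun t => \sum_(j < m) c t j * inner mu (w' j) v)); last first.
  by apply/funext => t; rewrite sE' inner_suml.
apply: measurable_sum => j; apply: measurable_funM => //.
by rewrite /c valK; apply: measurable_indic; exact: mA.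
Qed.

Lemma Linf_L2norm_conull (F : R -> T -> R) :
  exists B, conull tau B /\ forall t, B t -> (L2norm mu (F t) <= Linf_L2norm mu tau F)%E.
Proof.
apply: ae_conull; rewrite /Linf_L2norm unlock.
(* The norm of infinite exponent is an essential supremum only on a space of positive measure, which
   [tau0] ensures. *)
rewrite ifT; last first.
  rewrite /lebesgue_itv/= /mrestr setTI lebesgue_measure_itv/= lte_fin tau0.
  by rewrite sube0 lte_fin.
apply: filterS (ess_sup_inf.ess_sup_ge (lebesgue_itv tau)
  (abse \o (fun t => L2norm mu (F t)))) => t /=.
by rewrite gee0_abs// Lnorm_ge0.
Qed.

(** Strong measurability implies weak measurability. One [B] serves every [v]: it is where the
    simple functions converge in norm, and norm convergence passes to all inner products. *)
Lemma strongly_measurable_conull (f : R -> T -> R) :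
  (forall t, 0 < t < tau -> f t \in L2) -> strongly_measurable mu tau f ->
  exists B, conull tau B /\ forall v, v \in L2 ->
    measurable_fun (B : set (measurableTypeR R)) (fun t => inner mu (f t) v).
Proof.
move=> Lf [s [ss]] /ae_conull[B [cB sB]]; exists B; split => // v Lv.
apply: (@measurable_fun_cvg _ _ _ _ (fun k t => inner mu (s k t) v)) => [k|t Bt].
  by apply: measurable_funTS; exact: (L2simple_inner_measurable (ss k) Lv).2.
have Ls k : s k t \in L2 by exact: (L2simple_inner_measurable (ss k) Lv).1.
have It : 0 < t < tau by have [_ BI _] := cB; have := BI _ Bt; rewrite /= in_itv.
exact: inner_cvg Ls (Lf _ It) Lv (sB _ Bt).
Qed.

End Bochner_coefficients.

(** * Convolution with the Mittag-Leffler kernel *)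

Section weighted_Cauchy_Schwarz.
Context {d : measure_display} {T : measurableType d} {R : realType}.
Variables (mu : {measure set T -> \bar R}) (D : set T).
Hypothesis mD : measurable D.
Implicit Types (k c : T -> R) (M A : R).

Lemma integrable_mul_bounded k c M :
  mu.-integrable D (EFin \o k) -> measurable_fun D c ->
  (forall s, D s -> `|c s| <= M) ->
  mu.-integrable D (EFin \o (fun s => k s * c s)).
Proof.
move=> ik mc cM; apply: (@le_integrable _ _ _ mu D mD _ (fun s => (M%:E * (k s)%:E)%E)) => //.
- apply/measurable_EFinP; apply: measurable_funM => //.
  by apply/measurable_EFinP; have /integrableP[] := ik.
- move=> s Ds; rewrite -EFinM !abse_EFin lee_fin !normrM mulrC ler_wpM2r//.
  by rewrite (le_trans (cM _ Ds))// ler_norm.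
- exact: integrableZl.
Qed.

(** Expand the non-negative integral of k (A c - x)^2, where x is the integral of k c: replacing the
    mass of k by its bound [A] leaves A^2 times the last integral minus A x^2, and A is cancelled.
    No root of the weight is needed. *)
Lemma weighted_Cauchy_Schwarz k c M A :
  mu.-integrable D (EFin \o k) -> measurable_fun D c ->
  (forall s, D s -> 0 <= k s) -> (forall s, D s -> `|c s| <= M) ->
  0 < A -> \int[mu]_(s in D) k s <= A ->
  (\int[mu]_(s in D) (k s * c s)) ^+ 2 <= A * \int[mu]_(s in D) (k s * c s ^+ 2).
Proof.
move=> ik mc k0 cM A0 kA.
have ikc := integrable_mul_bounded ik mc cM.
have ikc2 : mu.-integrable D (EFin \o (fun s => k s * c s ^+ 2)).
  apply: (@integrable_mul_bounded _ _ (M ^+ 2)) => //; first exact: measurable_funX.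
  by move=> s Ds; rewrite normrX lerXn2r ?nnegrE// ?(le_trans _ (cM _ Ds))// cM.
move xE : (\int[mu]_(s in D) (k s * c s)) => x.
have : 0 <= \int[mu]_(s in D) (k s * (A * c s - x) ^+ 2).
  by apply: Rintegral_ge0 => s Ds; rewrite mulr_ge0 ?sqr_ge0// k0.
rewrite (_ : \int[mu]_(s in D) _ = A ^+ 2 * \int[mu]_(s in D) (k s * c s ^+ 2)
   + ((- (2 * A * x)) * \int[mu]_(s in D) (k s * c s) + x ^+ 2 * \int[mu]_(s in D) k s)); last first.
  have iZ g r : mu.-integrable D (EFin \o g) -> mu.-integrable D (EFin \o (fun s => r * g s)).
    by move=> ig; apply: (@eq_integrable _ _ _ mu _ _ (fun t => (r%:E * (g t)%:E)%E)) => //; exact: integrableZl.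
  rewrite -(RintegralZl (A ^+ 2) mD ikc2) -(RintegralZl (- (2 * A * x)) mD ikc) -(RintegralZl (x ^+ 2) mD ik).
  have iD g1 g2 : mu.-integrable D (EFin \o g1) -> mu.-integrable D (EFin \o g2) ->
      mu.-integrable D (EFin \o (fun s => g1 s + g2 s)).
    by move=> i1 i2; apply: (@eq_integrable _ _ _ mu _ _ (fun t => ((g1 t)%:E + (g2 t)%:E)%E)) => //; exact: integrableD.
  have i1 := iZ _ (- (2 * A * x)) ikc; have i2 := iZ _ (x ^+ 2) ik.
  rewrite -(RintegralD mD i1 i2) -(RintegralD mD (iZ _ (A ^+ 2) ikc2) (iD _ _ i1 i2)).
  by apply: eq_Rintegral => s _; ring.
rewrite xE; move: (\int[mu]_(s in D) k s) (\int[mu]_(s in D) (k s * c s ^+ 2)) kA => K I KA H.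
rewrite -subr_ge0 -(pmulr_rge0 _ A0).
have : x ^+ 2 * K <= x ^+ 2 * A by rewrite ler_wpM2l// sqr_ge0.
nra.
Qed.

End weighted_Cauchy_Schwarz.

Section ml_convolution.
Context {R : realType}.
Variables (a tau : R) (B : set (measurableTypeR R)).
Hypotheses (a0 : 0 < a) (a1 : a < 1) (tau0 : 0 < tau) (cB : conull tau B).
Hypothesis ml_ge0 : forall x, x <= 0 -> 0 <= mittag_leffler a 1 x.
Local Notation mu := (@lebesgue_measure R).
Local Notation I := (`]0%R, tau[%classic : set (measurableTypeR R)).
Implicit Types (L M : R) (c : R -> R).

Let mB : measurable B. Proof. by have [] := cB. Qed.

Let BI : B `<=` I. Proof. by have [] := cB. Qed.

Let mI : measurable I. Proof. exact: measurable_itv. Qed.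

Let integrable_conull (k : R -> R) r : measurable_fun I k ->
  (forall s, I s -> 0 <= k s) -> (\int[mu]_(s in I) (k s)%:E = r%:E)%E ->
  mu.-integrable B (EFin \o k) /\ \int[mu]_(s in B) k s = r.
Proof.
move=> mk k0 kr; split.
  apply: (integrableS mI) => //; apply/integrableP; split.
    by apply/measurable_EFinP.
  under eq_integral => s /[!inE] Is do rewrite /= ger0_norm ?k0//.
  by rewrite kr ltry.
by have [_ _ B0] := cB; rewrite -(Rintegral_conull _ mI)// /Rintegral kr.
Qed.

(** Non-negativity of E_{a,1} enters here: the exact integral is 1 / L minus a multiple of it. *)
Lemma ml_kernel_integrable L : 0 < L ->
  mu.-integrable B (EFin \o ml_kernel a tau L) /\
  \int[mu]_(s in B) ml_kernel a tau L s <= L^-1.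
Proof.
move=> L0; have [] := @integrable_conull (ml_kernel a tau L)
    (L^-1 * (1 - mittag_leffler a 1 (- (L * tau `^ a)))).
- have oI : open (`]0%R, tau[%classic : set R) by exact: interval_open.
  apply: (@open_continuous_measurable_fun R _ _ oI) => s.
  by rewrite inE/= in_itv/=; exact: continuous_ml_kernel.
- by move=> s _; have /andP[] := ml_kernel_bounds tau a0 a1 L0 s.
- exact: integral_ml_kernel.
move=> ik ->; split => //; rewrite ler_piMr ?invr_ge0 ?(ltW L0)//.
by rewrite gerBl ml_ge0// oppr_le0 mulr_ge0 ?powR_ge0 ?(ltW L0).
Qed.

Lemma powR_sub_integrable :
  mu.-integrable B (EFin \o (fun s => (tau - s) `^ (a - 1))) /\
  \int[mu]_(s in B) (tau - s) `^ (a - 1) = tau `^ a / a.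
Proof.
apply: integrable_conull.
- apply: (@measurableT_comp _ _ _ _ _ _ (fun x => x `^ (a - 1))) => //.
  exact: measurable_funB.
- by move=> s _; exact: powR_ge0.
- exact: integral_powR_sub.
Qed.

Lemma ml_convolution_le L M c : 0 < L -> measurable_fun B c ->
  (forall s, B s -> `|c s| <= M) ->
  (\int[mu]_(s in B) (ml_kernel a tau L s * c s)) ^+ 2 <= (M / L) ^+ 2.
Proof.
move=> L0 mc cM; have [ik kL] := ml_kernel_integrable L0.
have k0 s : 0 <= ml_kernel a tau L s by have /andP[] := ml_kernel_bounds tau a0 a1 L0 s.
apply: (le_trans (weighted_Cauchy_Schwarz mB ik mc (fun s _ => k0 s) cM _ kL)).
  by rewrite invr_gt0.
have cM2 s : B s -> `|c s ^+ 2| <= M ^+ 2.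
  by move=> Bs; rewrite normrX lerXn2r ?nnegrE// ?(le_trans _ (cM _ Bs))// cM.
rewrite expr_div_n -exprVn mulrC [in leRHS]expr2 mulrA ler_wpM2r ?invr_ge0 ?(ltW L0)//.
apply: (@le_trans _ _ (\int[mu]_(s in B) (M ^+ 2 * ml_kernel a tau L s))).
  apply: le_Rintegral => //.
  - exact: (integrable_mul_bounded mB ik (measurable_funX 2 mc) cM2).
  - apply: (@eq_integrable _ _ _ mu _ _ (fun s => ((M ^+ 2)%:E * (ml_kernel a tau L s)%:E)%E)) => //.
    exact: integrableZl.
  - move=> s Bs; rewrite mulrC ler_wpM2r//.
    by rewrite (le_trans _ (cM2 _ Bs))// ler_norm.
by rewrite RintegralZl// ler_wpM2l// sqr_ge0.
Qed.

(** In the weighted Cauchy-Schwarz bound the mass of each kernel is at most 1 / [Lmin], and inside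
    the remaining integral every kernel is replaced by the common majorant [w]. The sum over n can
    then move under the integral, where the pointwise bound applies. *)
Lemma sum_sqr_ml_convolution_le (L : nat -> R) (c : nat -> R -> R) Lmin M N :
  0 < Lmin -> (forall n, Lmin <= L n) -> (forall n, measurable_fun B (c n)) ->
  (forall n s, B s -> `|c n s| <= M) ->
  (forall s, B s -> \sum_(n < N) c n s ^+ 2 <= M ^+ 2) ->
  \sum_(n < N) (\int[mu]_(s in B) (ml_kernel a tau (L n) s * c n s)) ^+ 2 <=
  Lmin^-1 * M ^+ 2 * (Gamma a)^-1 * (tau `^ a / a).
Proof.
move=> Lmin0 LL mc cM cS.
have L0 n : 0 < L n by exact: lt_le_trans (LL n).
have [iw <-] := powR_sub_integrable; pose w s := (Gamma a)^-1 * (tau - s) `^ (a - 1).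
have iW : mu.-integrable B (EFin \o w).
  apply: (@eq_integrable _ _ _ mu _ _ (fun s => (((Gamma a)^-1)%:E * ((tau - s) `^ (a - 1))%:E)%E)) => //.
  exact: integrableZl.
have w0 s : 0 <= w s by rewrite mulr_ge0 ?powR_ge0// invr_ge0 (ltW (Gamma_gt0 a0)).
have cM2 n s : B s -> `|c n s ^+ 2| <= M ^+ 2.
  by move=> Bs; rewrite normrX lerXn2r ?nnegrE// ?(le_trans _ (cM n _ Bs))// cM.
have iwc n : mu.-integrable B (EFin \o (fun s => w s * c n s ^+ 2)).
  exact: (integrable_mul_bounded mB iW (measurable_funX 2 (mc n)) (cM2 n)).
have step n : (\int[mu]_(s in B) (ml_kernel a tau (L n) s * c n s)) ^+ 2 <=
    Lmin^-1 * \int[mu]_(s in B) (w s * c n s ^+ 2).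
  have [ik kL] := ml_kernel_integrable (L0 n).
  have kB s := ml_kernel_bounds tau a0 a1 (L0 n) s.
  have k0 s : 0 <= ml_kernel a tau (L n) s by have /andP[] := kB s.
  apply: (le_trans (weighted_Cauchy_Schwarz mB ik (mc n) (fun s _ => k0 s) (cM n) _ kL)).
    by rewrite invr_gt0.
  apply: ler_pM.
  - by rewrite invr_ge0 (ltW (L0 n)).
  - by apply: Rintegral_ge0 => s _; rewrite mulr_ge0 ?sqr_ge0.
  - by rewrite lef_pV2 ?posrE.
  apply: le_Rintegral => //.
    exact: (integrable_mul_bounded mB ik (measurable_funX 2 (mc n)) (cM2 n)).
  by move=> s _; rewrite ler_wpM2r ?sqr_ge0//; have /andP[] := kB s.
apply: (le_trans (ler_sum _ (fun (n : 'I_N) _ => step n))).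
rewrite -mulr_sumr -!mulrA ler_wpM2l ?invr_ge0 ?(ltW Lmin0)//.
have [isum ->] : mu.-integrable B (EFin \o (fun s => \sum_(n < N) w s * c n s ^+ 2)) /\
    \sum_(n < N) \int[mu]_(s in B) (w s * c n s ^+ 2) =
    \int[mu]_(s in B) \sum_(n < N) w s * c n s ^+ 2.
  elim: N {cS} => [|N [iN IH]].
    rewrite big_ord0; split.
      apply: (@eq_integrable _ _ _ mu _ _ (cst 0%E)) => //; last exact: integrable0.
      by move=> s _ /=; rewrite big_ord0.
    by under eq_Rintegral do rewrite big_ord0; rewrite /Rintegral integral0.
  split.
    apply: (@eq_integrable _ _ _ mu _ _ (fun s => ((\sum_(n < N) w s * c n s ^+ 2)%:E + (w s * c N s ^+ 2)%:E)%E)) => //.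
      by move=> s _ /=; rewrite big_ord_recr.
    exact: (integrableD mB iN (iwc N)).
  rewrite big_ord_recr/= IH -RintegralD//.
  by apply: eq_Rintegral => s _; rewrite big_ord_recr.
rewrite mulrA -expr2 -RintegralZl// -/w -RintegralZl//; apply: le_Rintegral => //.
  apply: (@eq_integrable _ _ _ mu _ _ (fun s => ((M ^+ 2)%:E * (w s)%:E)%E)) => //.
  exact: integrableZl.
move=> s Bs; rewrite -mulr_sumr [leRHS]mulrC ler_wpM2l//; exact: cS.
Qed.

End ml_convolution.

Section Psi_bounds.
Context {d : measure_display} {T : measurableType d} {R : realType}.
Variable mu : {measure set T -> \bar R}.
Variables (lam : nat -> R) (phi : nat -> T -> R) (tau alpha : R).
Local Notation L2 := (Lfun mu 2%:E).
Hypothesis Lphi : forall n, phi n \in L2.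
Hypothesis phi_orth : forall m n, inner mu (phi m) (phi n) = (m == n)%:R.
Hypotheses (lam_gt0 : 0 < lam 0%N) (lam_mono : forall k, lam k <= lam k.+1).
Hypotheses (tau0 : 0 < tau) (alpha0 : 0 < alpha) (alpha1 : alpha < 1).
Hypothesis ml_ge0 : forall x, x <= 0 -> 0 <= mittag_leffler alpha 1 x.
Implicit Types (f : R -> T -> R) (h : T -> R) (B : set (measurableTypeR R)).
Local Notation Psi f n := (Psi mu lam phi alpha f n tau).

Lemma lam0_le n : lam 0%N <= lam n.
Proof. by elim: n => // n /le_trans; exact. Qed.

Lemma lam_pos n : 0 < lam n.
Proof. exact: lt_le_trans (lam0_le n). Qed.

Lemma Psi_conull B f n : conull tau B -> Psi f n =
  \int[@lebesgue_measure R]_(s in B)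
    (ml_kernel alpha tau (lam n ^+ 2) s * inner mu (f s) (phi n)).
Proof. by move=> [mB BI B0]; rewrite -(Rintegral_conull _ _ mB BI B0)//; exact: measurable_itv. Qed.

Lemma inner_phi_le w M n : w \in L2 -> (L2norm mu w <= M%:E)%E ->
  `|inner mu w (phi n)| <= M.
Proof.
move=> Lw; rewrite L2normE// lee_fin; apply: le_trans.
apply: (le_trans (Cauchy_Schwarz_L2 Lw (Lphi n))).
by rewrite phi_orth eqxx sqrtr1 mulr1.
Qed.

Lemma sum_sqr_inner_phi_le w M N : w \in L2 -> (L2norm mu w <= M%:E)%E ->
  \sum_(n < N) inner mu w (phi n) ^+ 2 <= M ^+ 2.
Proof.
move=> Lw wM; apply: (le_trans (Bessel_L2 Lphi phi_orth N Lw)).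
move: wM; rewrite L2normE// lee_fin => wM.
rewrite -[leLHS]sqr_sqrtr ?inner_ge0// lerXn2r ?nnegrE ?sqrtr_ge0//.
by apply: le_trans wM; exact: sqrtr_ge0.
Qed.

Lemma Linf_L2_conull f : Linf_L2 mu tau f -> exists B M,
  [/\ conull tau B,
      forall n, measurable_fun B (fun s => inner mu (f s) (phi n)) &
      forall s, B s -> f s \in L2 /\ (L2norm mu (f s) <= M%:E)%E].
Proof.
move=> [Lf /(strongly_measurable_conull Lf)[B [cB mB]] foo].
have [B' [cB' B'f]] := Linf_L2norm_conull mu tau0 f.
exists (B `&` B'), (fine (Linf_L2norm mu tau f)); split.
- exact: conullI.
- move=> n; apply: (@measurable_funS _ _ _ _ (B : set (measurableTypeR R))) => //.
    by have [] := cB.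
  exact: mB.
- move=> s [Bs B's]; split.
    by apply: Lf; have [_ BI _] := cB; have := BI _ Bs; rewrite /= in_itv.
  rewrite fineK ?B'f// ge0_fin_numE//.
  exact: le_trans (Lnorm_ge0 _ _ _) (B'f _ B's).
Qed.

Lemma sum_sqr_Psi_bounded f : Linf_L2 mu tau f ->
  exists K, forall N, \sum_(n < N) Psi f n ^+ 2 <= K.
Proof.
move=> /Linf_L2_conull[B [M [cB mB fB]]].
exists ((lam 0%N ^+ 2)^-1 * M ^+ 2 * (Gamma alpha)^-1 * (tau `^ alpha / alpha)) => N.
under eq_bigr do rewrite (Psi_conull _ _ cB).
apply: (sum_sqr_ml_convolution_le alpha0 alpha1 tau0 cB ml_ge0 (exprn_gt0 2 lam_gt0)
  (L := fun n => lam n ^+ 2) (c := fun n s => inner mu (f s) (phi n))) => //.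
- by move=> n; rewrite lerXn2r ?nnegrE ?(ltW (lam_pos _))// lam0_le.
- by move=> n s /fB[]; exact: inner_phi_le.
- by move=> s /fB[]; exact: sum_sqr_inner_phi_le.
Qed.

(** The right side is D^2 times a term of [theta], which is how [theta] comes to weight the source
    error in the noise condition. *)
Lemma sqr_subr_Psi_le f fd D n : Linf_L2 mu tau f -> Linf_L2 mu tau fd ->
  (Linf_L2norm mu tau (fun t => f t \- fd t)%R <= D%:E)%E ->
  (Psi f n - Psi fd n) ^+ 2 <= (D / lam n ^+ 2) ^+ 2.
Proof.
move=> /Linf_L2_conull[B1 [M1 [cB1 mB1 fB1]]] /Linf_L2_conull[B2 [M2 [cB2 mB2 fB2]]] fD.
have [B3 [cB3 B3f]] := Linf_L2norm_conull mu tau0 (fun t => f t \- fd t).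
pose B : set (measurableTypeR R) := (B1 `&` B2) `&` B3.
have cB : conull tau B by apply: conullI => //; exact: conullI.
have mB : measurable B by have [] := cB.
have m1 : measurable_fun B (fun s => inner mu (f s) (phi n)).
  apply: (@measurable_funS _ _ _ _ (B1 : set (measurableTypeR R))) => //.
  - by have [] := cB1.
  - by move=> s [[]].
have m2 : measurable_fun B (fun s => inner mu (fd s) (phi n)).
  apply: (@measurable_funS _ _ _ _ (B2 : set (measurableTypeR R))) => //.
  - by have [] := cB2.
  - by move=> s [[]].
have l2 : 0 < lam n ^+ 2 by rewrite exprn_gt0// lam_pos.
have [ik _] := ml_kernel_integrable alpha0 alpha1 tau0 cB ml_ge0 l2.
rewrite !(Psi_conull _ _ cB) -RintegralB//; last 2 first.
- by apply: (integrable_mul_bounded mB ik m1 (M := M1)) => s [[/fB1[fs fM] _] _]; exact: inner_phi_le.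
- by apply: (integrable_mul_bounded mB ik m2 (M := M2)) => s [[_ /fB2[fs fM]] _]; exact: inner_phi_le.
under eq_Rintegral do rewrite -mulrBr.
apply: (ml_convolution_le alpha0 alpha1 tau0 cB ml_ge0 (c := fun s => inner mu (f s) (phi n) - inner mu (fd s) (phi n))) => //.
  exact: measurable_funB.
move=> s [[/fB1[Ls _] /fB2[Lds _]] /B3f fs]; rewrite -innerBl//.
by apply: inner_phi_le; [exact: L2B|exact: le_trans fD].
Qed.

End Psi_bounds.

(** * The error in terms of two filter bounds *)

Section error_estimate.
Context {d : measure_display} {T : measurableType d} {R : realType}.
Variable mu : {measure set T -> \bar R}.
Variables (lam : nat -> R) (phi : nat -> T -> R) (tau alpha : R).
Local Notation L2 := (Lfun mu 2%:E).
Hypothesis phi_basis : orthonormal_basis mu phi.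
Hypotheses (lam_gt0 : 0 < lam 0%N) (lam_mono : forall k, lam k <= lam k.+1).
Hypotheses (tau0 : 0 < tau) (alpha0 : 0 < alpha) (alpha1 : alpha < 1).
Variables (C1 C2 : R).
Hypotheses (C1_gt0 : 0 < C1) (C2_gt0 : 0 < C2).
Hypothesis ml_bounds : forall x, x <= 0 ->
  C1 / Gamma (1 - alpha) * (1 / (1 - x)) <= mittag_leffler alpha 1 x
    <= C2 / Gamma (1 - alpha) * (1 / (1 - x)).
Local Notation C4 := (const4 C1 alpha (lam 0%N) tau).
Local Notation E := (eigT lam tau alpha).

Let Lphi n : phi n \in L2. Proof. by have [] := phi_basis. Qed.

Let phi_orth m n : inner mu (phi m) (phi n) = (m == n)%:R.
Proof. by have [] := phi_basis. Qed.

Let lam_pos' n : 0 < lam n. Proof. exact: lam_pos. Qed.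

Let Gamma1a : 0 < Gamma (1 - alpha). Proof. by rewrite Gamma_gt0// subr_gt0. Qed.

Lemma ml_ge0 x : x <= 0 -> 0 <= mittag_leffler alpha 1 x.
Proof.
move=> x0; have /andP[+ _] := ml_bounds x0; apply: le_trans.
rewrite mulr_ge0 ?divr_ge0// ?ltW// ?Gamma1a//.
by move: x0; lra.
Qed.

Lemma const4_gt0 : 0 < C4.
Proof.
rewrite /const4 divr_gt0// ?mulr_gt0// ?exprn_gt0//.
by rewrite ltr_pwDl// mulr_ge0 ?powR_ge0 ?sqr_ge0.
Qed.

Let eigT_arg n : - (lam n ^+ 2 * tau `^ alpha) <= 0.
Proof. by rewrite oppr_le0 mulr_ge0 ?powR_ge0 ?sqr_ge0. Qed.

(** The form of C4 comes from here: b / (1 + b t) increases with b, so its value at the square of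
    the first eigenvalue is a lower bound for all n. *)
Lemma eigT_ge n : C4 / lam n ^+ 2 <= E n.
Proof.
have /andP[+ _] := ml_bounds (eigT_arg n); apply: le_trans.
rewrite opprK mul1r /const4.
have t0 : 0 <= tau `^ alpha by exact: powR_ge0.
have l2 : lam 0%N ^+ 2 <= lam n ^+ 2.
  by rewrite lerXn2r ?nnegrE ?(ltW (lam_pos' _))//; exact: lam0_le.
have l0 : 0 < lam 0%N ^+ 2 by rewrite exprn_gt0.
move: (tau `^ alpha) (lam 0%N ^+ 2) (lam n ^+ 2) t0 l2 l0 => t a b t0 ab a0.
have b0 : 0 < b by exact: lt_le_trans ab.
have at0 : 0 < 1 + a * t by rewrite ltr_pwDl// mulr_ge0// ltW.
have bt0 : 0 < 1 + b * t by rewrite ltr_pwDl// mulr_ge0// ltW.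
rewrite invfM -!mulrA ler_pM2l// mulrCA ler_pM2l ?invr_gt0//.
by rewrite -invfM ler_pdivrMr ?mulr_gt0// ler_pdivlMl//; nra.
Qed.

Lemma eigT_gt0 n : 0 < E n.
Proof.
by apply: lt_le_trans (eigT_ge n); rewrite divr_gt0 ?const4_gt0 ?exprn_gt0.
Qed.

Lemma eigT_le n : E n <= C2 / Gamma (1 - alpha).
Proof.
have /andP[_ +] := ml_bounds (eigT_arg n); move/le_trans; apply.
rewrite ler_piMr ?divr_ge0 ?(ltW Gamma1a) ?(ltW C2_gt0)//.
rewrite mul1r opprK invf_le1 ?lerDl ?ltr_pwDl//; by rewrite mulr_ge0 ?powR_ge0 ?sqr_ge0.
Qed.

(** [L2sum] is a choice with default 0, so its defining property holds only once a sum exists;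
    Riesz-Fischer supplies it. *)
Lemma L2sumP (c : nat -> R) K : (forall N, \sum_(n < N) c n ^+ 2 <= K) ->
  is_L2sum mu phi c (L2sum mu phi c).
Proof.
move=> /(Riesz_Fischer Lphi phi_orth)[w cw].
by rewrite /L2sum; apply: (xgetPex (cst 0)); exists w.
Qed.

Lemma sum_sqr_mul_le (c e : nat -> R) K r : 0 <= r -> (forall n, `|e n| <= r) ->
  (forall N, \sum_(n < N) c n ^+ 2 <= K) ->
  forall N, \sum_(n < N) (e n * c n) ^+ 2 <= r ^+ 2 * K.
Proof.
move=> r0 er cK N; apply: (@le_trans _ _ (r ^+ 2 * \sum_(n < N) c n ^+ 2)).
  rewrite mulr_sumr; apply: ler_sum => n _; rewrite exprMn ler_wpM2r ?sqr_ge0//.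
  by rewrite -[e n ^+ 2]real_normK ?num_real// lerXn2r ?nnegrE.
by rewrite ler_wpM2l ?sqr_ge0.
Qed.

Lemma sum_sqr_subr_le (a b : nat -> R) N :
  \sum_(n < N) (a n - b n) ^+ 2 <=
  2 * (\sum_(n < N) a n ^+ 2 + \sum_(n < N) b n ^+ 2).
Proof.
rewrite -big_split/= mulr_sumr; apply: ler_sum => n _.
by have := sqr_ge0 (a n + b n); nra.
Qed.

Lemma Upsilon_coef_bounded h f : h \in L2 -> Linf_L2 mu tau f ->
  exists K, forall N, \sum_(n < N) Upsilon_coef mu lam phi tau alpha h f n ^+ 2 <= K.
Proof.
move=> Lh /(sum_sqr_Psi_bounded Lphi phi_orth lam_gt0 lam_mono tau0 alpha0 alpha1 ml_ge0)[K PK].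
exists (2 * (inner mu h h + K)) => N.
apply: (le_trans (sum_sqr_subr_le (fun n => inner mu h (phi n)) (fun n => Psi mu lam phi alpha f n tau) N)).
by rewrite ler_pM2l// lerD ?PK//; exact: Bessel_L2.
Qed.

(** Both sides must be genuine L^2 sums before coefficients can be compared: the upper bound on
    E_{a,1} ensures it for [opT], the bounded data coefficients for [Upsilon]. *)
Lemma eigT_inner g h f n : g \in L2 -> h \in L2 -> Linf_L2 mu tau f ->
  opT mu lam phi tau alpha g = Upsilon mu lam phi tau alpha h f %[ae mu] ->
  E n * inner mu g (phi n) = Upsilon_coef mu lam phi tau alpha h f n.
Proof.
move=> Lg Lh ff ae.
have [K /L2sumP Uf] := Upsilon_coef_bounded Lh ff.
have EC n' : `|E n'| <= C2 / Gamma (1 - alpha) by rewrite gtr0_norm ?eigT_gt0// eigT_le.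
have C0 : 0 <= C2 / Gamma (1 - alpha) by apply: le_trans (EC 0%N).
have Tg := @L2sumP (fun n => E n * inner mu g (phi n)) _
  (@sum_sqr_mul_le (fun n => inner mu g (phi n)) _ _ _ C0 EC
    (fun N => Bessel_L2 Lphi phi_orth N Lg)).
rewrite -(L2sum_coef Lphi phi_orth n Uf) -(L2sum_coef Lphi phi_orth n Tg).
by apply: inner_ae => //; [case: Tg|case: Uf].
Qed.

Lemma sum_sqr_Upsilon_coef_subr_le h hd f fd delta N :
  h \in L2 -> hd \in L2 -> Linf_L2 mu tau f -> Linf_L2 mu tau fd ->
  (L2norm mu (h \- hd)%R ^+ 2 +
     theta lam * Linf_L2norm mu tau (fun t => f t \- fd t)%R ^+ 2
   <= (delta ^+ 2)%:E)%E ->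
  \sum_(n < N) (Upsilon_coef mu lam phi tau alpha hd fd n -
    Upsilon_coef mu lam phi tau alpha h f n) ^+ 2 <= 2 * delta ^+ 2.
Proof.
move=> Lh Lhd ff ffd dd.
pose F := Linf_L2norm mu tau (fun t => f t \- fd t)%R.
have F0 : (0 <= F)%E by exact: Lnorm_ge0.
have thN M : ((\sum_(n < M) lam n ^- 4)%:E <= theta lam)%E.
  rewrite /theta -(big_mkord xpredT (fun n => lam n ^- 4)) -sumEFin.
  by apply: nneseries_lim_ge => n _ _; rewrite lee_fin invr_ge0 exprn_ge0// ltW.
have Ffin : F \is a fin_num.
  rewrite ge0_fin_numE// ltNge; apply/negP; rewrite leye_eq => /eqP FE.
  (* [theta] is positive by its first term, so an infinite source error would make the left side of
     the noise condition infinite. *)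
  move: dd; rewrite -/F FE [(+oo ^+ 2)%E]expe2 mulyy gt0_muley; last first.
    apply: lt_le_trans (thN 1%N); rewrite big_ord1 lte_fin invr_gt0 exprn_gt0//.
  by rewrite L2normE ?L2B// -EFin_expe addey.
have := Ffin; rewrite -/F in dd *; move=> /fineK; move: (fine F) => D DE.
have D0 : 0 <= D by rewrite -lee_fin DE.
have key : inner mu (fun x => h x - hd x) (fun x => h x - hd x) + (\sum_(n < N) lam n ^- 4) * D ^+ 2 <= delta ^+ 2.
  rewrite -lee_fin; apply: le_trans dd; rewrite EFinD; apply: leeD.
    by rewrite L2normE ?L2B// -EFin_expe sqr_sqrtr ?inner_ge0.
  by rewrite -DE -EFin_expe EFinM; apply: lee_wpmul2r; rewrite ?lee_fin ?sqr_ge0.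
apply: (@le_trans _ _ (2 * (\sum_(n < N) inner mu (fun x => h x - hd x) (phi n) ^+ 2 +
    \sum_(n < N) (Psi mu lam phi alpha f n tau - Psi mu lam phi alpha fd n tau) ^+ 2))).
  apply: le_trans (sum_sqr_subr_le (fun n => inner mu (fun x => h x - hd x) (phi n))
    (fun n => Psi mu lam phi alpha f n tau - Psi mu lam phi alpha fd n tau) N).
  rewrite le_eqVlt; apply/orP; left; apply/eqP; apply: eq_bigr => n _.
  rewrite /Upsilon_coef (innerBl Lh Lhd (Lphi n)).
  by move: (inner mu h _) (inner mu hd _) (Psi _ _ _ _ f _ _) (Psi _ _ _ _ fd _ _) => ? ? ? ?; ring.
rewrite ler_pM2l//; apply: le_trans key; apply: lerD.
  by apply: Bessel_L2 => //; exact: L2B.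
rewrite mulr_suml; apply: ler_sum => n _.
have -> : lam n ^- 4 * D ^+ 2 = (D / lam n ^+ 2) ^+ 2.
  by rewrite expr_div_n -exprM mulrC.
by apply: (sqr_subr_Psi_le Lphi phi_orth lam_gt0 lam_mono tau0 alpha0 alpha1 ml_ge0) => //; rewrite DE.
Qed.

(** Minkowski's inequality for finite sums, read off from the L^2 triangle inequality applied to
    combinations of the orthonormal [phi]. *)
Lemma sum_sqrD_le (A B : nat -> R) a b N : 0 <= a -> 0 <= b ->
  \sum_(n < N) A n ^+ 2 <= a ^+ 2 -> \sum_(n < N) B n ^+ 2 <= b ^+ 2 ->
  \sum_(n < N) (A n + B n) ^+ 2 <= (a + b) ^+ 2.
Proof.
move=> a0 b0 Aa Bb; have := L2_triangle (L2_sum A N Lphi) (L2_sum B N Lphi).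
have -> : (fun x => \sum_(n < N) A n * phi n x + \sum_(n < N) B n * phi n x) =
    (fun x => \sum_(n < N) (A n + B n) * phi n x).
  by apply/funext => x; rewrite -big_split; apply: eq_bigr => n _; rewrite mulrDl.
rewrite (inner_partial_sums Lphi phi_orth (fun n => A n + B n) (fun n => A n + B n) N).
rewrite !(inner_partial_sums Lphi phi_orth).
have sq (c : nat -> R) : \sum_(n < N) c n * c n = \sum_(n < N) c n ^+ 2.
  by apply: eq_bigr => n _; rewrite expr2.
rewrite (sq (fun n => A n + B n)) !sq.
set s := \sum_(n < N) (A n + B n) ^+ 2.
have s0 : 0 <= s by apply: sumr_ge0 => n _; exact: sqr_ge0.
have sa : Num.sqrt (\sum_(n < N) A n ^+ 2) <= a by rewrite -[leRHS](ger0_norm a0) -sqrtr_sqr ler_wsqrtr.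
have sb : Num.sqrt (\sum_(n < N) B n ^+ 2) <= b by rewrite -[leRHS](ger0_norm b0) -sqrtr_sqr ler_wsqrtr.
move=> /le_trans /(_ (lerD sa sb)) H.
by rewrite -[leLHS]sqr_sqrtr// lerXn2r ?nnegrE ?addr_ge0.
Qed.

Lemma source_set_sum_sqr_le rho p g N : 0 <= rho -> source_set mu lam phi rho p g ->
  \sum_(n < N) (lam n `^ p * inner mu g (phi n)) ^+ 2 <= rho ^+ 2.
Proof.
move=> rho0 [Lg]; rewrite /Hnorm; set s := (X in sqrte X).
have sN : ((\sum_(n < N) (lam n `^ p * inner mu g (phi n)) ^+ 2)%:E <= s)%E.
  rewrite /s -(big_mkord xpredT (fun n => (lam n `^ p * inner mu g (phi n)) ^+ 2)) -sumEFin.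
  under eq_bigr do rewrite exprMn -powR_mulrn ?powR_ge0// -powRrM mulrC -real_normK ?num_real// mulrC (mulrC p).
  by apply: nneseries_lim_ge => n _ _; rewrite lee_fin mulr_ge0 ?powR_ge0 ?sqr_ge0.
case: s sN => [r||]//=; rewrite !lee_fin => sr rr.
apply: (le_trans sr).
have [r0|r0] := leP r 0; first exact: le_trans r0 (sqr_ge0 _).
by rewrite -[leLHS]sqr_sqrtr ?(ltW r0)// lerXn2r ?nnegrE ?sqrtr_ge0.
Qed.

(** [X] and [Y] stand for uniform bounds of the noise filter and of the bias filter, the latter
    relative to the source weight, so that all four parameter choices share this estimate. *)
Lemma qbv_error_le (q : nat) (beta delta rho p X Y : R) h hd g f fd :
  h \in L2 -> hd \in L2 -> Linf_L2 mu tau f -> Linf_L2 mu tau fd ->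
  (L2norm mu (h \- hd)%R ^+ 2 +
     theta lam * Linf_L2norm mu tau (fun t => f t \- fd t)%R ^+ 2
   <= (delta ^+ 2)%:E)%E ->
  opT mu lam phi tau alpha g = Upsilon mu lam phi tau alpha h f %[ae mu] ->
  0 <= delta -> 0 <= rho -> source_set mu lam phi rho p g -> 0 < beta ->
  0 <= X -> 0 <= Y ->
  (forall n, (E n + beta * lam n ^+ q)^-1 <= X) ->
  (forall n, beta * lam n ^+ q / (E n + beta * lam n ^+ q) <= Y * lam n `^ p) ->
  (L2norm mu (qbv_solution mu lam phi tau alpha q beta hd fd \- g)%R <=
     (Num.sqrt 2 * X * delta + Y * rho)%:E)%E.
Proof.
move=> Lh Lhd ff ffd dd ae delta0 rho0 gS beta0 X0 Y0 EX EY.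
have [Lg _] := gS; set u := qbv_solution _ _ _ _ _ _ _ _ _.
pose D n := E n + beta * lam n ^+ q.
have D0 n : 0 < D n by rewrite addr_gt0 ?eigT_gt0// mulr_gt0// exprn_gt0.
pose U := Upsilon_coef mu lam phi tau alpha h f.
pose Ud := Upsilon_coef mu lam phi tau alpha hd fd.
have DX n : `|(D n)^-1| <= X by rewrite gtr0_norm ?invr_gt0//; exact: EX.
have us : is_L2sum mu phi (fun n => Ud n / D n) u.
  have [K UK] := Upsilon_coef_bounded Lhd ffd.
  apply: (@L2sumP _ (X ^+ 2 * K)) => N; under eq_bigr do rewrite mulrC.
  exact: (sum_sqr_mul_le (c := Ud) X0 DX UK).
have Lu : u \in L2 by case: us.
have Lw := L2B Lu Lg; have [_ _ /(_ _ Lw) ws] := phi_basis.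
apply: (L2sum_norm_le Lphi phi_orth _ ws).
  by rewrite addr_ge0 ?mulr_ge0 ?sqrtr_ge0.
move=> N.
have -> : \sum_(n < N) inner mu (fun x => u x - g x) (phi n) ^+ 2 =
    \sum_(n < N) ((D n)^-1 * (Ud n - U n) +
       - (beta * lam n ^+ q / D n * inner mu g (phi n))) ^+ 2.
  apply: eq_bigr => n _; congr (_ ^+ 2).
  rewrite (innerBl Lu Lg (Lphi n)) (L2sum_coef Lphi phi_orth n us).
  rewrite /U -(eigT_inner n Lg Lh ff ae); move: (inner mu g _) => gn.
  have gE : gn = (D n)^-1 * ((E n + beta * lam n ^+ q) * gn).
    by rewrite -/(D n) mulKf// gt_eqF.
  by rewrite {1}gE; move: (D n)^-1 => Di; ring.
apply: (sum_sqrD_le (A := fun n => (D n)^-1 * (Ud n - U n))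
  (B := fun n => - (beta * lam n ^+ q / D n * inner mu g (phi n)))).
- by rewrite !mulr_ge0 ?sqrtr_ge0.
- by rewrite mulr_ge0.
- rewrite !exprMn sqr_sqrtr//.
  have -> : 2 * X ^+ 2 * delta ^+ 2 = X ^+ 2 * (2 * delta ^+ 2) by ring.
  apply: (sum_sqr_mul_le (c := fun n => Ud n - U n) X0 DX) => M.
  exact: sum_sqr_Upsilon_coef_subr_le.
- rewrite exprMn.
apply: (le_trans _ (ler_wpM2l (sqr_ge0 Y) (source_set_sum_sqr_le N rho0 gS))).
rewrite mulr_sumr; apply: ler_sum => n _; rewrite sqrrN.
have -> (y l v : R) : y ^+ 2 * (l * v) ^+ 2 = (y * l) ^+ 2 * v ^+ 2 by ring.
rewrite [leLHS]exprMn ler_wpM2r ?sqr_ge0// lerXn2r ?nnegrE ?EY//.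
  by rewrite divr_ge0 ?(ltW (D0 n))// mulr_ge0 ?(ltW beta0)// exprn_ge0// ltW.
by rewrite mulr_ge0 ?powR_ge0.
Qed.

End error_estimate.

(** * Filter estimates and rates *)

Section regularization_filters.
Context {R : realType}.
Implicit Types (C e l b w s p : R) (q : nat).

(* Maximizes s^w / (C + s): concavity puts s^w below its tangent at the maximizer C w / (1 - w). *)
Lemma powR_div_le C w s : 0 < C -> 0 <= s -> 0 < w -> w < 1 ->
  s `^ w / (C + s) <= (C * w / (1 - w)) `^ w * ((1 - w) / C).
Proof.
move=> C0 s0 w0 w1; have w1' : 0 < 1 - w by rewrite subr_gt0.
have z0 : 0 < C * w / (1 - w) by rewrite divr_gt0// mulr_gt0.
rewrite ler_pdivrMr ?ltr_pwDl//.
set z := C * w / (1 - w) in z0 *.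
have -> : s = z * (s / z) by rewrite mulrC divfK// gt_eqF.
have x0 : 0 <= s / z by rewrite divr_ge0// ltW.
rewrite {1}powRM// ?(ltW z0)// -mulrA ler_wpM2l ?powR_ge0//.
have w01 : 0 <= w <= 1 by rewrite (ltW w0) (ltW w1).
apply: (le_trans (powR_le_tangent x0 w01)).
have -> : (1 - w) / C * (C + z * (s / z)) = (1 - w) * (C / C) + (w * ((1 - w) / (1 - w)) * (C / C)) * (s / z).
  by rewrite /z; ring.
by rewrite !divff ?gt_eqF//; move: (s / z) => x; lra.
Qed.

Lemma filter_denom_ge C e l b q : 0 < l -> C / l ^+ 2 <= e ->
  (C + b * l ^+ (q + 2)) / l ^+ 2 <= e + b * l ^+ q.
Proof.
move=> l0 Ce; rewrite mulrDl lerD// exprD mulrA mulfK//.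
by rewrite expf_eq0/= gt_eqF.
Qed.

Lemma filter_inv_le C e l b q : 0 < C -> 0 < l -> 0 < b -> C / l ^+ 2 <= e ->
  (e + b * l ^+ q)^-1 <= l ^+ 2 / (C + b * l ^+ (q + 2)).
Proof.
move=> C0 l0 b0 Ce.
have n0 : 0 < (C + b * l ^+ (q + 2)) / l ^+ 2.
  by rewrite divr_gt0 ?exprn_gt0// addr_gt0// mulr_gt0// exprn_gt0.
have -> : l ^+ 2 / (C + b * l ^+ (q + 2)) = ((C + b * l ^+ (q + 2)) / l ^+ 2)^-1.
  by rewrite invfM invrK mulrC.
rewrite lef_pV2 ?posrE//.
  exact: filter_denom_ge.
by apply: lt_le_trans n0 _; exact: filter_denom_ge.
Qed.

Let q2_gt0 q : 0 < q%:R + 2 :> R. Proof. by rewrite ltr_wpDl. Qed.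

Lemma expr_powR l b q w : 0 < l -> 0 < b ->
  l `^ ((q%:R + 2) * w) = (b * l ^+ (q + 2)) `^ w * b `^ (- w).
Proof.
move=> l0 b0; rewrite powRM ?exprn_ge0 ?(ltW l0) ?(ltW b0)//.
rewrite -(@powR_mulrn _ l) ?(ltW l0)// -powRrM natrD mulrAC -powRD.
  by rewrite subrr powRr0 mul1r.
by rewrite (gt_eqF b0) implybT.
Qed.

(** In terms of s = b l^(q+2), l^2 equals s^w b^(-w) with w = 2 / (q + 2), and w < 1 because q is
    not 0. The root of 2 is divided out since [const5] already contains the noise factor. *)
Lemma filter_inv_le_const5 C e l b q : 0 < C -> 0 < l -> 0 < b ->
  C / l ^+ 2 <= e -> q <> 0%N ->
  (e + b * l ^+ q)^-1 <= const5 C q / Num.sqrt 2 * b `^ (- (2 / (q%:R + 2))).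
Proof.
move=> C0 l0 b0 Ce q0; apply: (le_trans (filter_inv_le q C0 l0 b0 Ce)).
have q0' : 0 < q%:R :> R by rewrite ltr0n lt0n; apply/eqP.
have q2 := q2_gt0 q.
have w0 : 0 < 2 / (q%:R + 2) :> R by rewrite divr_gt0.
have w1 : 2 / (q%:R + 2) < 1 :> R by rewrite ltr_pdivrMr// mul1r ltrDr.
have -> : l ^+ 2 = l `^ ((q%:R + 2) * (2 / (q%:R + 2))).
  by rewrite mulrC divfK ?gt_eqF// powR_mulrn// ltW.
rewrite (expr_powR q _ l0 b0) mulrAC; apply: ler_wpM2r; first exact: powR_ge0.
have s0 : 0 <= b * l ^+ (q + 2) by rewrite mulr_ge0 ?exprn_ge0 ?(ltW l0) ?(ltW b0).
apply: (le_trans (powR_div_le C0 s0 w0 w1)).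
have w1E : 1 - 2 / (q%:R + 2) = q%:R / (q%:R + 2) :> R.
  by rewrite -[X in X - _](@divff _ (q%:R + 2)) ?gt_eqF// -mulrBl addrK.
rewrite w1E /const5.
have -> : C * (2 / (q%:R + 2)) / (q%:R / (q%:R + 2)) = 2 * C / q%:R.
  rewrite invfM invrK.
  have -> : C * (2 / (q%:R + 2)) * (q%:R^-1 * (q%:R + 2)) = 2 * C / q%:R * ((q%:R + 2) / (q%:R + 2)) by ring.
  by rewrite divff ?gt_eqF// mulr1.
have -> (r x y : R) : r * x * y / r = x * y * (r / r) by ring.
rewrite divff ?gt_eqF ?sqrtr_gt0// mulr1 ler_wpM2l ?powR_ge0//.
(* The maximum yields q / (C (q + 2)), while [const5] carries the larger q / (C (1 + q)). *)
rewrite -mulrA ler_pM2l// -invfM lef_pV2 ?posrE ?mulr_gt0 ?ltr_wpDr//.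
by rewrite [leRHS]mulrC ler_pM2l// addrC lerD2l ler1n.
Qed.

Lemma filter_le C e l b q : 0 < C -> 0 < l -> 0 < b -> C / l ^+ 2 <= e ->
  b * l ^+ q / (e + b * l ^+ q) <= b * l ^+ (q + 2) / (C + b * l ^+ (q + 2)).
Proof.
move=> C0 l0 b0 Ce; have := filter_inv_le q C0 l0 b0 Ce.
rewrite (exprD l q 2); move: (C + _) => x ex.
by rewrite (mulrA b) -[leRHS]mulrA ler_wpM2l// mulr_ge0 ?exprn_ge0 ?(ltW l0) ?(ltW b0).
Qed.

(** With w = (q + 2 - p) / (q + 2), write s / (C + s) as s^w / (C + s) times s^(1-w): the first
    factor has maximum exactly [const6], the second is b^(p/(q+2)) l^p. *)
Lemma filter_le_const6 C e l b q p : 0 < C -> 0 < l -> 0 < b ->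
  C / l ^+ 2 <= e -> 0 < p -> p < q%:R + 2 ->
  b * l ^+ q / (e + b * l ^+ q) <= const6 C q p * b `^ (p / (q%:R + 2)) * l `^ p.
Proof.
move=> C0 l0 b0 Ce p0 pq; apply: (le_trans (filter_le q C0 l0 b0 Ce)).
have q2 := q2_gt0 q; pose w := (q%:R + 2 - p) / (q%:R + 2) : R.
have w0 : 0 < w by rewrite divr_gt0// subr_gt0.
have w1E : 1 - w = p / (q%:R + 2).
  by rewrite -[X in X - _](@divff _ (q%:R + 2)) ?gt_eqF// -mulrBl opprB addrCA subrr addr0.
have w1 : w < 1 by rewrite -subr_gt0 w1E divr_gt0.
have s0 : 0 < b * l ^+ (q + 2) by rewrite mulr_gt0 ?exprn_gt0.
have -> : const6 C q p = (C * w / (1 - w)) `^ w * ((1 - w) / C).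
  rewrite w1E /const6 -/w; congr (_ `^ w * _); last by rewrite invfM; ring.
  rewrite /w invfM invrK.
  have -> : C * ((q%:R + 2 - p) / (q%:R + 2)) * (p^-1 * (q%:R + 2)) = C * (q%:R + 2 - p) / p * ((q%:R + 2) / (q%:R + 2)) by ring.
  by rewrite divff ?gt_eqF// mulr1.
rewrite -[leRHS]mulrA.
have -> : b `^ (p / (q%:R + 2)) * l `^ p = (b * l ^+ (q + 2)) `^ (1 - w).
  rewrite -w1E powRM ?exprn_ge0 ?(ltW l0) ?(ltW b0)//; congr (_ * _).
  rewrite -(@powR_mulrn _ l) ?(ltW l0)// -powRrM natrD w1E mulrC divfK ?gt_eqF//.
have := powR_div_le C0 (ltW s0) w0 w1.
move/(ler_wpM2r (powR_ge0 (b * l ^+ (q + 2)) (1 - w))).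
rewrite mulrAC -powRD ?(gt_eqF s0) ?implybT// addrC subrK powRr1 ?(ltW s0)//.
Qed.

(** The saturated range: dropping s from the denominator leaves b l^(q+2) / C, and the surplus power
    l^(p-q-2) is bounded below by its value at [l0]. The order in b stays 1 however large p is. *)
Lemma filter_le_const7 C e l l0 b q p : 0 < C -> 0 < l0 -> l0 <= l -> 0 < b ->
  C / l ^+ 2 <= e -> q%:R + 2 <= p ->
  b * l ^+ q / (e + b * l ^+ q) <= const7 C l0 q p * b * l `^ p.
Proof.
move=> C0 l00 l0l b0 Ce pq; have lp : 0 < l by exact: lt_le_trans l0l.
apply: (le_trans (filter_le q C0 lp b0 Ce)).
have s0 : 0 < l ^+ (q + 2) by rewrite exprn_gt0.
have -> : l `^ p = l `^ (p - q%:R - 2) * l ^+ (q + 2).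
  rewrite -powR_mulrn ?(ltW lp)// -powRD ?(gt_eqF lp) ?implybT// natrD.
  by congr (_ `^ _); ring.
apply: (@le_trans _ _ (b * l ^+ (q + 2) / C)).
  rewrite ler_pM2l ?mulr_gt0// lef_pV2 ?posrE//; last by rewrite addr_gt0// mulr_gt0.
  by rewrite lerDl ltW// mulr_gt0.
have -> (x y : R) : const7 C l0 q p * b * (x * y) = b * y / C * (x / l0 `^ (p - q%:R - 2)).
  by rewrite /const7 invfM; ring.
rewrite ler_peMr//; first by rewrite divr_ge0 ?(ltW C0)// ltW// mulr_gt0.
rewrite ler_pdivlMr ?powR_gt0// mul1r ge0_ler_powR ?nnegrE ?(ltW l00) ?(ltW lp)//.
by rewrite -addrA -opprD subr_ge0.
Qed.

End regularization_filters.

Section convergence_rate.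
Context {R : realType}.
Implicit Types (A C x y e k c b delta rho : R).

(** With r = delta / rho both terms are at most multiples of rho r^e' = rho^e delta^e'. The exponent
    k balances them: k x + k y = 1. *)
Lemma parameter_choice_rate A C x y e e' k c c' b delta rho :
  0 <= A -> 0 <= C -> 0 <= x -> 0 <= y -> k * x = e -> k * y = e' -> e + e' = 1 ->
  0 < delta -> 0 < rho -> 0 < b -> 0 < c -> 0 < c' ->
  comparable_to c c' b ((delta / rho) `^ k) ->
  A * b `^ (- x) * delta + C * b `^ y * rho <=
  (1 + (A * c `^ (- x) + C * c' `^ y)) * rho `^ e * delta `^ e'.
Proof.
move=> A0 C0 x0 y0 kx ky ee delta0 rho0 b0 c0 c'0 [bc bc'].
set r := delta / rho in bc bc'.
have r0 : 0 < r by rewrite divr_gt0.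
have rk0 : 0 < r `^ k by rewrite powR_gt0.
have deltaE : delta = r * rho by rewrite divfK ?gt_eqF.
have ZE : rho `^ e * delta `^ e' = rho * r `^ e'.
  rewrite {1}deltaE powRM ?(ltW r0) ?(ltW rho0)// mulrCA -powRD ?(gt_eqF rho0) ?implybT//.
  by rewrite ee powRr1 ?(ltW rho0)// mulrC.
have Z0 : 0 <= rho * r `^ e' by rewrite mulr_ge0 ?powR_ge0 ?(ltW rho0).
have bx : b `^ (- x) <= c `^ (- x) * r `^ (- e).
  rewrite -kx -mulrN powRrM -powRM ?(ltW c0) ?powR_ge0// !powRN.
  rewrite lef_pV2 ?posrE ?powR_gt0 ?mulr_gt0// ge0_ler_powR ?nnegrE ?(ltW b0)//.
  by rewrite mulr_ge0 ?(ltW c0) ?(ltW rk0).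
have by' : b `^ y <= c' `^ y * r `^ e'.
  rewrite -ky powRrM -powRM ?(ltW c'0) ?powR_ge0// ge0_ler_powR ?nnegrE ?(ltW b0)//.
  by rewrite mulr_ge0 ?(ltW c'0) ?(ltW rk0).
have rdelta : r `^ (- e) * delta = rho * r `^ e'.
  rewrite {1}deltaE mulrA mulrC; congr (_ * _).
  have -> : r `^ e' = r `^ (- e) * r `^ 1.
    by rewrite -powRD ?(gt_eqF r0) ?implybT// -ee addKr.
  by rewrite powRr1 ?(ltW r0).
rewrite -[leRHS]mulrA ZE mulrDl mul1r ler_wpDl// mulrDl; apply: lerD.
  rewrite -rdelta -[leRHS]mulrA -mulrA ler_wpM2l// mulrA ler_wpM2r ?(ltW delta0)//.
rewrite (mulrC rho) -mulrA -[leRHS]mulrA ler_wpM2l// mulrA ler_wpM2r ?(ltW rho0)//.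
Qed.

End convergence_rate.

(** * The four parameter choices *)

Theorem theorem4p6 (R : realType) :
  exists (tC8 : R -> R -> R -> R -> R) (tC9 : R -> R -> R -> R)
         (C8 : R -> R -> R -> nat -> R -> R -> R)
         (C9 : R -> R -> nat -> R -> R -> R),
  [/\ forall C6 p c' c'', 0 < tC8 C6 p c' c'',
      forall C7 c' c'', 0 < tC9 C7 c' c'',
      forall C5 C6 p q c' c'', 0 < C8 C5 C6 p q c' c'' &
      forall C5 C7 q c' c'', 0 < C9 C5 C7 q c' c''] /\
  forall (d : nat) (Omega : set 'rV[R]_d) (oO : open Omega)
    (lam : nat -> R) (phi : nat -> 'rV[R]_d -> R) (tau alpha C1 C2 : R)
    (q : nat) (delta rho p c' c'' beta : R)
    (h hd g : 'rV[R]_d -> R) (f fd : R -> 'rV[R]_d -> R),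
  let mu := lebesgue_on oO in
  let C4 := const4 C1 alpha (lam 0%N) tau in
  let C5 := const5 C4 q in
  let C6 := const6 C4 q p in
  let C7 := const7 C4 (lam 0%N) q p in
  let err := L2norm mu
    (qbv_solution mu lam phi tau alpha q beta hd fd \- g) in
  (1 <= d <= 7)%N ->
  Omega !=set0 -> connected Omega -> bounded_set Omega ->
  Ck_boundary 2 Omega ->
  dirichlet_eigensystem oO lam phi ->
  0 < tau -> 0 < alpha < 1 ->
  0 < C1 -> 0 < C2 ->
  (forall x, x <= 0 ->
     C1 / Gamma (1 - alpha) * (1 / (1 - x)) <= mittag_leffler alpha 1 x
       <= C2 / Gamma (1 - alpha) * (1 / (1 - x))) ->
  0 < delta ->
  h \in Lfun mu 2%:E -> hd \in Lfun mu 2%:E ->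
  Linf_L2 mu tau f -> Linf_L2 mu tau fd ->
  (L2norm mu (h \- hd)%R ^+ 2 +
     theta lam * Linf_L2norm mu tau (fun t => f t \- fd t)%R ^+ 2
   <= (delta ^+ 2)%:E)%E ->
  opT mu lam phi tau alpha g = Upsilon mu lam phi tau alpha h f %[ae mu] ->
  0 < rho -> 0 < p -> source_set mu lam phi rho p g ->
  0 < beta -> 0 < c' -> 0 < c'' ->
  [/\ (* (i) *)
      q = 0%N -> p < 2 ->
      comparable_to c' c'' beta ((delta / rho) `^ (2 / (p + 2))) ->
      (err <= (tC8 C6 p c' c'' *
               rho `^ (2 / (p + 2)) * delta `^ (p / (p + 2)))%:E)%E,
      (* (ii) *)
      q = 0%N -> 2 <= p ->
      comparable_to c' c'' beta ((delta / rho) `^ (1 / 2)) ->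
      (err <= (tC9 C7 c' c'' * rho `^ (1 / 2) * delta `^ (1 / 2))%:E)%E,
      (* (iii) *)
      q <> 0%N -> p < q%:R + 2 ->
      comparable_to c' c'' beta
        ((delta / rho) `^ ((q%:R + 2) / (p + 2))) ->
      (err <= (C8 C5 C6 p q c' c'' *
               rho `^ (2 / (p + 2)) * delta `^ (p / (p + 2)))%:E)%E &
      (* (iv) *)
      q <> 0%N -> q%:R + 2 <= p ->
      comparable_to c' c'' beta
        ((delta / rho) `^ ((q%:R + 2) / (q%:R + 4))) ->
      (err <= (C9 C5 C7 q c' c'' *
               rho `^ (2 / (q%:R + 4)) *
               delta `^ ((q%:R + 2) / (q%:R + 4)))%:E)%E].
Proof.
(* The summand 1 and the absolute values make the constants positive for arbitrary real arguments,
   as the statement demands. *)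
exists (fun C6 p c' c'' => 1 + (Num.sqrt 2 * c' `^ (- 1) + `|C6| * c'' `^ (p / 2))),
  (fun C7 c' c'' => 1 + (Num.sqrt 2 * c' `^ (- 1) + `|C7| * c'' `^ 1)),
  (fun C5 C6 p q c' c'' => 1 + (`|C5| * c' `^ (- (2 / (q%:R + 2))) +
     `|C6| * c'' `^ (p / (q%:R + 2)))),
  (fun C5 C7 q c' c'' => 1 + (`|C5| * c' `^ (- (2 / (q%:R + 2))) + `|C7| * c'' `^ 1)).
split.
  by split=> *; rewrite ltr_pwDl// addr_ge0// mulr_ge0 ?sqrtr_ge0 ?powR_ge0.
move=> d Omega oO lam phi tau alpha C1 C2 q delta rho p c' c'' beta h hd g f fd.
move=> mu C4 C5 C6 C7 err _ _ _ _ _ [[lam0 _ lam_mono _] basis _ _] tau0.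
move=> /andP[alpha0 alpha1] C10 C20 ml delta0 Lh Lhd ff ffd dd ae rho0 p0 gS beta0 c'0 c''0.
have C40 : 0 < C4 by exact: const4_gt0.
have EC n : C4 / lam n ^+ 2 <= eigT lam tau alpha n by exact: (eigT_ge tau lam0 lam_mono alpha1 C10 ml).
have E0 n : 0 < eigT lam tau alpha n by exact: (eigT_gt0 tau lam0 lam_mono alpha1 C10 ml).
have lp n := lam_pos lam0 lam_mono n.
have errXY X Y : 0 <= X -> 0 <= Y ->
    (forall n, (eigT lam tau alpha n + beta * lam n ^+ q)^-1 <= X) ->
    (forall n, beta * lam n ^+ q / (eigT lam tau alpha n + beta * lam n ^+ q) <= Y * lam n `^ p) ->
    (err <= (Num.sqrt 2 * X * delta + Y * rho)%:E)%E.
  exact: (qbv_error_le basis lam0 lam_mono tau0 alpha0 alpha1 C10 C20 ml Lh Lhd ff ffd dd ae (ltW delta0) (ltW rho0) gS beta0).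
(* For q = 0 the exponent w would reach 1 and the maximization degenerates; positivity of E alone
   bounds the noise filter by 1 / beta. *)
have X0 : q = 0%N -> forall n, (eigT lam tau alpha n + beta * lam n ^+ q)^-1 <= beta `^ (- 1).
  move=> -> n; rewrite expr0 mulr1 powR_inv1 ?(ltW beta0)// lef_pV2 ?posrE ?addr_gt0//.
  by rewrite lerDr ltW.
have Xq : q <> 0%N -> forall n, (eigT lam tau alpha n + beta * lam n ^+ q)^-1 <=
    `|C5| / Num.sqrt 2 * beta `^ (- (2 / (q%:R + 2))).
  move=> q0 n; apply: (le_trans (filter_inv_le_const5 C40 (lp n) beta0 (EC n) q0)).
  by rewrite ler_wpM2r ?powR_ge0// ler_wpM2r ?invr_ge0 ?sqrtr_ge0// ler_norm.
have Y6 : p < q%:R + 2 -> forall n, beta * lam n ^+ q / (eigT lam tau alpha n + beta * lam n ^+ q) <=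
    `|C6| * beta `^ (p / (q%:R + 2)) * lam n `^ p.
  move=> pq n; apply: (le_trans (filter_le_const6 C40 (lp n) beta0 (EC n) p0 pq)).
  by rewrite ler_wpM2r ?powR_ge0// ler_wpM2r ?powR_ge0// ler_norm.
have Y7 : q%:R + 2 <= p -> forall n, beta * lam n ^+ q / (eigT lam tau alpha n + beta * lam n ^+ q) <=
    `|C7| * beta `^ 1 * lam n `^ p.
  move=> pq n; rewrite powRr1 ?(ltW beta0)//.
  apply: (le_trans (filter_le_const7 C40 lam0 (lam0_le lam_mono n) beta0 (EC n) pq)).
  by rewrite ler_wpM2r ?powR_ge0// ler_wpM2r ?(ltW beta0)// ler_norm.
have sqrt2K (x : R) : Num.sqrt 2 * (`|C5| / Num.sqrt 2 * x) = `|C5| * x.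
  have -> : Num.sqrt 2 * (`|C5| / Num.sqrt 2 * x) = `|C5| * x * (Num.sqrt 2 / Num.sqrt 2) by ring.
  by rewrite divff ?mulr1// gt_eqF// sqrtr_gt0.
have q20 : 0 < q%:R + 2 :> R by rewrite ltr_wpDl.
have q40 : 0 < q%:R + 4 :> R by rewrite ltr_wpDl.
have p20 : 0 < p + 2 by rewrite addr_gt0.
have pe : 2 / (p + 2) + p / (p + 2) = 1 by rewrite -mulrDl addrC divff// gt_eqF.
split=> [q0 p2 bb|q0 p2 bb|q0 pq bb|q0 pq bb].
- have pq : p < q%:R + 2 by rewrite q0 add0r.
  apply: (le_trans (errXY _ _ (powR_ge0 _ _) _ (X0 q0) (Y6 pq))).
    by rewrite mulr_ge0 ?powR_ge0.
  rewrite lee_fin q0 add0r; apply: parameter_choice_rate bb => //.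
  + by rewrite divr_ge0 ?(ltW p0).
  + by rewrite mulr1.
  + by rewrite mulrC mulrA divfK.
- have pq : q%:R + 2 <= p by rewrite q0 add0r.
  apply: (le_trans (errXY _ _ (powR_ge0 _ _) _ (X0 q0) (Y7 pq))).
    by rewrite mulr_ge0 ?powR_ge0.
  rewrite lee_fin; apply: parameter_choice_rate bb => //; rewrite ?mulr1//; lra.
- apply: (le_trans (errXY _ _ _ _ (Xq q0) (Y6 pq))).
  + by rewrite !mulr_ge0 ?powR_ge0 ?invr_ge0 ?sqrtr_ge0.
  + by rewrite mulr_ge0 ?powR_ge0.
  rewrite lee_fin sqrt2K; apply: parameter_choice_rate bb => //.
  + by rewrite divr_ge0 ?(ltW q20) ?(ltW p0).
  + by rewrite mulrC mulrA divfK// gt_eqF.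
  + by rewrite mulrC mulrA divfK// gt_eqF.
- apply: (le_trans (errXY _ _ _ _ (Xq q0) (Y7 pq))).
  + by rewrite !mulr_ge0 ?powR_ge0 ?invr_ge0 ?sqrtr_ge0.
  + by rewrite mulr_ge0 ?powR_ge0.
  rewrite lee_fin sqrt2K; apply: parameter_choice_rate bb => //.
  + by rewrite mulrC mulrA divfK// gt_eqF.
  + by rewrite mulr1.
  + rewrite -mulrDl.
    have -> : 2 + (q%:R + 2) = q%:R + 4 :> R by lra.
    by rewrite divff// gt_eqF.
Qed.
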